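(* Let $d\ge3$, $D>0$, and let $c_0>0$. There is a positive constant $K$, depending on $c_0$ and diverging as $c_0\to+\infty$, such that the Gagliardo--Nirenberg inequality $$\|v\|_2^2\le K\,I_{m_*}[v]^{1/3}\,\|v\|_1^{4/3}$$ holds for all $v\in L^2(\mathbb{R}^d,d\mu_* )\cap\mathrm{Dom}(I_{m_*})$ such that $I_{m_*}[v]/\|v\|_1^2\le c_0$.
   Context: $m_*=(d-4)/(d-2)$, $d\mu_*(x)=(D+|x|^2)^{-d/2}dx$, and $\|\cdot\|_p$ is the norm of $L^p(\mathbb{R}^d,d\mu_* )$. $I_{m_*}$ is the closure in $L^2(\mathbb{R}^d,d\mu_* )$ of the quadratic form $I_{m_*}[v]=\int_{\mathbb{R}^d}|\nabla v(x)|^2(D+|x|^2)^{-(d-2)/2}dx$, $v\in C_c^\infty(\mathbb{R}^d)$, and $\mathrm{Dom}(I_{m_*})$ is the domain of this closure. *)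

(* Defs.v *)
From HB Require Import structures.
From mathcomp Require Import all_boot all_order all_algebra.
From mathcomp Require Import all_classical all_reals all_analysis.
From mathcomp Require Import measurable_realfun.

Set Implicit Arguments.
Unset Strict Implicit.
Unset Printing Implicit Defensive.

Import Order.TTheory GRing.Theory Num.Theory.
Import numFieldNormedType.Exports.

Local Open Scope classical_set_scope.
Local Open Scope ring_scope.

(* Points of R^n are row vectors ['rV[R]_n]. Their sigma-algebra is the one
   generated by the coordinates, i.e. the Borel one. *)
Definition rV_display : measure_display -> measure_display.
Proof. exact. Qed.

Section measurable_rV.
Context {d} {T : measurableType d}.
Variable n : nat.

Let coords : 'I_n -> 'rV[T]_n -> T := fun i x => x ord0 i.

Let rV_set0 : g_sigma_preimage coords set0.
Proof. exact: sigma_algebra0. Qed.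

Let rV_setC A : g_sigma_preimage coords A -> g_sigma_preimage coords (~` A).
Proof. exact: sigma_algebraC. Qed.

Let rV_bigcup (F : (set 'rV[T]_n)^nat) :
  (forall i, g_sigma_preimage coords (F i)) ->
  g_sigma_preimage coords (\bigcup_i (F i)).
Proof. exact: sigma_algebra_bigcup. Qed.

HB.instance Definition _ := @isMeasurable.Build (rV_display d)
  'rV[T]_n (g_sigma_preimage coords) rV_set0 rV_setC rV_bigcup.

End measurable_rV.

Lemma measurable_coord d (T : measurableType d) n (i : 'I_n) :
  measurable_fun [set: 'rV[T]_n] (fun x : 'rV[T]_n => x ord0 i).
Proof.
move=> _ Y mY; rewrite setTI; apply: sub_sigma_algebra => /=.
rewrite -bigcup_seq/=; exists i => /=; first by rewrite mem_index_enum.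
by exists Y => //; rewrite setTI.
Qed.

Lemma measurable_fun_coordP d1 d2 (T1 : measurableType d1)
    (T2 : measurableType d2) n (f : T1 -> 'rV[T2]_n) :
  (forall i, measurable_fun [set: T1] (fun x => f x ord0 i)) ->
  measurable_fun [set: T1] f.
Proof.
move=> mf.
suff : g_sigma_preimage (fun i x => f x ord0 i) `<=` @measurable _ T1.
  rewrite (@g_sigma_preimage_comp _ _ n 'rV[T2]_n
    (fun i x => x ord0 i) _ f) => prefS _ A mA.
  by apply: prefS; exists A.
apply: smallest_sub; first exact: sigma_algebra_measurable.
case: n => [|n] in f mf *; first by rewrite big_ord0.
rewrite -bigcup_mkord_ord; apply: bigcup_sub => i Ii.
by move=> A [B mB <-]; exact: mf.
Qed.

Section lebesgue_rV.
Context {R : realType}.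

Definition cons_rV n (p : measurableTypeR R * 'rV[measurableTypeR R]_n) :
  'rV[measurableTypeR R]_n.+1 := row_mx (p.1)%:M p.2.

Lemma cons_rV0 n p : @cons_rV n p ord0 ord0 = p.1.
Proof.
rewrite /cons_rV.
rewrite (_ : ord0 = lshift n (ord0 : 'I_1)); last exact/val_inj.
by rewrite (row_mxEl (p.1)%:M) mxE eqxx.
Qed.

Lemma cons_rVS n p i : @cons_rV n p ord0 (lift ord0 i) = p.2 ord0 i.
Proof.
rewrite /cons_rV (_ : lift ord0 i = rshift 1 i); last exact/val_inj.
by rewrite (row_mxEr (p.1)%:M).
Qed.

Lemma measurable_cons_rV n : measurable_fun setT (@cons_rV n).
Proof.
apply: measurable_fun_coordP => i.
have [->|[j ->]] : i = ord0 \/ exists j, i = lift ord0 j.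
  by case: (unliftP ord0 i) => [j ->|->]; [right; exists j|left].
- by under eq_fun do rewrite cons_rV0; exact: measurable_fst.
- under eq_fun do rewrite cons_rVS.
  exact: (measurableT_comp (measurable_coord j) measurable_snd).
Qed.


Section step.
Variables (n : nat)
  (m : {sigma_finite_measure set 'rV[measurableTypeR R]_n -> \bar R}).

Definition lebesgue_rV_step : set 'rV[measurableTypeR R]_n.+1 -> \bar R :=
  pushforward (lebesgue_measure \x m)%E (@cons_rV n).

Let measurable_cons_preimage A : measurable A ->
  measurable (@cons_rV n @^-1` A).
Proof. by rewrite -[X in _ -> measurable X]setTI; exact: measurable_cons_rV. Qed.

Let step0 : lebesgue_rV_step set0 = 0%E.
Proof. by rewrite /lebesgue_rV_step /pushforward preimage_set0 measure0. Qed.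

Let step_ge0 A : (0 <= lebesgue_rV_step A)%E.
Proof. by rewrite /lebesgue_rV_step /pushforward. Qed.

Let step_sigma_additive : semi_sigma_additive lebesgue_rV_step.
Proof.
move=> F mF tF mUF; rewrite /lebesgue_rV_step /pushforward preimage_bigcup.
apply: measure_semi_sigma_additive.
- by move=> k; exact: measurable_cons_preimage.
- apply/trivIsetP => /= i j _ _ ij; rewrite -preimage_setI.
  by move/trivIsetP : tF => /(_ _ _ _ _ ij) ->//; rewrite preimage_set0.
- by rewrite -preimage_bigcup; exact: measurable_cons_preimage.
Qed.

HB.instance Definition _ := isMeasure.Build _ _ _ lebesgue_rV_step
  step0 step_ge0 step_sigma_additive.

Let step_sigma_finite : sigma_finite setT lebesgue_rV_step.
Proof.
have /sigma_finiteP[F [TF ndF Foo]] := sigma_finiteT (@lebesgue_measure R).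
have /sigma_finiteP[G [TG ndG Goo]] := sigma_finiteT m.
pose tl (x : 'rV[measurableTypeR R]_n.+1) :=
  (x ord0 ord0, \row_i x ord0 (lift ord0 i)).
have tlK p : tl (cons_rV p) = p.
  case: p => a y; congr pair; first by rewrite cons_rV0.
  by apply/rowP => i; rewrite mxE cons_rVS.
have mtl : measurable_fun setT tl.
  apply: measurable_fun_pair; first exact: measurable_coord.
  apply: measurable_fun_coordP => i; under eq_fun do rewrite mxE.
  exact: measurable_coord.
exists (fun k => tl @^-1` (F k `*` G k)).
  apply/esym/seteqP; split => // x _.
  have [k _ Fk] : (\bigcup_k F k) (tl x).1 by rewrite -TF.
  have [l _ Gl] : (\bigcup_k G k) (tl x).2 by rewrite -TG.
  exists (maxn k l) => //; split.
    by move: Fk; exact/subsetPset/ndF/leq_maxl.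
  by move: Gl; exact/subsetPset/ndG/leq_maxr.
move=> k; have [mF Fkoo] := Foo k; have [mG Gkoo] := Goo k; split.
  by rewrite -[X in measurable X]setTI; apply: mtl => //; exact: measurableX.
rewrite /lebesgue_rV_step /pushforward -comp_preimage.
rewrite (_ : tl \o _ = id); last exact/funext.
by rewrite preimage_id product_measure1E// lte_mul_pinfty// ge0_fin_numE.
Qed.

HB.instance Definition _ := Measure_isSigmaFinite.Build _ _ _
  lebesgue_rV_step step_sigma_finite.

End step.

(* Lebesgue measure on R^n, as an iterated product. *)
Fixpoint lebesgue_rV n :
    {sigma_finite_measure set 'rV[measurableTypeR R]_n -> \bar R} :=
  match n with
  | 0 => \d_(0 : 'rV[measurableTypeR R]_0)
  | n'.+1 => lebesgue_rV_step (lebesgue_rV n')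
  end.

Lemma lebesgue_rV_box n (A : 'I_n -> set (measurableTypeR R)) :
  (forall i, measurable (A i)) ->
  lebesgue_rV n [set x | forall i, A i (x ord0 i)] =
    (\prod_(i < n) lebesgue_measure (A i))%E.
Proof.
elim: n A => [|n IH] A mA.
  rewrite big_ord0 /= diracE mem_set//= => -[]//.
pose B := [set x : 'rV[measurableTypeR R]_n |
  forall i, A (lift ord0 i) (x ord0 i)].
have mB : measurable B.
  rewrite (_ : B = \bigcap_(i in [set: 'I_n])
      ((fun x : 'rV[measurableTypeR R]_n => x ord0 i) @^-1` A (lift ord0 i))).
    apply: fin_bigcap_measurable => // i _.
    by rewrite -[X in measurable X]setTI; exact: measurable_coord.
  by apply/seteqP; split => x Bx i; [move=> _|]; exact: Bx.
rewrite big_ord_recl -IH//= /lebesgue_rV_step /pushforward.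
rewrite (_ : _ @^-1` _ = A ord0 `*` B); first by rewrite product_measure1E.
apply/seteqP; split => p /=.
  move=> Ap; split => [|i]; first by rewrite -[p.1]cons_rV0; exact: Ap.
  by rewrite -cons_rVS; exact: Ap.
move=> [Ap Bp] i.
by have [j ->|->] := unliftP ord0 i; rewrite ?cons_rV0 ?cons_rVS//; exact: Bp.
Qed.

End lebesgue_rV.

Section mu_star.
Context {R : realType} {d : nat}.
Implicit Types (D : R) (x : 'rV[R]_d).

(* The norm [`|x|] of the library is the sup norm, hence this definition. *)
Definition sqnorm x : R := \sum_(i < d) x ord0 i ^+ 2.

Definition mu_star D (A : set 'rV[measurableTypeR R]_d) : \bar R :=
  (\int[lebesgue_rV d]_(x in A) ((D + sqnorm x) `^ (- (d%:R / 2)))%:E)%E.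

Lemma measurable_density D (p : R) :
  measurable_fun [set: 'rV[measurableTypeR R]_d]
    (EFin \o (fun x => (D + sqnorm x) `^ p)).
Proof.
apply/measurable_EFinP/(measurableT_comp (measurable_powR p)).
apply: measurable_funD => //; apply: measurable_sum => i.
have mc : measurable_fun [set: 'rV[measurableTypeR R]_d]
  (fun x => x ord0 i : R) := measurable_coord i.
exact: measurable_funX mc.
Qed.

Let mu_star0 D : mu_star D set0 = 0%E.
Proof. by rewrite /mu_star integral_set0. Qed.

Let mu_star_ge0 D A : (0 <= mu_star D A)%E.
Proof. by apply: integral_ge0 => x _; rewrite lee_fin powR_ge0. Qed.

Let mu_star_sigma_additive D : semi_sigma_additive (mu_star D).
Proof.
apply: semi_sigma_additive_nng_induced; first exact: measurable_density.
by move=> x; rewrite lee_fin powR_ge0.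
Qed.

HB.instance Definition _ D := isMeasure.Build _ _ _ (mu_star D)
  (mu_star0 D) (@mu_star_ge0 D) (@mu_star_sigma_additive D).

End mu_star.

Section fast_diffusion.
Context {R : realType} {d : nat}.
Implicit Types (D : R) (v f : 'rV[R]_d -> R) (x : 'rV[R]_d).

Definition partial_derivative (i : 'I_d) f x : R := 'D_(delta_mx ord0 i) f x.

Definition sqgrad f x : R := \sum_(i < d) partial_derivative i f x ^+ 2.

(* [f] is of class C^k: its iterated partial derivatives of order at most [k]
   exist and are continuous on the whole space. *)
Fixpoint class_C (k : nat) f : Prop :=
  if k is k'.+1 then
    continuous f /\
    forall i : 'I_d, (forall x, derivable f x (delta_mx ord0 i)) /\
                     class_C k' (partial_derivative i f)
  else continuous f.

(* C_c^oo(R^d) *)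
Definition test_function f : Prop :=
  (forall k, class_C k f) /\ compact (closure [set x | f x != 0]).

(* I_{m_*}, where m_* = (d-4)/(d-2), on test functions. *)
Definition dirichlet_form D f : \bar R :=
  (\int[lebesgue_rV d]_x
     (sqgrad f x * (D + sqnorm x) `^ (- ((d%:R - 2) / 2)))%:E)%E.

(* The sequence [phi] of test functions converges to [v] in L^2(mu_star D) and
   is Cauchy for the form. *)
Definition form_approximation D v (phi : ('rV[R]_d -> R)^nat) : Prop :=
  [/\ forall n, test_function (phi n),
      ('N[mu_star D]_2%:E[EFin \o (phi n \- v)%R] @[n --> \oo] --> 0)%E &
      forall e : R, 0 < e -> exists N : nat,
        forall m n, (N <= m)%N -> (N <= n)%N ->
          (dirichlet_form D (phi m \- phi n)%R <= e%:E)%E].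

Definition form_domain D : set ('rV[R]_d -> R) :=
  [set v | v \in Lfun (mu_star D) 2%:E /\ exists phi, form_approximation D v phi].

(* The closure of the form on its domain: the limit of [dirichlet_form D] along
   an approximation [phi] of [v]. The form is closable, so this limit does not
   depend on [phi]. *)
Definition closed_form D v : \bar R :=
  get [set J : \bar R | exists2 phi, form_approximation D v phi &
                        dirichlet_form D (phi n) @[n --> \oo] --> J].

(* The conventions of [\bar R] (0 * +oo = 0, 0^-1 = +oo, +oo^-1 = 0) cover the
   degenerate cases: if [v] = 0 a.e., then the ratio is 0 and the conclusion
   reads 0 <= 0; if [v] is not integrable, then the ratio is 0 and the
   right-hand side of the conclusion is +oo, because the form vanishes only
   on constants and [mu_star D] is infinite. *)
Definition gagliardo_nirenberg_on D (c0 K : R) : Prop :=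
  forall v, v \in Lfun (mu_star D) 2%:E -> form_domain D v ->
    (closed_form D v / 'N[mu_star D]_1[EFin \o v] ^+ 2 <= c0%:E)%E ->
    ('N[mu_star D]_2%:E[EFin \o v] ^+ 2 <=
       K%:E * closed_form D v `^ (1 / 3)%R
            * 'N[mu_star D]_1[EFin \o v] `^ (4 / 3)%R)%E.

End fast_diffusion.

Arguments gagliardo_nirenberg_on {R} d D c0 K.

(* Main.v *)
Require Import Defs.
From mathcomp Require Import all_boot all_order all_algebra.
From mathcomp Require Import all_classical all_reals all_analysis.
From mathcomp Require Import measurable_realfun.
From mathcomp Require Import ring lra.

(* Let B_k = [-2^k, 2^k]^d, a_k the mean of |v| over B_k, and V_k the mean of
   (v x - v y)^2 over B_k x B_k. Up to constants, (D + |x|^2)^(-p/2) is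
   sum_k 2^(-pk) 1_(B_k)(x), so that the squared L^2 norm is at most
   sum_k (V_k + a_k^2), the L^1 norm is at least sum_k a_k, and Poincare's
   inequality on cubes bounds sum_k V_k by the energy J. Since a drop from
   a_k to a_(k+1) is at most sqrt(2^d V_(k+1)), a discrete Nash inequality gives
   S^3 <= C J N1^4 for S = sum_k a_k^2, while J <= c0 N1^2 bounds the remaining
   term J by c0^(2/3) (J N1^4)^(1/3). Hence K = C (1 + c0) is admissible.

   No bounded K is: for a bump function at scale eps, the inequality reads
   eps^d <= K C (eps^(d-2))^(1/3) (eps^d)^(4/3), which forces K to blow up as
   eps -> 0. There the closed form of a test function f has to be compared with
   dirichlet_form D f: the form is closable, by integration by parts. *)
Set Implicit Arguments.
Unset Strict Implicit.
Unset Printing Implicit Defensive.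

Import Order.TTheory GRing.Theory Num.Theory.
Import numFieldNormedType.Exports.
Local Open Scope classical_set_scope.
Local Open Scope ring_scope.

(** * Integration with respect to densities, and Tonelli's theorem on rectangles *)

(** The exponents do not depend on [d] because the two weights turn space into a half-line of
    scales. On [B_k], the factor [4^k] of Poincare's inequality is exactly the ratio of the two
    dyadic weights, so all scales contribute with the same constant and only the sequence [a_k]
    remains. Its inequality is Nash's inequality in dimension one, the variable being log |x|. The
    variances escape it: they are bounded by [J] linearly, and this is the term that needs [c0]. The
    condition [3 <= d] makes [2^(-(d-2)k)] decay, so that the weight of the form is comparable with
    its dyadic sum.

    A function in the domain of the form is merely measurable, whereas Poincare's inequality needs
    derivatives. The two meet in the oscillations, which are stable under L^2 perturbations
    uniformly in the number of scales. For the upper bound any approximating sequence will do, so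
    the choice made by [get] in [closed_form] is harmless there. The blow-up needs an upper bound on
    that choice, and this is where closability enters; a bound up to a factor 2 is enough. *)

Section density.
Context d (T : measurableType d) (R : realType).
Variables (m nu : {measure set T -> \bar R}) (w : T -> R).
Hypothesis mw : measurable_fun setT w.
Hypothesis w0 : forall x, 0 <= w x.
Hypothesis nuE : forall A, measurable A ->
  nu A = (\int[m]_(x in A) (w x)%:E)%E.
Local Open Scope ereal_scope.
Import HBNNSimple.

(** By monotone convergence both sides are limits along the simple functions [h n]. For these,
    linearity reduces the identity to [nuE] on level sets. *)
Lemma integral_density (f : T -> \bar R) : measurable_fun setT f ->
  (forall x, 0 <= f x) -> \int[nu]_x f x = \int[m]_x (f x * (w x)%:E).
Proof.
move=> mf f0.
have mw' : measurable_fun setT (fun x => (w x)%:E) by exact/measurable_EFinP.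
have w0' x : 0 <= (w x)%:E by rewrite lee_fin.
pose h := nnsfun_approx measurableT mf.
have fE x : f x = lim ((EFin \o h n) x @[n --> \oo]).
  by apply/esym/cvg_lim => //; exact: cvg_nnsfun_approx.
have -> : \int[nu]_x f x = lim (\int[nu]_x (EFin \o h n) x @[n --> \oo]).
  under eq_integral => x _ do rewrite fE.
  apply: monotone_convergence => //.
  - by move=> n; apply/measurable_EFinP; exact/measurable_funP.
  - by move=> n x Ex //=; rewrite lee_fin.
  - by move=> x Ex a b ab; rewrite lee_fin; exact/lefP/nd_nnsfun_approx.
have -> : \int[m]_x (f x * (w x)%:E) =
    lim (\int[m]_x ((EFin \o h n) x * (w x)%:E) @[n --> \oo]).
  have fg x : f x * (w x)%:E = lim ((EFin \o h n) x * (w x)%:E @[n --> \oo]).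
    apply/esym/cvg_lim => //; apply: cvgeZr => //.
    exact: cvg_nnsfun_approx.
  under eq_integral => x _ do rewrite fg.
  apply: monotone_convergence => [//| | |].
  - move=> n; apply/emeasurable_funM => //.
    by apply/measurable_EFinP; exact/measurable_funP.
  - by move=> n x Ex /=; rewrite mule_ge0 ?lee_fin.
  - by move=> x Ex a b ab/=; rewrite lee_wpmul2r ?lee_fin//; exact/lefP/nd_nnsfun_approx.
suff suf n : \int[m]_x ((EFin \o h n) x * (w x)%:E) = \int[nu]_x (EFin \o h n) x.
  by under [in RHS]eq_fun do rewrite suf.
transitivity (\int[nu]_x
   (\sum_(y \in range (h n)) (y * \1_(h n @^-1` [set y]) x)%:E)); last first.
  by apply: eq_integral => t tE; rewrite /= fimfunE -fsumEFin.
have indich r : measurable_fun setT (fun x => (r * \1_(h n @^-1` [set r]) x)%:E).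
  by apply: (measurable_comp measurableT) => //; exact: measurable_funM.
rewrite ge0_integral_fsum//; last by move=> y x Ey; exact: nnfun_muleindic_ge0.
transitivity (\int[m]_x (\sum_(y \in range (h n))
    (y * \1_(h n @^-1` [set y]) x)%:E * (w x)%:E)).
  under [RHS]eq_integral => x xE.
    rewrite -ge0_mule_fsuml => [|y]; last exact: nnfun_muleindic_ge0.
    rewrite fsumEFin // -(fimfunE _ x); over.
  by [].
rewrite ge0_integral_fsum//; last 2 first.
  - by move=> y; apply: emeasurable_funM.
  - by move=> y x Ey; rewrite mule_ge0// nnfun_muleindic_ge0.
apply: eq_fsbigr => r rhn.
under [RHS]eq_integral do rewrite EFinM.
rewrite integralZl_indic_nnsfun => //.
under eq_integral do rewrite EFinM -muleA.
rewrite ge0_integralZl//.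
- under eq_integral do rewrite muleC.
  rewrite (eq_integral ((EFin \o w) \_ (h n @^-1` [set r]))); last first.
    by move=> x xE; rewrite epatch_indic.
  by rewrite -integral_mkcond -nuE// integral_indic// setIT.
- by apply: emeasurable_funM => //; exact/measurable_EFinP.
- by move=> t Et; rewrite mule_ge0 ?lee_fin.
- by move: rhn; rewrite inE => -[t _ <-]; rewrite lee_fin.
Qed.

End density.

Section tonelli_on.
Context d1 d2 (T1 : measurableType d1) (T2 : measurableType d2) (R : realType).
Variables (m1 : {sigma_finite_measure set T1 -> \bar R})
          (m2 : {sigma_finite_measure set T2 -> \bar R}).
Variables (A : set T1) (B : set T2) (f : T1 * T2 -> \bar R).
Hypotheses (mA : measurable A) (mB : measurable B).
Hypothesis mf : measurable_fun setT f.
Hypothesis f0 : forall x, (0 <= f x)%E.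
Local Open Scope ereal_scope.

(** Extension by zero reduces integrals over a rectangle to Tonelli's theorem on the whole
    product. *)
Let g := f \_ (A `*` B).

Let mg : measurable_fun setT g.
Proof.
by apply/(measurable_restrictT _ _).1; [exact: measurableX|exact: measurable_funTS].
Qed.

Let g0 x : 0 <= g x.
Proof. by rewrite /g patchE; case: ifP. Qed.

Let gE a b : g (a, b) = ((fun a => ((fun b => f (a, b)) \_ B) b) \_ A) a.
Proof. by rewrite /g !patchE in_setX/=; case: (a \in A); case: (b \in B). Qed.

Lemma tonelli_on1 : \int[m1 \x m2]_(z in A `*` B) f z =
  \int[m1]_(a in A) \int[m2]_(b in B) f (a, b).
Proof.
rewrite integral_mkcond -/g fubini_tonelli1// [RHS]integral_mkcond.
apply: eq_integral => a _; rewrite /fubini_F [RHS]patchE.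
under eq_integral do rewrite gE patchE.
by case: ifP => aA; [rewrite [RHS]integral_mkcond|rewrite integral0].
Qed.

Lemma tonelli_on : \int[m1]_(a in A) \int[m2]_(b in B) f (a, b) =
  \int[m2]_(b in B) \int[m1]_(a in A) f (a, b).
Proof.
rewrite -tonelli_on1 integral_mkcond -/g fubini_tonelli2// [RHS]integral_mkcond.
apply: eq_integral => b _; rewrite /fubini_G [RHS]patchE.
under eq_integral do rewrite gE.
case: ifP => bB; [rewrite [RHS]integral_mkcond; apply: eq_integral => a _|rewrite integral0_eq// => a _].
  by rewrite /= !patchE bB.
by rewrite !patchE bB; case: ifP.
Qed.

Lemma measurable_tonelli_on1 : measurable_fun A (fun a => \int[m2]_(b in B) f (a, b)).
Proof.
apply: (@eq_measurable_fun _ _ _ _ _ (fun a => \int[m2]_b g (a, b))).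
  move=> a aA; rewrite [RHS]integral_mkcond; apply: eq_integral => b _.
  by rewrite gE patchE aA.
apply: measurable_funTS; exact: (@measurable_fun_fubini_tonelli_F _ _ _ _ _ m2 _ mg g0).
Qed.

End tonelli_on.

(** * Lebesgue measure on cubes *)

Section rV_basics.
Context {R : realType}.
Notation T n := 'rV[measurableTypeR R]_n.

Lemma measurable_coordR n (i : 'I_n) :
  measurable_fun [set: T n] (fun x => x ord0 i : R).
Proof. exact: measurable_coord. Qed.

Lemma measurable_box n (A : 'I_n -> set R) : (forall i, measurable (A i)) ->
  measurable ([set x | forall i, A i (x ord0 i)] : set (T n)).
Proof.
move=> mA.
rewrite [X in measurable X](_ : _ = \bigcap_(i in [set: 'I_n]) ((fun x : T n => x ord0 i : R) @^-1` A i)).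
  apply: fin_bigcap_measurable => // i _.
  by rewrite -[X in measurable X]setTI; apply: measurable_coordR.
by apply/seteqP; split => x Bx i; [move=> _|]; exact: Bx.
Qed.

(** The sigma-algebra is generated by the coordinates, so an open set has to be written as a
    countable union of boxes, here with rational centres and half-sides [1/(k+1)]. *)
Lemma open_measurable_rV n (U : set 'rV[R]_n) : open U -> measurable (U : set (T n)).
Proof.
move=> oU.
pose q2 (q : 'rV[rat]_n * nat) : set (T n) := [set x | forall i,
  ball (ratr (q.1 ord0 i) : R) (q.2.+1%:R^-1) (x ord0 i)].
rewrite [X in measurable X](_ : _ = \bigcup_(q in [set q | q2 q `<=` U]) q2 q).
  rewrite bigcup_mkcond; apply: countable_bigcupT_measurable => [|q].
    exact: countableP.
  by case: ifP => // _; apply: (@measurable_box n (fun i => ball (ratr (q.1 ord0 i) : R) (q.2.+1%:R^-1))) => i; exact: measurable_ball.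
apply/seteqP; split; last by move=> x [q /= qU]; exact: qU.
move=> x Ux.
have /nbhs_ballP[e /= e0 eU] : nbhs (x : 'rV[R]_n) U by exact: open_nbhs_nbhs.
have [k ke] : exists k : nat, k.+1%:R^-1 < e / 2.
  exists (Num.truncn (2 / e)); rewrite -[ltRHS]invf_div ltf_pV2 ?posrE ?divr_gt0//.
  by rewrite truncnS_gt.
have exq i : exists q : rat, ball (x ord0 i : R) (k.+1%:R^-1) (ratr q).
  have : x ord0 i - k.+1%:R^-1 < x ord0 i + k.+1%:R^-1 :> R.
    by rewrite ltrD2l gtrN.
  move=> /rat_in_itvoo[q]; rewrite in_itv/= => /andP[q1 q2'].
  by exists q; rewrite /ball/= ltr_distlC q1.
have [q hq] := choice exq.
exists (\row_i q i, k).
  move=> y /= hy; apply: eU; split => // i j; rewrite !ord1.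
  have := hy j; rewrite mxE => /ball_sym hyj.
  have := ball_triangle (hq j) (ball_sym hyj) => /le_ball; apply.
  by rewrite (splitr e) lerD// ltW.
by move=> i /=; rewrite mxE; exact/ball_sym.
Qed.

Lemma continuous_measurable_rV n (f : 'rV[R]_n -> R) : continuous f ->
  measurable_fun [set: T n] f.
Proof.
move=> /continuousP cf; apply: (measurability _ (RGenOInfty.measurableE R)).
move=> _ [_ [x ->] <-]; rewrite setTI; apply: open_measurable_rV.
exact/cf/interval_open.
Qed.

(** Cubes are preferred to Euclidean balls because they split off one coordinate at a time:
    Poincare's inequality and the divergence theorem then go by induction on the dimension. *)
Definition cube n (L : R) : set (T n) := [set x | forall i, `[- L, L]%classic (x ord0 i)].
Arguments cube n L : clear implicits.

Lemma measurable_cube n L : measurable (cube n L).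
Proof. by apply: (@measurable_box n (fun=> `[- L, L]%classic)) => i; exact: measurable_itv. Qed.

Lemma lebesgue_segment (L : R) : 0 <= L ->
  lebesgue_measure `[- L, L]%classic = (2 * L)%:E.
Proof.
move=> L0; rewrite lebesgue_measure_itv/= lte_fin.
case: ltP; first by move=> _; rewrite -EFinB opprK mulr2n mulrDl mul1r.
move=> LL; have -> : L = 0 by lra.
by rewrite mulr0.
Qed.

Lemma lebesgue_cube n (L : R) : 0 <= L ->
  lebesgue_rV n (cube n L) = ((2 * L) ^+ n)%:E.
Proof.
move=> L0.
rewrite (@lebesgue_rV_box R n (fun=> `[- L, L]%classic)); last by move=> i; exact: measurable_itv.
under eq_bigr do rewrite lebesgue_segment//.
by rewrite big_const_ord iter_mule// -EFin_expe mule1.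
Qed.

Lemma cons_cube n L : @cons_rV R n @^-1` (cube n.+1 L) =
  `[- L, L]%classic `*` cube n L.
Proof.
apply/seteqP; split => p /=.
  move=> h; split => [|i]; first by rewrite -[p.1]cons_rV0; exact: h.
  by rewrite -cons_rVS; exact: h.
move=> [p1 p2] i.
by have [j ->|->] := unliftP ord0 i; rewrite ?cons_rV0 ?cons_rVS//; exact: p2.
Qed.

Lemma integral_cube_cons n L (f : T n.+1 -> \bar R) : measurable_fun setT f ->
  (forall x, 0 <= f x)%E ->
  (\int[lebesgue_rV n.+1]_(x in cube n.+1 L) f x =
   \int[lebesgue_measure]_(a in `[(- L)%R, L]) \int[lebesgue_rV n]_(x in cube n L)
     f (cons_rV (a, x)))%E.
Proof.
move=> mf f0.
have := @ge0_integral_pushforward _ _ _ _ R (@cons_rV R n) (@measurable_cons_rV R n)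
  (lebesgue_measure \x lebesgue_rV n)%E (cube n.+1 L) f (@measurable_cube n.+1 L)
  (measurable_funTS mf) (fun x _ => f0 x).
rewrite cons_cube => /= ->.
rewrite tonelli_on1//; first exact: measurable_cube.
by apply: measurableT_comp => //; exact: measurable_cons_rV.
Qed.

End rV_basics.

Arguments cube {R} n L.
#[global] Hint Extern 0 (measurable (cube _ _)) => solve [exact: measurable_cube] : core.

(** * Slices of functions of several variables *)

Import HBNNSimple.

(** The integral of a non-negative function is a supremum over the simple functions below it, a
    family that grows with the function. Monotonicity thus also covers inner integrals whose
    measurability has not been established. *)
Lemma ge0_integral_mono d (T : measurableType d) (R : realType)
    (m : {measure set T -> \bar R}) (A : set T) (f g : T -> \bar R) :
  (forall x, A x -> 0 <= f x)%E -> (forall x, A x -> f x <= g x)%E ->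
  (\int[m]_(x in A) f x <= \int[m]_(x in A) g x)%E.
Proof.
move=> f0 fg.
rewrite !ge0_integralE//; last by move=> x Ax; exact: le_trans (f0 _ Ax) (fg _ Ax).
apply: ereal_sup_le => /= _ [h hf <-].
exists h => // x; apply: (le_trans (hf x)); rewrite !patchE; case: ifP => //.
by rewrite inE; exact: fg.
Qed.

Section poincare.
Context {R : realType}.
Notation T n := 'rV[measurableTypeR R]_n.

(** Cauchy-Schwarz for [F b - F a], read as the integral of [F']. It is obtained from
    [(F' - c)^2 >= 0] alone, with [c] the mean slope. *)
Lemma sqr_increment_le (L : R) (F : R -> R) :
  (forall t, derivable F t 1) -> continuous (derive1 F) ->
  forall a b, `[- L, L]%classic a -> `[- L, L]%classic b ->
  (((F a - F b) ^+ 2)%:E <=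
    (2 * L)%:E * \int[lebesgue_measure]_(t in `[(- L)%R, L]) ((derive1 F) t ^+ 2)%:E)%E.
Proof.
move=> dF cF.
suff H a b : `[- L, L]%classic a -> `[- L, L]%classic b -> a < b ->
  (((F a - F b) ^+ 2)%:E <=
    (2 * L)%:E * \int[lebesgue_measure]_(t in `[(- L)%R, L]) ((derive1 F) t ^+ 2)%:E)%E.
  move=> a b La Lb; have [ab|ba|->] := ltgtP a b; first exact: H.
    by rewrite -sqrrN opprB; exact: H.
  rewrite subrr expr0n/= mule_ge0//; last by apply: integral_ge0 => t _; rewrite lee_fin sqr_ge0.
  by move: Lb; rewrite /= in_itv/= lee_fin => /andP[]; lra.
rewrite /= !in_itv/= => /andP[La aL] /andP[Lb bL] ab.
have ba0 : 0 < b - a by lra.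
(* [G] is a primitive of [2 c F' - c^2], which is at most [F'^2], and the value of [c] gives
   [G b - G a = (F b - F a)^2 / (b - a)]. *)
pose c := (F b - F a) / (b - a).
pose G t := 2 * c * F t - c ^+ 2 * t.
have dG (t : R) : is_derive t (1 : R) G (2 * c * (derive1 F) t - c ^+ 2).
  have /derivableP dFt := dF t.
  rewrite (_ : G = (2 * c) *: F - (c ^+ 2) *: (id : R -> R)); last exact/funext.
  by apply: is_derive_eq; rewrite derive1E /GRing.scale/= mulr1.
have cG : continuous (fun t => 2 * c * (derive1 F) t - c ^+ 2).
  move=> t; apply: cvgB; last exact: cvg_cst.
  by apply: cvgMr; exact: cF.
have csq : continuous (fun t => (derive1 F) t ^+ 2).
  move=> t; apply: (@continuous_comp _ _ _ (derive1 F) (fun x => x ^+ 2)).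
    exact: cF.
  exact: exprn_continuous.
have ic (g : R -> R) : continuous g ->
    (@lebesgue_measure R).-integrable `[a, b] (EFin \o g).
  move=> cg; apply: continuous_compact_integrable; first exact: segment_compact.
  exact: continuous_subspaceT.
have GE : (\int[lebesgue_measure]_(t in `[a, b]) (2 * c * (derive1 F) t - c ^+ 2)%:E
    = (G b)%:E - (G a)%:E)%E.
  apply: (@continuous_FTC2 R _ G) => //.
  - exact: continuous_subspaceT.
  - split.
    + by move=> t _; case: (dG t).
    + apply: cvg_at_right_filter; apply: differentiable_continuous.
      by apply/derivable1_diffP; case: (dG a).
    + apply: cvg_at_left_filter; apply: differentiable_continuous.
      by apply/derivable1_diffP; case: (dG b).
  - by move=> t _; rewrite derive1E; case: (dG t).
have h1 : (((F a - F b) ^+ 2 / (b - a))%:E <=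
    \int[lebesgue_measure]_(t in `[a, b]) ((derive1 F) t ^+ 2)%:E)%E.
  have -> : (((F a - F b) ^+ 2 / (b - a))%:E = (G b)%:E - (G a)%:E)%E.
    rewrite -EFinB; congr EFin; rewrite /G /c; field.
    by rewrite gt_eqF.
  rewrite -GE; apply: le_integral => //; [exact: ic|exact: ic|move=> t _].
  by rewrite lee_fin -subr_ge0 (_ : _ - _ = ((derive1 F) t - c) ^+ 2) ?sqr_ge0//; ring.
apply: (@le_trans _ _ ((b - a)%:E * \int[lebesgue_measure]_(t in `[a, b]) ((derive1 F) t ^+ 2)%:E)%E).
  by rewrite -lee_pdivrMl// -EFinM mulrC.
apply: lee_pmul => //.
- by rewrite lee_fin ltW.
- by apply: integral_ge0 => t _; rewrite lee_fin sqr_ge0.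
- by rewrite lee_fin; lra.
- apply: ge0_subset_integral => //.
  + apply/measurable_EFinP/measurable_funTS; exact: continuous_measurable_fun.
  + by move=> t _; rewrite lee_fin sqr_ge0.
  + by apply: subset_itv; rewrite bnd_simp.
Qed.

Lemma shift_cons_tail n (a h : R) (x : 'rV[R]_n) (j : 'I_n) :
  (h *: delta_mx ord0 (lift ord0 j) + cons_rV (a, x) : 'rV[R]_n.+1) =
  cons_rV (a, h *: delta_mx ord0 j + x).
Proof.
apply/rowP => i; rewrite 2!mxE [in LHS]mxE.
have [k ->|->] := unliftP ord0 i.
  rewrite !cons_rVS/= 3!mxE/=.
  by rewrite (inj_eq (@lift_inj _ ord0)).
by rewrite !cons_rV0/= mulr0 add0r.
Qed.

Lemma shift_cons_head n (a h : R) (x : 'rV[R]_n) :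
  (h *: delta_mx ord0 ord0 + cons_rV (a, x) : 'rV[R]_n.+1) =
  cons_rV (h + a, x).
Proof.
apply/rowP => i; rewrite 2!mxE [in LHS]mxE.
have [k ->|->] := unliftP ord0 i.
  by rewrite !cons_rVS/= mulr0 add0r.
by rewrite !cons_rV0/= mulr1.
Qed.

(** The difference quotients agree as functions of [h], so derivability and the value of the
    derivative pass to slices at the same time. *)
Lemma derive_quotient_tail n (f : 'rV[R]_n.+1 -> R) (a : R) (x : 'rV[R]_n) (j : 'I_n) :
  (fun h : R => h^-1 *: ((f \o shift (cons_rV (a, x))) (h *: delta_mx ord0 (lift ord0 j))
      - f (cons_rV (a, x)))) =
  (fun h : R => h^-1 *: (((fun y => f (cons_rV (a, y))) \o shift x) (h *: delta_mx ord0 j)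
      - (fun y => f (cons_rV (a, y))) x)).
Proof. by apply/funext => h /=; rewrite shift_cons_tail. Qed.

Lemma derive_quotient_head n (f : 'rV[R]_n.+1 -> R) (a : R) (x : 'rV[R]_n) :
  (fun h : R => h^-1 *: ((f \o shift (cons_rV (a, x))) (h *: delta_mx ord0 ord0)
      - f (cons_rV (a, x)))) =
  (fun h : R => h^-1 *: (((fun t => f (cons_rV (t, x))) \o shift a) (h *: (1 : R^o))
      - (fun t => f (cons_rV (t, x))) a)).
Proof. by apply/funext => h /=; rewrite shift_cons_head /GRing.scale/= mulr1. Qed.

Lemma partial_cons_tail n (f : 'rV[R]_n.+1 -> R) a x j :
  partial_derivative j (fun y : 'rV[R]_n => f (cons_rV (a, y))) x =
  partial_derivative (lift ord0 j) f (cons_rV (a, x)).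
Proof. by rewrite /partial_derivative /derive -derive_quotient_tail. Qed.

Lemma partial_cons_head n (f : 'rV[R]_n.+1 -> R) (x : 'rV[R]_n) (a : R) :
  derive1 (fun t : R => f (cons_rV (t, x))) a = partial_derivative ord0 f (cons_rV (a, x)).
Proof. by rewrite derive1E /partial_derivative /derive -derive_quotient_head. Qed.

Lemma continuous_cons_tail n (a : R) : continuous (fun x : 'rV[R]_n => cons_rV (a, x) : 'rV[R]_n.+1).
Proof.
move=> x A /nbhs_ballP[e e0 eA]; apply/nbhs_ballP; exists e => // y [_ xy].
apply: eA; split => // i j; rewrite ord1.
have [k ->|->] := unliftP ord0 j; last by rewrite !cons_rV0; exact: ballxx.
by rewrite !cons_rVS; exact: xy.
Qed.

Lemma continuous_cons_head n (x : 'rV[R]_n) : continuous (fun a : R => cons_rV (a, x) : 'rV[R]_n.+1).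
Proof.
move=> a A /nbhs_ballP[e e0 eA]; apply/nbhs_ballP; exists e => // b ab.
apply: eA; split => // i j; rewrite ord1.
by have [k ->|->] := unliftP ord0 j; rewrite ?cons_rV0 ?cons_rVS//; exact: ballxx.
Qed.

Lemma class_C1_cons_tail n (f : 'rV[R]_n.+1 -> R) a : class_C 1 f ->
  class_C 1 (fun y : 'rV[R]_n => f (cons_rV (a, y))).
Proof.
move=> [cf df]; split.
  by move=> x; apply: continuous_comp; [exact: continuous_cons_tail|exact: cf].
move=> i; split.
  by move=> x; rewrite /derivable -derive_quotient_tail; exact: (df _).1.
move=> x /=; rewrite (_ : partial_derivative i _ =
   (partial_derivative (lift ord0 i) f) \o (fun x : 'rV[R]_n => cons_rV (a, x) : 'rV[R]_n.+1)).
  by apply: continuous_comp; [exact: continuous_cons_tail|exact: (df _).2].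
by apply/funext => y; rewrite partial_cons_tail.
Qed.

Lemma class_C1_cons_head n (f : 'rV[R]_n.+1 -> R) (x : 'rV[R]_n) : class_C 1 f ->
  (forall t, derivable (fun t : R => f (cons_rV (t, x))) t 1) /\
  continuous (derive1 (fun t : R => f (cons_rV (t, x)))).
Proof.
move=> [cf df]; split.
  by move=> t; rewrite /derivable -derive_quotient_head; exact: (df _).1.
rewrite (_ : derive1 _ =
   (partial_derivative ord0 f) \o (fun t : R => cons_rV (t, x) : 'rV[R]_n.+1)).
  move=> t.
  by apply: continuous_comp; [exact: continuous_cons_head|exact: (df _).2].
by apply/funext => y; rewrite partial_cons_head.
Qed.

End poincare.

(** * The Poincare inequality on cubes *)

Section poincare.
Context {R : realType}.
Notation T n := 'rV[measurableTypeR R]_n.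

Lemma measurable_sqr_sub d (X : measurableType d) (g : X -> R) : measurable_fun setT g ->
  measurable_fun setT (fun p : X * X => ((g p.1 - g p.2) ^+ 2)%:E).
Proof.
move=> mg; apply/measurable_EFinP; apply: measurable_funX; apply: measurable_funB.
  exact: measurableT_comp mg measurable_fst.
exact: measurableT_comp mg measurable_snd.
Qed.

Lemma measurable_sqr_subl d (X : measurableType d) (g : X -> R) (c : R) : measurable_fun setT g ->
  measurable_fun setT (fun y : X => ((c - g y) ^+ 2)%:E).
Proof.
by move=> mg; apply/measurable_EFinP; apply: measurable_funX; apply: measurable_funB.
Qed.

(** Induction on the dimension. From [(a, x)] to [(b, y)] one goes through [(a, y)]: the first leg
    stays in a slice, where the induction hypothesis applies, and the second is parallel to the
    first axis, where [sqr_increment_le] applies. Splitting the square costs a factor 2 at each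
    dimension, hence [2 ^+ n]. *)
Lemma poincare_cube n (L : R) (f : 'rV[R]_n -> R) : 0 <= L -> class_C 1 f ->
  (\int[lebesgue_rV n]_(x in cube n L) \int[lebesgue_rV n]_(y in cube n L)
     ((f x - f y) ^+ 2)%:E <=
   (4 * 2 ^+ n * L ^+ 2 * (2 * L) ^+ n)%:E *
     \int[lebesgue_rV n]_(x in cube n L) (sqgrad f x)%:E)%E.
Proof.
move=> L0; elim: n f => [|n IH] f Cf.
  rewrite integral0_eq => [|x _].
    apply: mule_ge0; first by rewrite lee_fin !mulr_ge0.
    by apply: integral_ge0 => x _; rewrite lee_fin sumr_ge0// => i _; exact: sqr_ge0.
  by apply: integral0_eq => y _; rewrite !(thinmx0 (_ : 'rV_0)) subrr expr0n.
have [cf df] := Cf.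
have mC k : measurable (cube k L) by exact: measurable_cube.
have sq0 (r : R) : (0 <= (r ^+ 2)%:E)%E by rewrite lee_fin sqr_ge0.
have mf : measurable_fun [set: T n.+1] f by exact: continuous_measurable_rV.
have mfa a : measurable_fun [set: T n] (fun y => f (cons_rV (a, y))).
  by apply: measurableT_comp mf _; apply: measurableT_comp (@measurable_cons_rV R n) _; exact: measurable_pair1.
pose S := `[- L, L]%classic : set R.
have mS : measurable S by exact: measurable_itv.
have lS : lebesgue_measure S = (2 * L)%:E by exact: lebesgue_segment.
have iS (r : \bar R) : (\int[lebesgue_measure]_(b in S) r = r * (2 * L)%:E)%E.
  by transitivity (r * lebesgue_measure S)%E; [exact: integral_cst|rewrite lS].
have iC (r : \bar R) : (\int[lebesgue_rV n]_(x in cube n L) r = r * ((2 * L) ^+ n)%:E)%E.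
  by transitivity (r * lebesgue_rV n (cube n L))%E; [exact: integral_cst|rewrite lebesgue_cube].
pose d0 x := partial_derivative ord0 f x.
(* [h y] is the energy along the line through [y] parallel to the first axis, [K] its integral over
   [y], and [s] collects the remaining derivatives. *)
pose h y := (\int[lebesgue_measure]_(t in S) (d0 (cons_rV (t, y)) ^+ 2)%:E)%E.
pose K := (\int[lebesgue_rV n.+1]_(x in cube n.+1 L) (d0 x ^+ 2)%:E)%E.
pose s x := \sum_(j < n) partial_derivative (lift ord0 j) f x ^+ 2.
pose G a x := (\int[lebesgue_rV n]_(y in cube n L)
  ((f (cons_rV (a, x)) - f (cons_rV (a, y))) ^+ 2)%:E)%E.
have md i : measurable_fun [set: T n.+1] (partial_derivative i f).
  by apply: continuous_measurable_rV; exact: (df i).2.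
have md0 : measurable_fun [set: T n.+1] (fun x => (d0 x ^+ 2)%:E).
  by apply/measurable_EFinP; apply: measurable_funX; exact: md.
have ms : measurable_fun [set: T n.+1] (fun x => (s x)%:E).
  by apply/measurable_EFinP; apply: measurable_sum => j; apply: measurable_funX; exact: md.
have s0 x : 0 <= s x by apply: sumr_ge0 => j _; exact: sqr_ge0.
have h0 y : (0 <= h y)%E by apply: integral_ge0 => t _.
have G0 a x : (0 <= G a x)%E by apply: integral_ge0 => t _.
have mh : measurable_fun (cube n L) h.
  apply: (measurable_tonelli_on1 lebesgue_measure (mC n) mS
    (f := fun p => (d0 (cons_rV (p.2, p.1)) ^+ 2)%:E)) => //.
  apply: (measurableT_comp md0); apply: (measurableT_comp (@measurable_cons_rV R n)).
  exact: measurable_swap.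
have mG a : measurable_fun (cube n L) (G a).
  apply: (measurable_tonelli_on1 (lebesgue_rV n) (mC n) (mC n)
    (f := fun p => ((f (cons_rV (a, p.1)) - f (cons_rV (a, p.2))) ^+ 2)%:E)) => //.
  exact: (measurable_sqr_sub (mfa a)).
have hK : (\int[lebesgue_rV n]_(y in cube n L) h y = K)%E.
  rewrite /K integral_cube_cons//; apply/esym.
  apply: (@tonelli_on _ _ _ _ R lebesgue_measure (lebesgue_rV n) S (cube n L)
    (fun p => (d0 (cons_rV p) ^+ 2)%:E)) => //.
  exact: (measurableT_comp md0 (@measurable_cons_rV R n)).
have K0 : (0 <= K)%E by exact: integral_ge0.
have SQ : (\int[lebesgue_rV n.+1]_(x in cube n.+1 L) (sqgrad f x)%:E =
   K + \int[lebesgue_rV n.+1]_(x in cube n.+1 L) (s x)%:E)%E.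
  rewrite -ge0_integralD//=.
  - by apply: eq_integral => x _; rewrite /sqgrad big_ord_recl EFinD.
  - exact: measurable_funTS.
  - by move=> x _; rewrite lee_fin.
  - exact: measurable_funTS.
clearbody K.
have inner a x : S a -> (\int[lebesgue_rV n.+1]_(y in cube n.+1 L)
      ((f (cons_rV (a, x)) - f y) ^+ 2)%:E <=
    (4 * L)%:E * G a x + (8 * L ^+ 2)%:E * K)%E.
  move=> Sa; rewrite integral_cube_cons//; last exact: measurable_sqr_subl.
  have -> : ((4 * L)%:E * G a x + (8 * L ^+ 2)%:E * K =
      \int[lebesgue_measure]_(b in S) (2%:E * G a x + (4 * L)%:E * K))%E.
    rewrite iS; move: (G a x) (G0 a x) => g g0.
    rewrite [RHS]muleC ge0_muleDr ?mule_ge0 ?lee_fin ?mulr_ge0//.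
    by rewrite !muleA -!EFinM; congr (_%:E * _ + _%:E * _)%E; ring.
  apply: ge0_integral_mono => [b _|b Sb]; first exact: integral_ge0.
  apply: (@le_trans _ _ (\int[lebesgue_rV n]_(y in cube n L)
     (2%:E * ((f (cons_rV (a, x)) - f (cons_rV (a, y))) ^+ 2)%:E + (4 * L)%:E * h y))%E).
    apply: ge0_integral_mono => [//|y Cy].
    have [dF cF] := class_C1_cons_head y Cf.
    have := sqr_increment_le dF cF Sa Sb.
    under eq_integral do rewrite partial_cons_head.
    rewrite -/(h y) => hh.
    apply: (@le_trans _ _ (2%:E * ((f (cons_rV (a, x)) - f (cons_rV (a, y))) ^+ 2)%:E
       + 2%:E * ((f (cons_rV (a, y)) - f (cons_rV (b, y))) ^+ 2)%:E)%E).
      rewrite -!EFinM -EFinD lee_fin -subr_ge0.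
      set u := f _; set v := f _; set w := f _.
      by rewrite (_ : _ - _ = (u - v - (v - w)) ^+ 2) ?sqr_ge0//; ring.
    rewrite leeD2l//; apply: (@le_trans _ _ (2%:E * ((2 * L)%:E * h y))%E).
      by rewrite lee_pmul2l.
    by rewrite muleA -EFinM mulrA -natrM.
  have mb : measurable_fun (cube n L) (fun y => ((f (cons_rV (a, x)) - f (cons_rV (a, y))) ^+ 2)%:E).
    by apply: measurable_funTS; exact: (measurable_sqr_subl _ (mfa a)).
  rewrite ge0_integralD//=; last 4 first.
  - by move=> y _; rewrite mule_ge0.
  - exact: measurable_funeM.
  - by move=> y _; rewrite mule_ge0// lee_fin mulr_ge0.
  - exact: measurable_funeM.
  by rewrite ge0_integralZl// ge0_integralZl// ?lee_fin ?mulr_ge0// hK.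
rewrite integral_cube_cons//; last 2 first.
- have := @measurable_tonelli_on1 _ _ _ _ R (lebesgue_rV n.+1) setT (cube n.+1 L) _ measurableT (mC _)
    (measurable_sqr_sub mf) (fun=> sq0 _).
  exact.
- by move=> x; exact: integral_ge0.
apply: (@le_trans _ _ (\int[lebesgue_measure]_(a in S)
  ((4 * L * (4 * 2 ^+ n * L ^+ 2 * (2 * L) ^+ n))%:E *
    (\int[lebesgue_rV n]_(x in cube n L) (s (cons_rV (a, x)))%:E)
    + (8 * L ^+ 2 * (2 * L) ^+ n)%:E * K))%E).
  apply: ge0_integral_mono => [a _|a Sa].
    by apply: integral_ge0 => x _; exact: integral_ge0.
  apply: (@le_trans _ _ (\int[lebesgue_rV n]_(x in cube n L)
     ((4 * L)%:E * G a x + (8 * L ^+ 2)%:E * K))%E).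
    apply: ge0_integral_mono => [x _|x _]; first exact: integral_ge0.
    exact: inner.
    rewrite ge0_integralD//=; last 3 first.
  - by move=> x _; rewrite mule_ge0 ?lee_fin ?mulr_ge0.
  - exact: measurable_funeM.
  - by move=> x _; rewrite mule_ge0// lee_fin ?mulr_ge0// sqr_ge0.
  rewrite iC ge0_integralZl// ?lee_fin ?mulr_ge0//.
  apply: leeD; last by rewrite muleAC -EFinM.
  rewrite (EFinM (4 * L)) -[leRHS]muleA.
  apply: lee_wpmul2l; first by rewrite lee_fin mulr_ge0.
  apply: le_trans (IH _ (class_C1_cons_tail a Cf)) _.
  apply: lee_wpmul2l; first by rewrite lee_fin ?mulr_ge0 ?exprn_ge0 ?mulr_ge0.
  apply: ge0_integral_mono => x _.
    by rewrite lee_fin; apply: sumr_ge0 => i _; exact: sqr_ge0.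
  rewrite lee_fin; apply: ler_sum => i _.
  by rewrite partial_cons_tail.
have ms' : measurable_fun S (fun a => \int[lebesgue_rV n]_(x in cube n L) (s (cons_rV (a, x)))%:E)%E.
  apply: (measurable_tonelli_on1 (lebesgue_rV n) mS (mC n)
    (f := fun p => (s (cons_rV p))%:E)) => //.
    exact: (measurableT_comp ms (@measurable_cons_rV R n)).
  by move=> p; rewrite lee_fin.
rewrite ge0_integralD//; last 3 first.
- move=> x _; rewrite mule_ge0 ?lee_fin ?mulr_ge0// ?exprn_ge0 ?mulr_ge0//.
  by apply: integral_ge0 => y _; rewrite lee_fin.
- exact: measurable_funeM.
- by move=> x _; rewrite mule_ge0// lee_fin ?mulr_ge0// ?exprn_ge0 ?mulr_ge0// sqr_ge0.
rewrite iS.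
rewrite ge0_integralZl//; last 2 first.
- by move=> a _; apply: integral_ge0 => y _; rewrite lee_fin.
- by rewrite lee_fin !mulr_ge0// ?exprn_ge0 ?mulr_ge0.
rewrite -(@integral_cube_cons R n L (fun x => (s x)%:E))//.
rewrite SQ.
have := integral_ge0 (lebesgue_rV n.+1) (D := cube n.+1 L) (f := fun x => (s x)%:E) (fun x _ => s0 x).
move: (\int[lebesgue_rV n.+1]_(x in cube n.+1 L) (s x)%:E)%E => I0 I00.
rewrite addeC ge0_muleDr//.
(* The constant in front of the other derivatives is multiplied by exactly [4 * L]; the one in front
   of [K] fits because [1 <= 2 ^+ n]. *)
have cc : 0 <= L ^+ 2 * (2 * L) ^+ n.+1 by rewrite mulr_ge0 ?exprn_ge0 ?mulr_ge0.
apply: leeD.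
  rewrite muleAC -EFinM; apply: lee_wpmul2r => //; rewrite lee_fin.
  rewrite [X in X <= _](_ : _ = 8 * (L ^+ 2 * (2 * L) ^+ n.+1)); last by rewrite [in RHS](exprS _ n); ring.
  rewrite -[leRHS]mulrA ler_wpM2r//.
  have : 1 <= 2 ^+ n :> R by rewrite exprn_ege1// ler1n.
  by rewrite exprS; lra.
apply: lee_wpmul2r => //.
by rewrite lee_fin !exprS le_eqVlt; apply/orP; left; apply/eqP; ring.
Qed.

End poincare.

(** * Dyadic decomposition of the weights *)

Section weights.
Context {R : realType} {d : nat}.
Notation T := 'rV[measurableTypeR R]_d.
Variable D : R.
Hypothesis D0 : 0 < D.
Implicit Types (x : T) (p k : nat).

(** Two exponents matter: [p = d] gives the density of [mu_star], [p = d - 2] the weight of the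
    form. *)
Definition weight p x : R := (D + sqnorm x) `^ (- (p%:R / 2)).

Definition dyadic p k : R := (2 ^+ k)^-1 ^+ p.

Lemma dyadic_gt0 p k : 0 < dyadic p k.
Proof. by rewrite exprn_gt0// invr_gt0 exprn_gt0. Qed.

Lemma dyadic_ge0 p k : 0 <= dyadic p k.
Proof. exact/ltW/dyadic_gt0. Qed.

Lemma dyadicS p k : (0 < p)%N -> dyadic p k.+1 <= dyadic p k / 2.
Proof.
move=> p0; rewrite /dyadic exprS invfM exprMn mulrC ler_wpM2l//.
rewrite -(prednK p0) exprS ler_piMr// exprn_ile1// invf_le1//.
by rewrite ler1n.
Qed.

Lemma dyadic_powR p k : ((2 ^+ k) ^+ 2 : R) `^ (- (p%:R / 2)) = dyadic p k.
Proof.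
have k0 : 0 < 2 ^+ k :> R by rewrite exprn_gt0.
rewrite -powR_mulrn ?ltW// -powRrM mulrN powRN (_ : _ * _ = p%:R); last by field.
by rewrite powR_mulrn ?ltW// /dyadic exprVn.
Qed.

Lemma ler_powRN (a b q : R) : 0 <= q -> 0 < a -> a <= b -> b `^ (- q) <= a `^ (- q).
Proof.
move=> q0 a0 ab; rewrite !powRN lef_pV2 ?posrE ?powR_gt0//; last exact: lt_le_trans ab.
by rewrite ge0_ler_powR// nnegrE ltW// (lt_le_trans a0).
Qed.

Lemma sqnorm_ge0 x : 0 <= sqnorm x.
Proof. by apply: sumr_ge0 => i _; exact: sqr_ge0. Qed.

Lemma weight_ge0 p x : 0 <= weight p x.
Proof. exact: powR_ge0. Qed.

Lemma sqnorm_cube (L : R) x : cube d L x -> sqnorm x <= d%:R * L ^+ 2.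
Proof.
move=> h; rewrite -[X in _ <= X%:R * _](card_ord d) mulr_natl -sumr_const.
apply: ler_sum => i _; have := h i; rewrite /= in_itv/= -ler_norml => xL.
by rewrite -real_normK ?num_real// lerXn2r// ?nnegrE// (le_trans _ xL).
Qed.

Lemma sqnorm_notin_cube (L : R) x : 0 <= L -> ~ cube d L x -> L ^+ 2 <= sqnorm x.
Proof.
move=> L0 /existsNP[i]; rewrite /= in_itv/= -ler_norml => /negP; rewrite -ltNge => xL.
rewrite /sqnorm (bigD1 i)//= ler_wpDr//.
  by apply: sumr_ge0 => j _; exact: sqr_ge0.
by rewrite -[leRHS]real_normK ?num_real// lerXn2r// ?nnegrE// ltW.
Qed.

Lemma subset_cube (L M : R) : L <= M -> cube d L `<=` cube d M.
Proof.
move=> LM x h i; have := h i; rewrite /= !in_itv/= => /andP[h1 h2].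
by rewrite (le_trans _ h1) ?lerN2//= (le_trans h2).
Qed.

Definition dyadic_cube k : set T := cube d (2 ^+ k).

Lemma dyadic_cubeS k : dyadic_cube k `<=` dyadic_cube k.+1.
Proof. by apply: subset_cube; rewrite exprS ler_peMl ?exprn_ge0// ler1n. Qed.

Lemma dyadic_cube_le k l : (k <= l)%N -> dyadic_cube k `<=` dyadic_cube l.
Proof. by move=> kl; apply: subset_cube; rewrite ler_weXn2l// ler1n. Qed.

(** On this cube [D + sqnorm x <= (D + d) * 4^k], which is the origin of the constant [D + d]. *)
Lemma dyadic_weight p k x : dyadic_cube k x ->
  dyadic p k <= (D + d%:R) `^ (p%:R / 2) * weight p x.
Proof.
move=> xk; have Dd0 : 0 < D + d%:R :> R by rewrite ltr_wpDr.
rewrite -ler_pdivrMl ?powR_gt0// -powRN -dyadic_powR -powRM; last 2 first.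
- exact: ltW.
- by rewrite sqr_ge0.
apply: ler_powRN; first by rewrite divr_ge0.
  by rewrite ltr_pwDl// sqnorm_ge0.
rewrite mulrDl lerD//; last exact: sqnorm_cube.
by rewrite ler_peMr ?(ltW D0)// exprn_ege1// exprn_ege1// ler1n.
Qed.

(* The sum is geometric, hence comparable with its first non-zero term. *)
Lemma sum_dyadic_le p N x : (0 < p)%N ->
  \sum_(k < N) dyadic p k * \1_(dyadic_cube k) x <=
    2 * (D + d%:R) `^ (p%:R / 2) * weight p x.
Proof.
move=> p0; set c := _ `^ _; pose t k := dyadic p k * \1_(dyadic_cube k) x.
have t0 k : 0 <= t k by rewrite mulr_ge0// dyadic_ge0.
have tle k : t k <= c * weight p x.
  rewrite /t indicE; have [/set_mem xk|_] := boolP (x \in _).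
    by rewrite mulr1; exact: dyadic_weight.
  by rewrite mulr0 mulr_ge0 ?powR_ge0.
case: N => [|N]; first by rewrite big_ord0 !mulr_ge0 ?powR_ge0.
(* The induction counts the last term twice. Once [x] lies in the cube, the next term is at most
   half of the last one, so this quantity no longer increases; before that, all terms vanish. *)
suff : \sum_(k < N.+1) t k + t N <= 2 * c * weight p x /\
       (x \notin dyadic_cube N -> \sum_(k < N.+1) t k = 0).
  by move=> [h _]; apply: le_trans h; rewrite lerDl.
elim: N => [|N [IH1 IH2]].
  rewrite big_ord1; split; first by have := tle 0%N; lra.
  by rewrite /t indicE => /negbTE ->; rewrite mulr0.
split.
  rewrite big_ord_recr/=; have [xN|xN] := boolP (x \in dyadic_cube N).
    apply: le_trans IH1; rewrite -addrA lerD2l.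
    have : t N.+1 <= t N / 2.
      rewrite /t !indicE xN (mem_set (dyadic_cubeS (set_mem xN))) !mulr1.
      exact: dyadicS.
    by lra.
  by rewrite IH2// add0r; have := tle N.+1; lra.
move=> xN; rewrite big_ord_recr/= IH2; last first.
  by apply: contra xN => /set_mem/dyadic_cubeS/mem_set.
by rewrite /t indicE (negbTE xN) mulr0 add0r.
Qed.

Lemma weight_le_sum_dyadic N x : dyadic_cube N x ->
  weight d x <= Num.max (D `^ (- (d%:R / 2))) (2 ^+ d) *
    \sum_(k < N.+1) dyadic d k * \1_(dyadic_cube k) x.
Proof.
set C := Num.max _ _.
have C0 : 0 <= C by rewrite le_max powR_ge0.
elim: N => [x0|N IH xN].
  rewrite big_ord1 indicE mem_set// /dyadic expr0 invr1 expr1n !mulr1.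
  by rewrite le_max ler_powRN// ?divr_ge0// lerDl sqnorm_ge0.
rewrite big_ord_recr/= mulrDr.
have [xN'|xN'] := pselect (dyadic_cube N x).
  apply: (le_trans (IH xN')); rewrite lerDl mulr_ge0// mulr_ge0//.
  exact: dyadic_ge0.
rewrite ler_wpDl//.
  rewrite mulr_ge0//; apply: sumr_ge0 => k _; rewrite mulr_ge0//.
  exact: dyadic_ge0.
rewrite indicE mem_set// mulr1.
apply: (@le_trans _ _ (dyadic d N)).
  rewrite -dyadic_powR; apply: ler_powRN; first by rewrite divr_ge0.
    by rewrite exprn_gt0// exprn_gt0.
  rewrite ler_wpDl ?(ltW D0)//; exact: sqnorm_notin_cube.
have -> : dyadic d N = 2 ^+ d * dyadic d N.+1.
  by rewrite /dyadic -exprMn exprS invfM mulrA mulfV// mul1r.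
by rewrite ler_wpM2r ?dyadic_ge0// le_max lexx orbT.
Qed.

Lemma bigcup_dyadic_cube : \bigcup_k dyadic_cube k = [set: T].
Proof.
apply/seteqP; split => // x _.
pose M := \sum_i `|x ord0 i|.
exists (Num.truncn M).+1 => //; apply: (@subset_cube M).
  apply: (@le_trans _ _ (Num.truncn M).+1%:R); first exact/ltW/truncnS_gt.
  by rewrite -natrX ler_nat ltnW// ltn_expl.
move=> i /=; rewrite in_itv/= -ler_norml /M (bigD1 i)//= lerDl.
by apply: sumr_ge0.
Qed.

Lemma measurable_weight p : measurable_fun [set: T] (weight p).
Proof. by apply/measurable_EFinP; exact: measurable_density. Qed.

Local Open Scope ereal_scope.

Lemma sum_cube_integralE p N (g : T -> R) : measurable_fun [set: T] g ->
  (forall x, (0 <= g x)%R) ->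
  \sum_(k < N) (dyadic p k)%:E * \int[lebesgue_rV d]_(x in dyadic_cube k) (g x)%:E =
  \int[lebesgue_rV d]_x (g x * \sum_(k < N) dyadic p k * \1_(dyadic_cube k) x)%:E.
Proof.
move=> mg g0; have mC k : measurable (dyadic_cube k) by exact: measurable_cube.
have m1 k : measurable_fun [set: T] (fun x => (g x * \1_(dyadic_cube k) x)%:E).
  by apply/measurable_EFinP; exact: measurable_funM.
transitivity (\sum_(k < N) \int[lebesgue_rV d]_x
   ((dyadic p k)%:E * (g x * \1_(dyadic_cube k) x)%:E)).
  apply: eq_bigr => k _; rewrite ge0_integralZl//; last 2 first.
  - by move=> x _; rewrite lee_fin mulr_ge0.
  - by rewrite lee_fin dyadic_ge0.
  congr mule; rewrite [LHS]integral_mkcond; apply: eq_integral => x _.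
  by rewrite patchE indicE; case: ifP; rewrite (mulr1, mulr0).
rewrite -(ge0_integral_sum (lebesgue_rV d) measurableT (f := fun (k : 'I_N) x =>
    (dyadic p k)%:E * (g x * \1_(dyadic_cube k) x)%:E))//; last 2 first.
- by move=> k; exact: measurable_funeM.
- by move=> k x _; rewrite mule_ge0// lee_fin ?dyadic_ge0// mulr_ge0.
apply: eq_integral => x _; rewrite mulr_sumr -sumEFin.
by apply: eq_bigr => k _; rewrite -EFinM mulrCA.
Qed.

Lemma measurable_mul_weight p (g : T -> R) : measurable_fun [set: T] g ->
  measurable_fun [set: T] (fun x => (g x * weight p x)%:E).
Proof.
move=> mg; apply/measurable_EFinP; apply: measurable_funM => //.
exact: measurable_weight.
Qed.

Lemma sum_cube_integral_le p N (g : T -> R) : (0 < p)%N ->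
  measurable_fun [set: T] g -> (forall x, (0 <= g x)%R) ->
  \sum_(k < N) (dyadic p k)%:E * \int[lebesgue_rV d]_(x in dyadic_cube k) (g x)%:E <=
  (2 * (D + d%:R) `^ (p%:R / 2))%:E * \int[lebesgue_rV d]_x (g x * weight p x)%:E.
Proof.
move=> p0 mg g0; rewrite sum_cube_integralE//.
rewrite -ge0_integralZl//; last 3 first.
- exact: measurable_mul_weight.
- by move=> x _; rewrite lee_fin mulr_ge0// weight_ge0.
- by rewrite lee_fin mulr_ge0// powR_ge0.
apply: ge0_integral_mono => x _; last first.
  by rewrite -EFinM lee_fin mulrCA ler_wpM2l// sum_dyadic_le.
by rewrite lee_fin mulr_ge0//; apply: sumr_ge0 => k _; rewrite mulr_ge0// dyadic_ge0.
Qed.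

(** The pointwise bound by [N + 1] terms holds only inside cube [N]; it is integrated there, and the
    cubes then exhaust the space. *)
Lemma integral_le_sum_cube (g : T -> R) (M : \bar R) :
  measurable_fun [set: T] g -> (forall x, (0 <= g x)%R) ->
  (forall N, \sum_(k < N) (dyadic d k)%:E *
      \int[lebesgue_rV d]_(x in dyadic_cube k) (g x)%:E <= M) ->
  \int[lebesgue_rV d]_x (g x * weight d x)%:E <=
    (Num.max (D `^ (- (d%:R / 2))) (2 ^+ d))%:E * M.
Proof.
set C := Num.max _ _.
have C0 : (0 <= C)%R by rewrite le_max powR_ge0.
move=> mg g0 hM; rewrite -bigcup_dyadic_cube.
have cv : \int[lebesgue_rV d]_(x in dyadic_cube k) (g x * weight d x)%:E @[k --> \oo] -->
    \int[lebesgue_rV d]_(x in \bigcup_k dyadic_cube k) (g x * weight d x)%:E.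
  apply: ge0_nondecreasing_set_cvg_integral => //.
  - by move=> k l kl; apply/subsetPset; exact: dyadic_cube_le.
  - by move=> k; exact: measurable_cube.
  - by move=> k; apply: measurable_funTS; exact: measurable_mul_weight.
  - by move=> k x _; rewrite lee_fin mulr_ge0// weight_ge0.
rewrite -(cvg_lim _ cv)//; apply: lime_le; first by apply/cvg_ex; eexists; exact: cv.
apply: nearW => N; apply: le_trans (lee_wpmul2l _ (hM N.+1)); last by rewrite lee_fin.
have s0 x : (0 <= \sum_(k < N.+1) dyadic d k * \1_(dyadic_cube k) x)%R.
  by apply: sumr_ge0 => k _; rewrite mulr_ge0// dyadic_ge0.
have ms : measurable_fun [set: T] (fun x => \sum_(k < N.+1) dyadic d k * \1_(dyadic_cube k) x)%R.
  apply: measurable_sum => k; apply: measurable_funM => //.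
  by apply: measurable_indic; exact: measurable_cube.
rewrite sum_cube_integralE// -ge0_integralZl//; last 2 first.
- by apply/measurable_EFinP; exact: measurable_funM.
- by move=> x _; rewrite lee_fin mulr_ge0.
rewrite [leLHS]integral_mkcond; apply: ge0_integral_mono => x _.
  by rewrite patchE; case: ifP => // _; rewrite lee_fin mulr_ge0// weight_ge0.
rewrite patchE; case: ifP => [/set_mem xN|_]; last first.
  by rewrite -EFinM lee_fin !mulr_ge0.
by rewrite -EFinM lee_fin mulrCA ler_wpM2l// weight_le_sum_dyadic.
Qed.

End weights.

(** * Oscillations and means *)

Section mean_oscillation.
Local Open Scope ereal_scope.
Context d (X : measurableType d) (R : realType).
Variable m : {sigma_finite_measure set X -> \bar R}.
Implicit Types (A B : set X) (v f : X -> R).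

(** For a square-integrable [v] and [m A] finite, this is [2 m(A)] times the integral of the squared
    distance of [v] to its mean. The double integral avoids the mean and makes sense for every
    measurable [v]. *)
Definition oscillation A v : \bar R :=
  \int[m]_(x in A) \int[m]_(y in A) ((v x - v y) ^+ 2)%:E.

Lemma oscillation_ge0 A v : 0 <= oscillation A v.
Proof.
by apply: integral_ge0 => x _; apply: integral_ge0 => y _; rewrite lee_fin sqr_ge0.
Qed.

Let sq0 (r : R) : 0 <= (r ^+ 2)%:E. Proof. by rewrite lee_fin sqr_ge0. Qed.

Let measurable_inner A B v : measurable A -> measurable B ->
  measurable_fun [set: X] v ->
  measurable_fun A (fun x => \int[m]_(y in B) ((v x - v y) ^+ 2)%:E).
Proof.
move=> mA mB mv; exact: (@measurable_tonelli_on1 _ _ _ _ R m A B _ mA mB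
  (measurable_sqr_sub mv) (fun=> sq0 _)).
Qed.

Let measurable_abs v : measurable_fun [set: X] v ->
  measurable_fun [set: X] (fun x => (`|v x|)%:E).
Proof. by move=> mv; apply/measurable_EFinP; exact: measurableT_comp. Qed.

Let measurable_sq v : measurable_fun [set: X] v ->
  measurable_fun [set: X] (fun x => (v x ^+ 2)%:E).
Proof. by move=> mv; apply/measurable_EFinP; exact: measurable_funX. Qed.

Let integral_constant A (a : R) (r : \bar R) : measurable A -> m A = a%:E ->
  \int[m]_(x in A) r = r * a%:E.
Proof. by move=> mA <-; exact: integral_cst. Qed.

Ltac nonneg := intros; repeat first [done | apply: integral_ge0; intros |
  apply: adde_ge0 | apply: mule_ge0 | rewrite lee_fin; repeat first [done |
  apply: addr_ge0 | apply: mulr_ge0 | apply: sqr_ge0 | apply: divr_ge0 | apply: ltW]].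

Ltac measurability := repeat first [done | apply: measurable_inner |
  (apply: measurable_funTS; first [done | apply: measurable_abs |
    apply: measurable_sqr_subl | apply: measurable_sq]) |
  apply: emeasurable_funD | apply: measurable_funeM].

Ltac side := solve [measurability | nonneg].

(** Integrate [v(x)^2 <= (v(x) - v(y))^2 + 2 |v(x)| |v(y)|] over [A x A]. *)
Lemma integral_sqr_le_oscillation A (a : R) v : measurable A -> m A = a%:E ->
  measurable_fun [set: X] v ->
  a%:E * \int[m]_(x in A) (v x ^+ 2)%:E <= oscillation A v +
    2%:E * (\int[m]_(x in A) `|v x|%:E * \int[m]_(x in A) `|v x|%:E).
Proof.
move=> mA mAa mv; set I := \int[m]_(x in A) `|v x|%:E.
have a0 : (0 <= a)%R by rewrite -lee_fin -mAa.
have I0 : 0 <= I by apply: integral_ge0 => x _; rewrite lee_fin.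
apply: (@le_trans _ _ (\int[m]_(x in A)
   (\int[m]_(y in A) ((v x - v y) ^+ 2)%:E + (2%:E * I) * `|v x|%:E))).
  rewrite -ge0_integralZl//; last exact/measurable_funTS/measurable_sq; try side.
  apply: ge0_integral_mono => x Ax; first by rewrite mule_ge0.
  rewrite muleC -(integral_constant _ mA mAa).
  apply: (@le_trans _ _ (\int[m]_(y in A)
     (((v x - v y) ^+ 2)%:E + (2 * `|v x|)%:E * `|v y|%:E))).
    apply: ge0_integral_mono => // y Ay.
    rewrite -EFinM -EFinD lee_fin.
    have : (v x * v y <= `|v x| * `|v y|)%R by rewrite -normrM ler_norm.
    by have := sqr_ge0 (v y); nra.
  rewrite ge0_integralD//=; try side.
  rewrite ge0_integralZl//; try side.
  by rewrite -/I EFinM -!muleA (muleC I).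
rewrite ge0_integralD//=; try side.
rewrite ge0_integralZl//; try side.
by rewrite -/I muleA.
Qed.

(** Integrate [|v(x)| <= |v(y)| + u] over [A x B], where [u = |v(x) - v(y)|] is at most
    [t/2 + u^2/(2t)]. The free parameter [t] stands in for a Cauchy-Schwarz inequality and is
    optimised by the user. *)
Lemma integral_abs_le_oscillation A B (a b t : R) v :
  measurable A -> measurable B -> A `<=` B -> m A = a%:E -> m B = b%:E ->
  measurable_fun [set: X] v -> (0 < t)%R ->
  b%:E * \int[m]_(x in A) `|v x|%:E <= a%:E * \int[m]_(x in B) `|v x|%:E +
    (t / 2 * a * b)%:E + (2 * t)^-1%:E * oscillation B v.
Proof.
move=> mA mB AB mAa mBb mv t0; set I := \int[m]_(x in B) `|v x|%:E.
have a0 : (0 <= a)%R by rewrite -lee_fin -mAa.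
have b0 : (0 <= b)%R by rewrite -lee_fin -mBb.
have I0 : 0 <= I by apply: integral_ge0 => x _; rewrite lee_fin.
have t20 : (0 <= (2 * t)^-1)%R by rewrite invr_ge0 mulr_ge0// ltW.
apply: (@le_trans _ _ (\int[m]_(x in A)
   (I + (t / 2 * b)%:E + (2 * t)^-1%:E * \int[m]_(y in B) ((v x - v y) ^+ 2)%:E))).
  rewrite -ge0_integralZl//; last exact/measurable_funTS/measurable_abs; try side.
  apply: ge0_integral_mono => x Ax; first by rewrite mule_ge0.
  rewrite muleC -(integral_constant _ mB mBb).
  apply: (@le_trans _ _ (\int[m]_(y in B)
     (`|v y|%:E + (t / 2)%:E + (2 * t)^-1%:E * ((v x - v y) ^+ 2)%:E))).
    apply: ge0_integral_mono => // y Ay.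
    rewrite -EFinM -!EFinD lee_fin.
    have h : (`|v x| <= `|v y| + `|v x - v y|)%R.
      by rewrite -lerBlDl; exact: lerB_dist.
    apply: (le_trans h); rewrite -addrA lerD2l -(real_normK (num_real (v x - v y))).
    move: `|v x - v y|%R => u.
    rewrite -subr_ge0 (_ : _ - _ = (2 * t)^-1 * (t - u) ^+ 2)%R; first by rewrite mulr_ge0// sqr_ge0.
    by field; rewrite gt_eqF.
  rewrite ge0_integralD//=; try side.
  rewrite ge0_integralD//=; try side.
  rewrite (integral_constant _ mB mBb) -EFinM ge0_integralZl//; try side.
rewrite ge0_integralD//=; try side.
rewrite (integral_constant _ mA mAa) ge0_integralZl//; try side.
rewrite ge0_muleDl//; last by rewrite lee_fin mulr_ge0// divr_ge0// ltW.
rewrite (muleC I) -EFinM mulrAC; apply: leeD => //; apply: lee_wpmul2l => //.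
apply: ge0_subset_integral => //; first exact: measurable_inner.
by move=> x _; exact: integral_ge0.
Qed.

(** This carries Poincare's inequality from a smooth [f] to a measurable [v]. In the pointwise bound
    the errors at [x] and at [y] both have coefficient 4, and each integrates to [4 * a] times the
    squared distance. *)
Lemma oscillation_perturb A (a : R) v f : measurable A -> m A = a%:E ->
  measurable_fun [set: X] v -> measurable_fun [set: X] f ->
  oscillation A v <= 2%:E * oscillation A f +
    (8 * a)%:E * \int[m]_(x in A) ((v x - f x) ^+ 2)%:E.
Proof.
move=> mA mAa mv mf; set I := \int[m]_(x in A) ((v x - f x) ^+ 2)%:E.
have a0 : (0 <= a)%R by rewrite -lee_fin -mAa.
have I0 : 0 <= I by apply: integral_ge0.
have mu : measurable_fun [set: X] (fun x => ((v x - f x) ^+ 2)%:E).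
  by apply: measurable_sq; exact: measurable_funB.
apply: (@le_trans _ _ (\int[m]_(x in A)
   (2%:E * \int[m]_(y in A) ((f x - f y) ^+ 2)%:E + (4 * a)%:E * ((v x - f x) ^+ 2)%:E + 4%:E * I))).
  apply: ge0_integral_mono => x Ax; first exact: integral_ge0.
  apply: (@le_trans _ _ (\int[m]_(y in A)
     (2%:E * ((f x - f y) ^+ 2)%:E + (4%:E * ((v x - f x) ^+ 2)%:E) + 4%:E * ((v y - f y) ^+ 2)%:E))).
    apply: ge0_integral_mono => // y Ay.
    rewrite -!EFinM -!EFinD lee_fin -subr_ge0.
    set p := (v x - f x)%R; set q := (v y - f y)%R.
    have -> : (2 * (f x - f y) ^+ 2 + 4 * p ^+ 2 + 4 * q ^+ 2 - (v x - v y) ^+ 2 =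
      (f x - f y - (p - q)) ^+ 2 + 2 * (p + q) ^+ 2)%R by rewrite /p /q; ring.
    by apply: addr_ge0; [exact: sqr_ge0|apply: mulr_ge0 => //; exact: sqr_ge0].
  rewrite ge0_integralD//=; try side.
  rewrite ge0_integralD//=; try side.
  rewrite (integral_constant _ mA mAa) !ge0_integralZl//; try side.
  by rewrite -/I muleAC -EFinM.
rewrite ge0_integralD//=; try side.
rewrite ge0_integralD//=; try side.
rewrite (integral_constant _ mA mAa) !ge0_integralZl//; try side.
rewrite -/I -addeA -/(oscillation A f); apply: leeD => //.
rewrite muleAC -EFinM -ge0_muleDl ?lee_fin ?mulr_ge0//.
apply: lee_wpmul2r => //; rewrite lee_fin; lra.
Qed.

Lemma sqr_integral_abs_le A (a : R) v : measurable A -> m A = a%:E -> (0 < a)%R ->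
  measurable_fun [set: X] v -> \int[m]_(x in A) (v x ^+ 2)%:E < +oo ->
  \int[m]_(x in A) `|v x|%:E \is a fin_num /\
  ((fine (\int[m]_(x in A) `|v x|%:E) / a) ^+ 2 <=
     fine (\int[m]_(x in A) (v x ^+ 2)%:E) / a)%R.
Proof.
move=> mA mAa a0 mv; set Q := \int[m]_(x in A) (v x ^+ 2)%:E => Qoo.
have Q0 : 0 <= Q by apply: integral_ge0.
have Qfin : Q \is a fin_num by rewrite ge0_fin_numE.
set I := \int[m]_(x in A) `|v x|%:E.
have I0 : 0 <= I by apply: integral_ge0 => x _; rewrite lee_fin.
(* AM-GM: [2 s |v| <= v^2 + s^2] *)
have H (s : R) : (0 <= s)%R -> (2 * s)%:E * I <= Q + (s ^+ 2 * a)%:E.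
  move=> s0; rewrite -ge0_integralZl//; last 2 first.
  - by apply: measurable_funTS; exact: measurable_abs.
  - by rewrite lee_fin mulr_ge0.
  rewrite (EFinM (s ^+ 2)) -(integral_constant _ mA mAa) /Q -ge0_integralD//=; try side.
  apply: ge0_integral_mono => x Ax; first by rewrite -EFinM lee_fin !mulr_ge0.
  rewrite -EFinM -EFinD lee_fin -subr_ge0 -(real_normK (num_real (v x))).
  rewrite (_ : _ - _ = (`|v x| - s) ^+ 2)%R ?sqr_ge0//.
  by ring.
have Ifin : I \is a fin_num.
  (* The value [s = 1/2] makes the coefficient of [I] equal to 1, which gives finiteness. *)
  rewrite ge0_fin_numE//; have := H 2^-1%R (ltac:(by rewrite invr_ge0)).
  rewrite mulfV// mul1e => /le_lt_trans; apply.
  by rewrite lte_add_pinfty// ltry.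
split => //; move: H; rewrite -(fineK Ifin) -(fineK Qfin).
have : (0 <= fine I)%R by rewrite fine_ge0.
move: (fine I) (fine Q) => i q i0 /= H.
(* The best [s] is the mean of [|v|]; it turns [H] into Jensen's inequality. *)
have := H (i / a)%R (ltac:(by rewrite divr_ge0// ltW)).
rewrite -EFinM -EFinD lee_fin => h.
rewrite -(ler_pM2r a0) divfK ?gt_eqF//.
have : (2 * (i / a) * i = 2 * ((i / a) ^+ 2 * a))%R by field; rewrite gt_eqF.
by lra.
Qed.

End mean_oscillation.

(** * A Nash inequality for sequences *)

Section nash_sequence.
Context {R : realType}.
Variables (a e : nat -> R) (S Delta : R).
Hypothesis a0 : forall k, 0 <= a k.
Hypothesis ae : forall k, a k.+1 <= a k -> (a k - a k.+1) ^+ 2 <= e k.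
Hypothesis e0 : forall k, 0 <= e k.
Hypothesis aS : forall n, \sum_(k < n) a k ^+ 2 <= S.
Hypothesis eDelta : forall n, \sum_(k < n) e k <= Delta.

Lemma sqr_seq_vanishes k eps : 0 < eps -> exists2 n, (k <= n)%N & a n ^+ 2 <= eps.
Proof.
move=> eps0; apply: contrapT => /forall2NP H.
have h n : (k <= n)%N -> eps <= a n ^+ 2.
  by move=> kn; case: (H n) => [//|/negP]; rewrite -ltNge => /ltW.
have g n : eps *+ n <= \sum_(i < k + n) a i ^+ 2.
  elim: n => [|n IH]; first by rewrite mulr0n; apply: sumr_ge0 => i _; exact: sqr_ge0.
  by rewrite addnS big_ord_recr/= mulrSr lerD// h// leq_addr.
have S0 : 0 <= S by apply: le_trans (aS 0); rewrite big_ord0.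
have := le_trans (g (Num.truncn (S / eps)).+1) (aS _).
rewrite -mulr_natr mulrC -ler_pdivlMr// leNgt => /negP; apply.
exact: truncnS_gt.
Qed.

(** Telescoping of [a_i^2 - a_(i+1)^2 = (a_i - a_(i+1)) (a_i + a_(i+1))], the discrete form of
    integrating [(a^2)']. Increases only help; at a drop, Young's inequality bounds the product by
    [e_i / theta] plus [theta / 2] times the two squares, and each square occurs twice in the
    total. *)
Lemma sqr_seq_le k theta : 0 < theta -> a k ^+ 2 <= theta * S + Delta / theta.
Proof.
move=> t0; apply/ler_addgt0Pl => eps eps0.
(* The telescoping stops at an index where the boundary term is at most [eps]. *)
have [n kn ha] := sqr_seq_vanishes k eps0.
suff H j : a k ^+ 2 <= a (k + j)%N ^+ 2 +
    theta / 2 * (\sum_(i < k + j) a i ^+ 2 + \sum_(i < (k + j).+1) a i ^+ 2)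
    + (\sum_(i < k + j) e i) / theta.
  have := H (n - k)%N; rewrite subnKC// => /le_trans; apply.
  rewrite -addrA; apply: lerD => //; apply: lerD.
    by rewrite -mulrA ler_wpM2l ?(ltW t0)//; have := aS n; have := aS n.+1; lra.
  by rewrite ler_pM2r ?invr_gt0.
elim: j => [|j IH].
  rewrite addn0 -addrA lerDl; apply: addr_ge0.
    apply: mulr_ge0; first by rewrite divr_ge0// ltW.
    by apply: addr_ge0; apply: sumr_ge0 => i _; exact: sqr_ge0.
  by apply: divr_ge0; [exact: sumr_ge0|exact: ltW].
apply: (le_trans IH); rewrite addnS; set m := (k + j)%N.
rewrite !big_ord_recr/=.
move: (\sum_(i < m) _) (\sum_(i < m) _) => s1 s2.
have h1 : a m ^+ 2 <= a m.+1 ^+ 2 + theta / 2 * (a m ^+ 2 + a m.+1 ^+ 2) + e m / theta.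
  have [lt|le] := ltP (a m) (a m.+1).
    have : a m ^+ 2 <= a m.+1 ^+ 2 by rewrite ler_sqr ?nnegrE// ltW.
    have : 0 <= theta / 2 * (a m ^+ 2 + a m.+1 ^+ 2).
      by rewrite mulr_ge0 ?divr_ge0 ?addr_ge0 ?sqr_ge0// ltW.
    have : 0 <= e m / theta by rewrite divr_ge0// ltW.
    by lra.
  have h := ae le.
  have h2 : (a m - a m.+1) ^+ 2 / theta <= e m / theta by rewrite ler_pM2r ?invr_gt0.
  suff : a m ^+ 2 - a m.+1 ^+ 2 <= theta / 4 * (a m + a m.+1) ^+ 2 + (a m - a m.+1) ^+ 2 / theta.
    have : theta / 4 * (a m + a m.+1) ^+ 2 <= theta / 2 * (a m ^+ 2 + a m.+1 ^+ 2).
      rewrite -subr_ge0 (_ : _ - _ = theta / 4 * (a m - a m.+1) ^+ 2); last by field.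
      by rewrite mulr_ge0 ?sqr_ge0// divr_ge0// ltW.
    by lra.
  rewrite -subr_ge0 (_ : _ - _ = theta^-1 * (theta / 2 * (a m + a m.+1) - (a m - a m.+1)) ^+ 2).
    by rewrite mulr_ge0 ?sqr_ge0// invr_ge0 ltW.
  by field; rewrite gt_eqF.
by rewrite mulrDl; lra.
Qed.

End nash_sequence.

(** With [S] the supremum, [S <= (sup a) * A], and [sqr_seq_le] bounds [(sup a)^2] by
    [theta S + Delta / theta]. This is the analogue of bounding the sixth power of the L^2 norm by
    the squared L^2 norm of the derivative times the fourth power of the L^1 norm. The role of [B]
    is to make the supremum a genuine one. *)
Lemma nash_seq {R : realType} (a e : nat -> R) (B Delta A : R) :
  (forall k, 0 <= a k) -> (forall k, 0 <= e k) ->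
  (forall k, a k.+1 <= a k -> (a k - a k.+1) ^+ 2 <= e k) ->
  (forall n, \sum_(k < n) a k ^+ 2 <= B) ->
  (forall n, \sum_(k < n) e k <= Delta) -> 0 <= A ->
  (forall n, \sum_(k < n) a k <= A) ->
  sup (range (fun n => \sum_(k < n) a k ^+ 2)) ^+ 3 <= 4 * Delta * A ^+ 4.
Proof.
move=> a0 e0 ae aB eD A0 aA.
pose E := range (fun n => \sum_(k < n) a k ^+ 2).
have hE : has_sup E by split; [exists (\sum_(k < 0) a k ^+ 2); exists 0%N|exists B => _ [k _ <-]].
pose S := sup E.
have aS m : \sum_(k < m) a k ^+ 2 <= S by apply: ub_le_sup; [exact: hE.2|exists m].
have S0 : 0 <= S by apply: le_trans (aS 0); rewrite big_ord0.
rewrite -/E -/S.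
have D0 : 0 <= Delta by apply: le_trans (eD 0%N); rewrite big_ord0.
have [->|Sn0] := eqVneq S 0; first by rewrite expr0n/= !mulr_ge0// exprn_ge0.
have {Sn0}Sgt : 0 < S by rewrite lt_neqAle eq_sym Sn0.
have Ssq theta : 0 < theta -> S ^+ 2 <= (theta * S + Delta / theta) * A ^+ 2.
  move=> t0; set M := _ + _.
  have M0 : 0 <= M by rewrite addr_ge0// ?mulr_ge0// ?invr_ge0 ltW.
  have aM k : a k <= Num.sqrt M.
    by rewrite -(ler_sqr (a0 k : _ \is Num.nneg)) ?nnegrE ?sqrtr_ge0// sqr_sqrtr//; exact: (sqr_seq_le a0 ae e0 aS eD).
  have : S <= Num.sqrt M * A.
    apply: ge_sup; first exact: hE.1.
    move=> _ [m _ <-]; apply: (@le_trans _ _ (\sum_(k < m) Num.sqrt M * a k)).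
      by apply: ler_sum => k _; rewrite expr2 ler_wpM2r.
    by rewrite -mulr_sumr ler_wpM2l// sqrtr_ge0.
  move=> h; rewrite -[M in leRHS]sqr_sqrtr// -exprMn lerXn2r// nnegrE// mulr_ge0//.
have Agt : 0 < A.
  rewrite lt_neqAle A0 andbT; apply/eqP => A00.
  have := Ssq 1 ltr01; rewrite -A00 expr0n/= mulr0; by rewrite leNgt exprn_gt0.
(* This [theta] makes [theta * S * A ^+ 2] equal to half of [S ^+ 2], which is absorbed on the
   left. *)
have t0 : 0 < S / (2 * A ^+ 2) by rewrite divr_gt0// mulr_gt0// exprn_gt0.
have := Ssq _ t0.
have -> : (S / (2 * A ^+ 2) * S + Delta / (S / (2 * A ^+ 2))) * A ^+ 2 =
   S ^+ 2 / 2 + 2 * Delta * A ^+ 4 / S by field; rewrite !gt_eqF.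
move=> h; have {}h : S ^+ 2 / 2 <= 2 * Delta * A ^+ 4 / S by lra.
move: h; rewrite ler_pdivlMr// => h.
by rewrite (_ : S ^+ 3 = 2 * (S ^+ 2 / 2 * S)); [lra|field].
Qed.

(** * Dyadic estimates for functions of class C^1 *)

Section core_estimate.
Context {R : realType} {d : nat}.
Notation T := 'rV[measurableTypeR R]_d.
Notation lambda := (lebesgue_rV d).
Variable D : R.
Hypotheses (d3 : (3 <= d)%N) (D0 : 0 < D).

Definition volume k : R := (2 * 2 ^+ k) ^+ d.

Lemma volume_gt0 k : 0 < volume k.
Proof. by rewrite exprn_gt0// mulr_gt0// exprn_gt0. Qed.

Lemma volumeS k : volume k.+1 = 2 ^+ d * volume k.
Proof. by rewrite /volume exprS -exprMn. Qed.

Lemma dyadic_volume k : dyadic d k = 2 ^+ d / volume k :> R.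
Proof.
rewrite /dyadic /volume -expr_div_n; congr (_ ^+ _); field.
by rewrite expf_neq0.
Qed.

(** The factor [(2 ^+ k) ^+ 2] is the squared side in Poincare's inequality on the cube: the weight
    of the form is the one that makes this inequality uniform over the scales. *)
Lemma dyadic_subn2 k : dyadic (d - 2) k = (2 ^+ k) ^+ 2 * dyadic d k :> R.
Proof.
rewrite /dyadic -{2}(subnK (ltnW d3)) exprD mulrC -mulrA -exprMn mulVf ?expr1n ?mulr1//.
Qed.

Lemma lebesgue_dyadic_cube k : lambda (dyadic_cube k) = (volume k)%:E.
Proof. by rewrite lebesgue_cube ?exprn_ge0. Qed.

Local Notation c p := (2 * (D + d%:R) `^ (p%:R / 2)).

Lemma c_ge0 p : 0 <= c p.
Proof. by rewrite mulr_ge0 ?powR_ge0. Qed.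

Lemma dirichlet_formE (f : 'rV[R]_d -> R) :
  dirichlet_form D f = (\int[lambda]_x (sqgrad f x * weight D (d - 2) x)%:E)%E.
Proof.
rewrite /dirichlet_form; apply: eq_integral => x _; rewrite /weight natrB//.
exact: ltnW.
Qed.

Lemma sqgrad_ge0 (f : 'rV[R]_d -> R) x : 0 <= sqgrad f x.
Proof. by apply: sumr_ge0 => i _; exact: sqr_ge0. Qed.

Lemma measurable_class_C1 (f : 'rV[R]_d -> R) : class_C 1 f ->
  measurable_fun [set: T] f /\ measurable_fun [set: T] (sqgrad f).
Proof.
move=> [cf df]; split; first exact: continuous_measurable_rV.
apply: measurable_sum => i; apply: measurable_funX.
by apply: continuous_measurable_rV; exact: (df i).2.
Qed.

Local Open Scope ereal_scope.

Lemma sum_oscillation_class_C1 N (f : 'rV[R]_d -> R) : class_C 1 f ->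
  \sum_(k < N) (volume k ^- 2)%:E * oscillation lambda (dyadic_cube k) f <=
  (4 * c (d - 2))%:E * dirichlet_form D f.
Proof.
move=> Cf; have [_ ms] := measurable_class_C1 Cf.
rewrite EFinM -muleA dirichlet_formE.
apply: (@le_trans _ _ (4%:E * \sum_(k < N) (dyadic (d - 2) k)%:E *
    \int[lambda]_(x in dyadic_cube k) (sqgrad f x)%:E)); last first.
  apply: lee_wpmul2l => //; apply: sum_cube_integral_le => //.
  - by rewrite subn_gt0.
  - exact: sqgrad_ge0.
rewrite ge0_sume_distrr; last first.
  move=> k _; rewrite mule_ge0// ?lee_fin ?dyadic_ge0//.
  by apply: integral_ge0 => x _; rewrite lee_fin sqgrad_ge0.
apply: lee_sum => k _.
have := @poincare_cube R d (2 ^+ k)%R f (exprn_ge0 _ (ler0n _ _)) Cf.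
rewrite -/(oscillation lambda (dyadic_cube k) f).
move/(lee_wpmul2l (_ : 0 <= (volume k ^- 2)%:E)) => /(_ (ltac:(by rewrite lee_fin invr_ge0 exprn_ge0// ltW// volume_gt0))).
move/le_trans; apply; rewrite !muleA -!EFinM.
apply: lee_wpmul2r; first by apply: integral_ge0 => x _; rewrite lee_fin sqgrad_ge0.
(* Divided by the squared volume, the Poincare constant becomes [4 * dyadic (d - 2) k]. *)
rewrite lee_fin dyadic_subn2 dyadic_volume -/(volume k) le_eqVlt; apply/orP; left; apply/eqP.
by field; rewrite gt_eqF// volume_gt0.
Qed.

Lemma sum_cube_mean_le N (g : T -> R) : measurable_fun [set: T] g ->
  (forall x, (0 <= g x)%R) ->
  \sum_(k < N) (volume k)^-1%:E * \int[lambda]_(x in dyadic_cube k) (g x)%:E <=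
  (c d / 2 ^+ d)%:E * \int[lambda]_x (g x * weight D d x)%:E.
Proof.
move=> mg g0; have := @sum_cube_integral_le R d D D0 d N g (ltnW (ltnW d3)) mg g0.
have p0 : 0 <= ((2 ^+ d)^-1%R : R)%:E by rewrite lee_fin invr_ge0 exprn_ge0.
move/(lee_wpmul2l p0); rewrite muleA -EFinM (mulrC _ (c d)); apply: le_trans.
rewrite ge0_sume_distrr; last first.
  move=> k _; rewrite mule_ge0// ?lee_fin ?dyadic_ge0//.
  by apply: integral_ge0 => x _; rewrite lee_fin.
apply: lee_sum => k _; rewrite muleA -EFinM dyadic_volume.
by rewrite mulrA mulVf ?mul1r// expf_neq0.
Qed.

Lemma sum_oscillation_le N (v f : T -> R) : measurable_fun [set: T] v ->
  class_C 1 (f : 'rV[R]_d -> R) ->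
  \sum_(k < N) (volume k ^- 2)%:E * oscillation lambda (dyadic_cube k) v <=
  (8 * c (d - 2))%:E * dirichlet_form D f +
  (8 * (c d / 2 ^+ d))%:E * \int[lambda]_x ((v x - f x) ^+ 2 * weight D d x)%:E.
Proof.
move=> mv Cf; have [mf _] := measurable_class_C1 Cf.
have mvf : measurable_fun [set: T] (v \- f)%R by exact: measurable_funB.
apply: (@le_trans _ _ (\sum_(k < N) (2%:E * ((volume k ^- 2)%:E * oscillation lambda (dyadic_cube k) f)
   + 8%:E * ((volume k)^-1%:E * \int[lambda]_(x in dyadic_cube k) ((v x - f x) ^+ 2)%:E)))).
  apply: lee_sum => k _.
  have vk := volume_gt0 k.
  have p0 : 0 <= ((volume k ^- 2)%R : R)%:E by rewrite lee_fin invr_ge0 exprn_ge0// ltW.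
  have := oscillation_perturb (measurable_cube _) (lebesgue_dyadic_cube k) mv mf.
  move/(lee_wpmul2l p0)/le_trans; apply.
  rewrite ge0_muleDr; last 2 first.
  - by rewrite mule_ge0// oscillation_ge0.
  - rewrite mule_ge0// ?lee_fin ?mulr_ge0 ?(ltW vk)//.
    by apply: integral_ge0 => x _; rewrite lee_fin sqr_ge0.
  rewrite (muleCA _ 2%:E) leeD2l// !muleA -!EFinM.
  apply: lee_wpmul2r; first by apply: integral_ge0 => x _; rewrite lee_fin sqr_ge0.
  by rewrite lee_fin le_eqVlt; apply/orP; left; apply/eqP; field; rewrite gt_eqF.
rewrite big_split/= -!ge0_sume_distrr; last 2 first.
- move=> k _; rewrite mule_ge0// ?lee_fin ?invr_ge0 ?(ltW (volume_gt0 _))//.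
  by apply: integral_ge0 => x _; rewrite lee_fin sqr_ge0.
- by move=> k _; rewrite mule_ge0// ?oscillation_ge0// lee_fin invr_ge0 exprn_ge0// ltW// volume_gt0.
apply: leeD.
  have -> : (8 * c (d - 2) = 2 * (4 * c (d - 2)))%R by ring.
  rewrite [in leRHS]EFinM -[leRHS]muleA; apply: lee_wpmul2l => //.
  exact: sum_oscillation_class_C1.
rewrite [in leRHS]EFinM -[leRHS]muleA; apply: lee_wpmul2l => //.
apply: sum_cube_mean_le; first exact: (measurable_funX 2 mvf).
by move=> x; exact: sqr_ge0.
Qed.

End core_estimate.

(** * Dyadic estimates for functions of finite energy *)

Section core_inequality.
Context {R : realType} {d : nat}.
Notation T := 'rV[measurableTypeR R]_d.
Notation lambda := (lebesgue_rV d).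
Variable D : R.
Hypotheses (d3 : (3 <= d)%N) (D0 : 0 < D).
Local Open Scope ereal_scope.
Local Notation c p := (2 * (D + d%:R) `^ (p%:R / 2))%R.
Local Notation vol k := (@volume R d k).
Local Notation V v k := (oscillation lambda (dyadic_cube k) v).

(** All that is kept of an approximating sequence with energies tending to [J]: one C^1 approximant
    for each precision, close in squared norm of L^2(mu_star). *)
Definition energy_approximable (v : T -> R) (J : R) := forall e : R, (0 < e)%R ->
  exists f : 'rV[R]_d -> R, [/\ class_C 1 f, dirichlet_form D f <= (J + e)%:E &
    \int[lambda]_x ((v x - f x) ^+ 2 * weight D d x)%:E <= e%:E].

Lemma sum_oscillation_energy (v : T -> R) J N : measurable_fun [set: T] v ->
  energy_approximable v J ->
  \sum_(k < N) (vol k ^- 2)%:E * V v k <= (8 * c (d - 2) * J)%:E.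
Proof.
move=> mv vJ; set M := (8 * c (d - 2) + 8 * (c d / 2 ^+ d))%R.
have c0 p : (0 <= c p)%R by exact: c_ge0.
have M0 : (0 <= M)%R by rewrite addr_ge0// !mulr_ge0// ?invr_ge0 ?exprn_ge0// powR_ge0.
apply/lee_addgt0Pr => e e0.
(* [M] adds up the coefficients of the two errors. It does not depend on [N], so the precision can
   be fixed before summing. *)
have e'0 : (0 < e / (M + 1))%R by rewrite divr_gt0// ltr_wpDl.
have [f [Cf fJ vf]] := vJ _ e'0.
apply: le_trans (sum_oscillation_le d3 D0 N mv Cf) _.
apply: (@le_trans _ _ ((8 * c (d - 2))%:E * (J + e / (M + 1))%:E + (8 * (c d / 2 ^+ d))%:E * (e / (M + 1))%:E)).
  apply: leeD; apply: lee_wpmul2l => //.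
    by rewrite lee_fin mulr_ge0.
  by rewrite lee_fin mulr_ge0// divr_ge0.
rewrite -!EFinM -!EFinD lee_fin mulrDr -addrA lerD2l -mulrDl -/M.
by rewrite mulrCA ger_pMr// ler_pdivrMr ?mul1r ?ltr_wpDl// lerDl.
Qed.

Section one_function.
Variables (v : T -> R) (J : R).
Hypothesis mv : measurable_fun [set: T] v.
Hypothesis v2 : \int[lambda]_x (v x ^+ 2 * weight D d x)%:E < +oo.
Hypothesis J0 : (0 <= J)%R.
Hypothesis vJ : energy_approximable v J.

(** Normalised oscillation, mean of [v^2] and mean of [|v|]. Since [fine] sends infinite values to
    0, these numbers are meaningful only with the finiteness part of [wE], [qE] and [aE]. *)
Let w k := (fine (V v k) / vol k ^+ 2)%R.
Let q k := (fine (\int[lambda]_(x in dyadic_cube k) (v x ^+ 2)%:E) / vol k)%R.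
Let a k := (fine (\int[lambda]_(x in dyadic_cube k) (`|v x|)%:E) / vol k)%R.
Let N2 := fine (\int[lambda]_x (v x ^+ 2 * weight D d x)%:E).

Let vk k : (0 < vol k :> R)%R := @volume_gt0 R d k.

Let N2E : \int[lambda]_x (v x ^+ 2 * weight D d x)%:E = N2%:E.
Proof.
rewrite fineK// ge0_fin_numE//; apply: integral_ge0 => x _.
by rewrite lee_fin mulr_ge0 ?sqr_ge0// weight_ge0.
Qed.

Let i20 k : 0 <= \int[lambda]_(x in dyadic_cube k) (v x ^+ 2)%:E.
Proof. by apply: integral_ge0 => x _; rewrite lee_fin sqr_ge0. Qed.

Let i10 k : 0 <= \int[lambda]_(x in dyadic_cube k) (`|v x|)%:E.
Proof. by apply: integral_ge0 => x _; rewrite lee_fin. Qed.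

(** An infinite term, having a positive coefficient, would make a bounded partial sum infinite; so
    the inequalities may be read in the reals. *)
Let term_fin (F : nat -> \bar R) (r : nat -> R) (M : R) : (forall k, 0 <= F k) ->
  (forall k, (0 < r k)%R) -> (forall N, \sum_(k < N) (r k)%:E * F k <= M%:E) ->
  (forall k, F k = (fine (F k))%:E) /\
  (forall N, (\sum_(k < N) r k * fine (F k) <= M)%R).
Proof.
move=> F0 r0 H.
have Ffin k : F k \is a fin_num.
  rewrite ge0_fin_numE// ltNge; apply/negP; rewrite leye_eq => /eqP Fy.
  have := H k.+1; rewrite big_ord_recr/= Fy gt0_muley ?lte_fin// addey.
    by rewrite leye_eq.
  rewrite -ltNye; apply: lt_le_trans (ltNy0) _.
  by apply: sume_ge0 => i _; rewrite mule_ge0// lee_fin ltW.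
split=> [k|N]; first by rewrite fineK.
rewrite -lee_fin -sumEFin; apply: le_trans (H N).
by apply: lee_sum => k _; rewrite EFinM fineK.
Qed.

Let wE : (forall k, V v k = (fine (V v k))%:E) /\
  (forall N, (\sum_(k < N) w k <= 8 * c (d - 2) * J)%R).
Proof.
have [h1 h2] := @term_fin (fun k => V v k) (fun k => vol k ^- 2)%R _
  (fun k => oscillation_ge0 _ _ _)
  (fun k => ltac:(by rewrite invr_gt0 exprn_gt0))
  (fun N => sum_oscillation_energy N mv vJ).
split => // N; apply: le_trans (h2 N); apply: ler_sum => k _.
by rewrite /w mulrC.
Qed.

Let qE : (forall k, \int[lambda]_(x in dyadic_cube k) (v x ^+ 2)%:E =
    (fine (\int[lambda]_(x in dyadic_cube k) (v x ^+ 2)%:E))%:E) /\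
  (forall N, (\sum_(k < N) q k <= c d / 2 ^+ d * N2)%R).
Proof.
have [h1 h2] := @term_fin (fun k => \int[lambda]_(x in dyadic_cube k) (v x ^+ 2)%:E)
  (fun k => (vol k)^-1)%R (c d / 2 ^+ d * N2)%R i20
  (fun k => ltac:(by rewrite invr_gt0))
  (fun N => ltac:(by rewrite EFinM -N2E; apply: sum_cube_mean_le => //;
    [exact: measurable_funX|move=> x; exact: sqr_ge0])).
split => // N; apply: le_trans (h2 N); apply: ler_sum => k _.
by rewrite /q mulrC.
Qed.

Let aE k : \int[lambda]_(x in dyadic_cube k) (`|v x|)%:E =
    (fine (\int[lambda]_(x in dyadic_cube k) (`|v x|)%:E))%:E /\
  (a k ^+ 2 <= q k)%R.
Proof.
have [h1 h2] := @sqr_integral_abs_le _ _ _ lambda (dyadic_cube k) (vol k) v (measurable_cube _) (lebesgue_dyadic_cube k) (vk k) mv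
  (ltac:(by rewrite (qE.1 k) ltry)).
by split => //; rewrite fineK.
Qed.

Let w0 k : (0 <= w k)%R.
Proof. by rewrite divr_ge0 ?exprn_ge0 ?(ltW (vk k))// fine_ge0// oscillation_ge0. Qed.

Let a0 k : (0 <= a k)%R.
Proof. by rewrite divr_ge0 ?(ltW (vk k))// fine_ge0. Qed.

Let qle k : (q k <= w k + 2 * a k ^+ 2)%R.
Proof.
have := @integral_sqr_le_oscillation _ _ _ lambda (dyadic_cube k) (vol k) v
  (measurable_cube _) (lebesgue_dyadic_cube k) mv.
rewrite (qE.1 k) (wE.1 k) (aE k).1 -!EFinM -EFinD lee_fin /q /w /a => h.
rewrite -(ler_pM2r (exprn_gt0 2 (vk k))).
move: h; move: (fine _) (fine _) (fine _) => z y x h.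
have -> : (x / vol k * vol k ^+ 2 = vol k * x)%R by field; rewrite gt_eqF.
apply: (le_trans h); rewrite le_eqVlt; apply/orP; left; apply/eqP.
by field; rewrite gt_eqF.
Qed.

(** The parameter of [integral_abs_le_oscillation] is the drop [t] itself: half of the left-hand
    side is absorbed and [t^2] remains. The factor [2 ^+ d] is the ratio of the volumes of two
    consecutive cubes. *)
Let ae k : (a k.+1 <= a k)%R -> ((a k - a k.+1) ^+ 2 <= 2 ^+ d * w k.+1)%R.
Proof.
move=> ale; set t := (a k - a k.+1)%R.
have [t0|t0] := eqVneq t 0%R; first by rewrite t0 expr0n/= mulr_ge0// exprn_ge0.
have {t0} tgt : (0 < t)%R by rewrite lt_neqAle eq_sym t0 subr_ge0.
have := @integral_abs_le_oscillation _ _ _ lambda (dyadic_cube k) (dyadic_cube k.+1)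
  (vol k) (vol k.+1) t v (measurable_cube _) (measurable_cube _)
  (@dyadic_cubeS R d k) (lebesgue_dyadic_cube k) (lebesgue_dyadic_cube k.+1) mv tgt.
rewrite (wE.1 k.+1) (aE k).1 (aE k.+1).1 -!EFinM -!EFinD lee_fin => h.
have tE : (t = a k - a k.+1)%R by [].
rewrite /a in tE; rewrite /w; move: h tE; rewrite volumeS.
move: (fine _) (fine _) (fine _) => z y x.
set V0 := vol k; set P := (2 ^+ d : R)%R => h tE.
have P0 : (0 < P)%R by rewrite exprn_gt0.
have VV : (0 < V0)%R by exact: vk.
have h2 : (P * V0 ^+ 2 * t <= t / 2 * V0 * (P * V0) + (2 * t)^-1 * z)%R.
  rewrite [X in (X <= _)%R](_ : _ = P * V0 * x - V0 * y)%R; first by lra.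
  by rewrite tE; field; rewrite !gt_eqF// mulr_gt0.
have {h2} : (P * V0 ^+ 2 * t ^+ 2 <= z)%R.
  have t2 : (0 < 2 * t)%R by rewrite mulr_gt0.
  rewrite -(ler_pM2l t2) in h2.
  have e1 : (2 * t * (P * V0 ^+ 2 * t) = 2 * (P * V0 ^+ 2 * t ^+ 2))%R by ring.
  have e2 : (2 * t * (t / 2 * V0 * (P * V0) + (2 * t)^-1 * z) = P * V0 ^+ 2 * t ^+ 2 + z)%R.
    by field; rewrite gt_eqF.
  by move: h2; rewrite e1 e2; lra.
move=> h3; have -> : (P * (z / (P * V0) ^+ 2) = z / (P * V0 ^+ 2))%R.
  by field; rewrite !gt_eqF.
by rewrite ler_pdivlMr ?mulr_gt0// ?exprn_gt0// mulrC.
Qed.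

Let S := sup (range (fun n => \sum_(k < n) a k ^+ 2)%R).

Let sum_a2 n : (\sum_(k < n) a k ^+ 2 <= c d / 2 ^+ d * N2)%R.
Proof. by apply: le_trans (qE.2 n); apply: ler_sum => k _; exact: (aE k).2. Qed.

Let sum_e n : (\sum_(k < n) 2 ^+ d * w k.+1 <= 2 ^+ d * (8 * c (d - 2) * J))%R.
Proof.
rewrite -mulr_sumr ler_wpM2l ?exprn_ge0//; apply: le_trans (wE.2 n.+1).
by rewrite big_ord_recl/= lerDr.
Qed.

Let has_supS : has_sup (range (fun n => \sum_(k < n) a k ^+ 2)%R).
Proof.
split; first by exists (\sum_(k < 0) a k ^+ 2)%R; exists 0%N.
by exists (c d / 2 ^+ d * N2)%R => _ [n _ <-].
Qed.

(** The last item is not contained in the third: if [v] is not integrable, no finite [A] is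
    available. It expresses that a function of zero energy has zero means, as a constant in L^2 of
    an infinite measure must. *)
Lemma core_inequality : [/\ (0 <= S)%R,
  (N2 <= Num.max (D `^ (- (d%:R / 2))) (2 ^+ d) * (2 ^+ d * (8 * c (d - 2) * J + 2 * S)))%R,
  (forall A : R, (0 <= A)%R -> \int[lambda]_x (`|v x| * weight D d x)%:E <= A%:E ->
     (S ^+ 3 <= 4 * (2 ^+ d * (8 * c (d - 2) * J)) * (c d / 2 ^+ d * A) ^+ 4)%R) &
  (J = 0%R -> S = 0%R)].
Proof.
have aS n : (\sum_(k < n) a k ^+ 2 <= S)%R by apply: ub_le_sup; [exact: has_supS.2|exists n].
have S0 : (0 <= S)%R by apply: le_trans (aS 0%N); rewrite big_ord0.
have e0 k : (0 <= 2 ^+ d * w k.+1)%R by rewrite mulr_ge0// exprn_ge0.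
split => //.
- rewrite -lee_fin -N2E EFinM; apply: integral_le_sum_cube => //.
  + exact: measurable_funX.
  + by move=> x; exact: sqr_ge0.
  move=> N.
  have -> : \sum_(k < N) (dyadic d k)%:E * \int[lambda]_(x in dyadic_cube k) (v x ^+ 2)%:E =
      (2 ^+ d * \sum_(k < N) q k)%:E.
    rewrite mulr_sumr -sumEFin; apply: eq_bigr => k _.
    by rewrite (qE.1 k) -EFinM dyadic_volume /q mulrAC mulrA.
  rewrite lee_fin ler_wpM2l ?exprn_ge0//.
  apply: (@le_trans _ _ (\sum_(k < N) (w k + 2 * a k ^+ 2))%R); first exact: ler_sum.
  rewrite big_split/= -mulr_sumr; apply: lerD; first exact: wE.2.
  by apply: ler_wpM2l => //; exact: aS.
- move=> A A0 hA; apply: (nash_seq a0 e0 ae sum_a2 sum_e).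
    by rewrite mulr_ge0// divr_ge0 ?c_ge0// exprn_ge0.
  move=> n; rewrite -lee_fin -sumEFin.
  apply: (@le_trans _ _ (\sum_(k < n) (vol k)^-1%:E * \int[lambda]_(x in dyadic_cube k) (`|v x|)%:E)).
    by apply: lee_sum => k _; rewrite (aE k).1 -EFinM /a mulrC.
  apply: le_trans (sum_cube_mean_le d3 D0 n _ _) _ => //; first exact: measurableT_comp.
  by rewrite [leRHS]EFinM; apply: lee_wpmul2l => //; rewrite lee_fin divr_ge0 ?c_ge0// exprn_ge0.
(* With zero total energy, [sqr_seq_le] reads [a_k^2 <= theta * B] for every positive [theta]. *)
- move=> J00; have an0 k : a k = 0%R.
    apply/eqP; rewrite -sqrf_eq0 eq_le sqr_ge0 andbT; apply/ler_addgt0Pl => eps eps0.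
    pose B := (c d / 2 ^+ d * N2)%R; have sB n : (\sum_(k < n) a k ^+ 2 <= B)%R by exact: sum_a2.
    have B0 : (0 <= B)%R by apply: le_trans (sB 0%N); rewrite big_ord0.
    have t0 : (0 < eps / (B + 1))%R by rewrite divr_gt0// ltr_wpDl.
    have := sqr_seq_le a0 ae e0 sB sum_e k t0.
    rewrite J00 !mulr0 mul0r !addr0 => /le_trans; apply.
    by rewrite -mulrA ger_pMr// mulrC ler_pdivrMr ?mul1r ?ltr_wpDl// lerDl.
  apply/eqP; rewrite eq_le S0 andbT; apply: ge_sup; first exact: has_supS.1.
  by move=> _ [n _ <-]; rewrite big1// => k _; rewrite an0 expr0n.
Qed.

End one_function.

End core_inequality.

(** * Test functions and the Dirichlet form *)

Section class_C_calculus.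
Context {R : realType} {d : nat}.
Implicit Types f g : 'rV[R]_d -> R.

Lemma class_C_pred k f : class_C k.+1 f -> class_C k f.
Proof.
elim: k f => [f []//|k IH f [cf df]]; split => // i.
by have [df1 df2] := df i; split => //; exact: IH.
Qed.

Lemma partialD f g i : (forall x, derivable f x (delta_mx ord0 i)) ->
  (forall x, derivable g x (delta_mx ord0 i)) ->
  partial_derivative i (f \+ g) = partial_derivative i f \+ partial_derivative i g.
Proof. by move=> df dg; apply/funext => x; rewrite /partial_derivative deriveD. Qed.

Lemma partialB f g i : (forall x, derivable f x (delta_mx ord0 i)) ->
  (forall x, derivable g x (delta_mx ord0 i)) ->
  partial_derivative i (f \- g) = partial_derivative i f \- partial_derivative i g.
Proof. by move=> df dg; apply/funext => x; rewrite /partial_derivative deriveB. Qed.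

Lemma partialM f g i : (forall x, derivable f x (delta_mx ord0 i)) ->
  (forall x, derivable g x (delta_mx ord0 i)) ->
  partial_derivative i (f \* g) =
  (f \* partial_derivative i g) \+ (g \* partial_derivative i f).
Proof. by move=> df dg; apply/funext => x; rewrite /partial_derivative deriveM. Qed.

Lemma class_CD k f g : class_C k f -> class_C k g -> class_C k (f \+ g).
Proof.
elim: k f g => [|k IH] f g /= Cf Cg.
  by move=> x; exact: (cvgD (Cf x) (Cg x)).
case: Cf Cg => [cf df] [cg dg]; split.
  by move=> x; exact: (cvgD (cf x) (cg x)).
move=> i; have [df1 df2] := df i; have [dg1 dg2] := dg i; split.
  by move=> x; exact: derivableD.
by rewrite (partialD df1 dg1); exact: IH.
Qed.

Lemma class_CB k f g : class_C k f -> class_C k g -> class_C k (f \- g).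
Proof.
elim: k f g => [|k IH] f g /= Cf Cg.
  by move=> x; exact: (cvgB (Cf x) (Cg x)).
case: Cf Cg => [cf df] [cg dg]; split.
  by move=> x; exact: (cvgB (cf x) (cg x)).
move=> i; have [df1 df2] := df i; have [dg1 dg2] := dg i; split.
  by move=> x; exact: derivableB.
by rewrite (partialB df1 dg1); exact: IH.
Qed.

Lemma class_CM k f g : class_C k f -> class_C k g -> class_C k (f \* g).
Proof.
elim: k f g => [|k IH] f g /= Cf Cg.
  by move=> x; exact: (cvgM (Cf x) (Cg x)).
case: (Cf) (Cg) => [cf df] [cg dg]; split.
  by move=> x; exact: (cvgM (cf x) (cg x)).
move=> i; have [df1 df2] := df i; have [dg1 dg2] := dg i; split.
  by move=> x; exact: derivableM.
rewrite (partialM df1 dg1); apply: class_CD; apply: IH.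
- exact: (class_C_pred Cf).
- exact: dg2.
- exact: (class_C_pred Cg).
- exact: df2.
Qed.

Lemma class_C_cst k (c : R) : class_C k (fun _ : 'rV[R]_d => c).
Proof.
elim: k c => [|k IH] c; first exact: cst_continuous.
split; first exact: cst_continuous.
move=> i; split; first by move=> x; exact: derivable_cst.
rewrite (_ : partial_derivative i _ = fun=> 0); first exact: IH.
by apply/funext => x; exact: derive_cst.
Qed.

Lemma mx_coord_le_norm (x : 'rV[R]_d) i : `|x ord0 i| <= `|x|.
Proof.
rewrite [leRHS]/Num.norm/= mx_normrE; apply/bigmax_geP; right => /=.
by exists (ord0, i).
Qed.

Lemma compact_cube (L : R) : compact (cube d L : set 'rV[R]_d).
Proof.
by apply: (@rV_compact _ _ (fun=> `[- L, L]%classic)) => _; exact: segment_compact.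
Qed.

Lemma closed_cube (L : R) : closed (cube d L : set 'rV[R]_d).
Proof. by apply: compact_closed; [exact: norm_hausdorff|exact: compact_cube]. Qed.

(** Compact supports are handled through an enclosing cube, which is stable under derivation and
    fits the integrals over cubes. *)
Definition vanishes_outside (L : R) f := forall x, ~ cube d L x -> f x = 0.

Lemma compact_supportP f : compact (closure [set x | f x != 0]) <->
  exists2 L, 0 <= L & vanishes_outside L f.
Proof.
split.
  move=> /compact_bounded[M [_ hM]]; exists (Num.max 0 (M + 1)).
    by rewrite le_max lexx.
  move=> x xL; apply/eqP/negPn/negP => fx; apply: xL => i.
  rewrite /= in_itv/= -ler_norml; apply: le_trans (mx_coord_le_norm _ _) _.
  apply: hM; first by rewrite lt_max ltrDl ltr01 orbT.
  exact: subset_closure.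
move=> [L L0 fL]; apply: subclosed_compact (@closed_closure _ _) (@compact_cube L) _.
rewrite [X in _ `<=` X](closure_id _).1; last exact: closed_cube.
by apply: closure_subset => x /= fx; apply: contrapT => /fL; exact/eqP.
Qed.

Lemma vanishes_outside_partial L f i : vanishes_outside L f ->
  vanishes_outside L (partial_derivative i f).
Proof.
move=> fL x xL; rewrite /partial_derivative -(derive_cst (0 : R) x (delta_mx ord0 i)).
apply: near_eq_derive.
have : nbhs x (~` cube d L) by apply: open_nbhs_nbhs; split => //; exact/closed_openC/closed_cube.
by apply: filterS => y; exact: fL.
Qed.

Lemma test_functionP f : test_function f <->
  (forall k, class_C k f) /\ exists2 L, 0 <= L & vanishes_outside L f.
Proof. by split => -[Cf] /compact_supportP. Qed.

Lemma test_functionB f g : test_function f -> test_function g -> test_function (f \- g).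
Proof.
move=> /test_functionP[Cf [L L0 fL]] /test_functionP[Cg [M M0 gM]].
apply/test_functionP; split; first by move=> k; exact: class_CB.
exists (L + M); first exact: addr_ge0.
move=> x xLM /=; rewrite fL ?gM ?subr0// => h; apply: xLM; apply: subset_cube h.
  by rewrite lerDr.
by rewrite lerDl.
Qed.

Lemma continuous_bounded_support L f : continuous f -> vanishes_outside L f ->
  exists2 M, 0 <= M & forall x, `|f x| <= M.
Proof.
move=> cf fL.
have /compact_bounded[M [_ hM]] : compact (f @` cube d L).
  by apply: continuous_compact; [exact: continuous_subspaceT|exact: compact_cube].
exists (Num.max 0 (M + 1)); first by rewrite le_max lexx.
move=> x; have [xL|xL] := pselect (cube d L x); last first.
  by rewrite fL// normr0 le_max lexx.
by apply: hM; [rewrite lt_max ltrDl ltr01 orbT|exists x].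
Qed.

Lemma integrable_bounded_support L f : 0 <= L -> continuous f -> vanishes_outside L f ->
  (lebesgue_rV d).-integrable [set: 'rV[measurableTypeR R]_d] (EFin \o f).
Proof.
move=> L0 cf fL; have [M M0 fM] := continuous_bounded_support cf fL.
apply/integrableP; split.
  by apply/measurable_EFinP; exact: continuous_measurable_rV.
apply: (@le_lt_trans _ _ (\int[lebesgue_rV d]_(x in cube d L) (cst M%:E x))%E).
  rewrite [leRHS]integral_mkcond; apply: ge0_integral_mono => x _.
    by rewrite abse_ge0.
  rewrite patchE; case: ifPn => [_|]; first by rewrite /= lee_fin.
  by rewrite notin_setE => /fL; rewrite /= => ->; rewrite normr0.
rewrite integral_cst//= lebesgue_cube// -EFinM ltry//.
Qed.

End class_C_calculus.

(** * Energies along approximating sequences *)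

Section energy.
Context {R : realType} {d : nat}.
Notation T := 'rV[measurableTypeR R]_d.
Notation lambda := (lebesgue_rV d).
Variable D : R.
Hypotheses (d3 : (3 <= d)%N) (D0 : 0 < D).
Implicit Types f g : 'rV[R]_d -> R.

Lemma continuous_coord (i : 'I_d) : continuous (fun x : 'rV[R]_d => x ord0 i).
Proof. exact: coord_continuous. Qed.

Lemma continuous_sum_fun (I : Type) (r : seq I) (h : I -> 'rV[R]_d -> R) :
  (forall i, continuous (h i)) -> continuous (fun x => \sum_(i <- r) h i x).
Proof.
move=> ch; elim: r => [|i r IH].
  rewrite (_ : (fun _ => _) = cst 0); first exact: cst_continuous.
  by apply/funext => x; rewrite big_nil.
rewrite (_ : (fun _ => _) = h i \+ (fun x => \sum_(j <- r) h j x)).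
  by move=> x; exact: (cvgD (ch i x) (IH x)).
by apply/funext => x; rewrite big_cons.
Qed.

Lemma continuous_sqnorm : continuous (@sqnorm R d).
Proof.
apply: continuous_sum_fun => i x.
by apply: (@continuous_comp _ _ _ (fun x : 'rV[R]_d => x ord0 i) (fun t : R => t ^+ 2));
  [exact: continuous_coord|exact: exprn_continuous].
Qed.

Lemma continuous_shift_powR (p : R) : continuous (fun x : 'rV[R]_d => (D + sqnorm x) `^ p).
Proof.
move=> x; apply: (@continuous_comp _ _ _ (fun x : 'rV[R]_d => D + sqnorm x) (fun t : R => t `^ p)).
  exact: (@class_CD R d 0 _ _ (@class_C_cst R d 0 D) continuous_sqnorm).
apply: differentiable_continuous; apply/derivable1_diffP.
have h : 0 < D + sqnorm x by rewrite ltr_pwDl// sqnorm_ge0.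
by case: (is_derive1_powR p h).
Qed.

Lemma continuous_sqgrad f : class_C 1 f -> continuous (sqgrad f).
Proof.
move=> [_ df]; apply: continuous_sum_fun => i x.
by apply: (@continuous_comp _ _ _ (partial_derivative i f) (fun t : R => t ^+ 2));
  [exact: (df i).2|exact: exprn_continuous].
Qed.

Lemma vanishes_outside_sqgrad L f : vanishes_outside L f -> vanishes_outside L (sqgrad f).
Proof.
move=> fL x xL; rewrite /sqgrad big1// => i _.
by rewrite (vanishes_outside_partial _ fL xL) expr0n.
Qed.

Local Open Scope ereal_scope.

Lemma dirichlet_form_ge0 f : 0 <= dirichlet_form D f.
Proof.
by apply: integral_ge0 => x _; rewrite lee_fin mulr_ge0// ?powR_ge0// sqgrad_ge0.
Qed.

Lemma dirichlet_form_fin f : test_function f -> dirichlet_form D f \is a fin_num.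
Proof.
move=> /test_functionP[Cf [L L0 fL]].
rewrite /dirichlet_form; apply: integrable_fin_num => //.
apply: (@integrable_bounded_support _ _ L (fun x => sqgrad f x * (D + sqnorm x) `^ (- ((d%:R - 2) / 2)))%R) => //.
  exact: (@class_CM R d 0 _ _ (continuous_sqgrad (Cf 1%N)) (@continuous_shift_powR _)).
by move=> x xL; rewrite (vanishes_outside_sqgrad fL xL) mul0r.
Qed.

Lemma measurable_dirichlet f : class_C 1 f ->
  measurable_fun [set: T] (fun x => (sqgrad f x * (D + sqnorm x) `^ (- ((d%:R - 2) / 2)))%:E).
Proof.
move=> Cf; apply/measurable_EFinP; apply: measurable_funM; first exact: (measurable_class_C1 Cf).2.
by apply/measurable_EFinP; exact: measurable_density.
Qed.

(** The triangle inequality for the square root of the form, squared by means of Young's inequality.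
    [theta = 1] gives bounds up to a factor 2, and a small [theta] gives convergence of energies. *)
Lemma dirichlet_form_perturb f g (theta : R) : class_C 1 f -> class_C 1 g -> (0 < theta)%R ->
  dirichlet_form D f <= (1 + theta)%:E * dirichlet_form D g +
    (1 + theta^-1)%:E * dirichlet_form D (f \- g)%R.
Proof.
move=> Cf Cg t0; have Cfg := class_CB Cf Cg.
have w0 x : (0 <= (D + sqnorm x) `^ (- ((d%:R - 2) / 2)))%R by exact: powR_ge0.
have t1 : (0 <= 1 + theta)%R by rewrite addr_ge0// ltW.
have t2 : (0 <= 1 + theta^-1)%R by rewrite addr_ge0// invr_ge0 ltW.
have q0 h x : 0 <= (sqgrad h x * (D + sqnorm x) `^ (- ((d%:R - 2) / 2)))%:E.
  by rewrite lee_fin mulr_ge0// sqgrad_ge0.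
rewrite -!ge0_integralZl//; [|exact: measurable_dirichlet|exact: measurable_dirichlet].
rewrite -ge0_integralD//; last 4 first.
- by move=> x _; rewrite mule_ge0.
- by apply: measurable_funeM; exact: measurable_dirichlet.
- by move=> x _; rewrite mule_ge0.
- by apply: measurable_funeM; exact: measurable_dirichlet.
apply: ge0_integral_mono => x _ //.
rewrite -!EFinM -EFinD lee_fin !mulrA -mulrDl ler_wpM2r//.
rewrite /sqgrad !mulr_sumr -big_split/=; apply: ler_sum => i _.
case: Cf Cg => [_ df] [_ dg].
rewrite partialB; [|exact: (df i).1|exact: (dg i).1].
rewrite /=; move: (partial_derivative i f x) (partial_derivative i g x) => u w.
rewrite -subr_ge0 (_ : _ - _ = theta^-1 * (theta * w - (u - w)) ^+ 2)%R.
  by rewrite mulr_ge0 ?sqr_ge0// invr_ge0 ltW.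
by field; rewrite gt_eqF.
Qed.

Lemma form_approximation_cvg (v : T -> R) phi : form_approximation D v phi ->
  exists2 J : R, (0 <= J)%R & dirichlet_form D (phi n) @[n --> \oo] --> J%:E.
Proof.
move=> [tphi _ cphi].
have [a aE] : exists a : nat -> R, forall n, dirichlet_form D (phi n) = (a n)%:E.
  exists (fun n => fine (dirichlet_form D (phi n))) => n.
  by rewrite fineK//; exact: dirichlet_form_fin.
have a0 n : (0 <= a n)%R by rewrite -lee_fin -aE dirichlet_form_ge0.
have h m n theta e : (0 < theta)%R -> dirichlet_form D (phi m \- phi n)%R <= e%:E ->
    (a m <= (1 + theta) * a n + (1 + theta^-1) * e)%R.
  move=> t0 he; have := dirichlet_form_perturb ((tphi m).1 1%N) ((tphi n).1 1%N) t0.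
  rewrite !aE => /le_trans H; rewrite -lee_fin; apply: H.
  rewrite [leRHS]EFinD; apply: leeD; first by rewrite -EFinM.
  rewrite [leRHS]EFinM; apply: lee_wpmul2l => //.
  by rewrite lee_fin addr_ge0// invr_ge0 ltW.
have [N1 hN1] := cphi 1%R ltr01.
(* Boundedness comes first, with [theta = 1] and error 1; the next step needs it to choose
   [theta]. *)
pose B := (2 * a N1 + 2)%R.
have aB n : (N1 <= n)%N -> (a n <= B)%R.
  move=> N1n; have := h n N1 1%R 1%R ltr01 (hN1 _ _ N1n (leqnn _)).
  by rewrite invr1 /B; lra.
have B0 : (0 <= B)%R by rewrite addr_ge0// mulr_ge0.
have ca : cauchy (a n @[n --> \oo]).
  apply/cauchyP => e e0.
  (* [theta] makes [theta * B] at most [e / 4]; then [e'] makes the other error term equal to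
     [e / 4]. *)
  pose theta := (e / (4 * (B + 1)))%R.
  have t0 : (0 < theta)%R by rewrite divr_gt0// mulr_gt0// ltr_wpDl.
  have t1 : (0 < 1 + theta^-1)%R by rewrite addr_gt0// invr_gt0.
  pose e' := (e / (4 * (1 + theta^-1)))%R.
  have e'0 : (0 < e')%R by rewrite divr_gt0// mulr_gt0.
  have [N2 hN2] := cphi e' e'0.
  have k m n : (maxn N1 N2 <= m)%N -> (maxn N1 N2 <= n)%N -> (a m - a n <= e / 2)%R.
    rewrite !geq_max => /andP[m1 m2] /andP[n1 n2].
    have H := h m n theta e' t0 (hN2 _ _ m2 n2).
    have H2 : (theta * a n <= e / 4)%R.
      apply: (@le_trans _ _ (theta * B)%R); first by rewrite ler_wpM2l ?aB// ltW.
      rewrite /theta invfM mulrA -mulrA ger_pMr ?divr_gt0//.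
      by rewrite mulrC ler_pdivrMr ?mul1r ?ltr_wpDl// lerDl.
    have H3 : ((1 + theta^-1) * e' = e / 4)%R
      by rewrite /e'; move: (1 + theta^-1)%R t1 => r r0; field; rewrite gt_eqF.
    by lra.
  exists (a (maxn N1 N2)); exists (maxn N1 N2) => // n /= nN; rewrite /ball/=.
  rewrite ltr_distlC; have := k _ _ nN (leqnn _); have := k _ _ (leqnn _) nN.
  by move=> *; apply/andP; split; lra.
have : a n @[n --> \oo] --> lim (a n @[n --> \oo]) by exact: R_complete ca.
set J := lim _ => aJ; exists J.
  by apply: limr_ge; [exact: aJ|exact: nearW].
rewrite (_ : (fun n => dirichlet_form D (phi n)) = EFin \o a); last exact/funext.
by apply: cvg_EFin => //; exact: nearW.
Qed.

(** Convergence of energies makes the set in [closed_form] inhabited, so [get] returns one of its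
    elements: a finite limit, attained along some approximation that may differ from the given
    one. *)
Lemma closed_formP (v : T -> R) : form_domain D v -> exists (phi : ('rV[R]_d -> R)^nat) (J : R),
  [/\ form_approximation D v phi, (0 <= J)%R, closed_form D v = J%:E &
      dirichlet_form D (phi n) @[n --> \oo] --> J%:E].
Proof.
move=> [_ [phi aphi]]; have [J _ phiJ] := form_approximation_cvg aphi.
have /getPex : [set J : \bar R | exists2 phi, form_approximation D v phi &
    dirichlet_form D (phi n) @[n --> \oo] --> J] !=set0 by exists J%:E; exists phi.
rewrite -/(closed_form D v) => -[psi apsi psiJ].
have [J' J'0 psiJ'] := form_approximation_cvg apsi.
exists psi, J'; split => //.
by apply: cvg_unique psiJ psiJ' => //; exact: ereal_hausdorff.
Qed.

End energy.

(** * The inequality with constant C (1 + c0) *)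

Section norms.
Context {R : realType} {d : nat}.
Notation T := 'rV[measurableTypeR R]_d.
Notation lambda := (lebesgue_rV d).
Variable D : R.
Implicit Types u v : T -> R.
Local Open Scope ereal_scope.

Lemma integral_mu_star (f : T -> \bar R) : measurable_fun [set: T] f -> (forall x, 0 <= f x) ->
  \int[mu_star D]_x f x = \int[lambda]_x (f x * (weight D d x)%:E).
Proof.
move=> mf f0; apply: integral_density => //; first exact: measurable_weight.
by move=> x; exact: powR_ge0.
Qed.

Lemma sqr_Lnorm2 u : measurable_fun [set: T] u ->
  'N[mu_star D]_2%:E[EFin \o u] ^+ 2 = \int[lambda]_x (u x ^+ 2 * weight D d x)%:E.
Proof.
move=> mu; have sqrE (x : \bar R) : 0 <= x -> x ^+ 2 = x `^ 2.
  case: x => [r||]//; last by rewrite poweRyr.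
  by rewrite lee_fin poweR_EFin -EFin_expe => r0; rewrite (@powR_mulrn _ r 2).
have absE (r : R) : `|r%:E| `^ 2 = (r ^+ 2)%:E.
  by rewrite -sqrE ?abse_ge0// abse_EFin -EFin_expe real_normK ?num_real.
rewrite sqrE ?Lnorm_ge0// poweR_Lnorm//.
under eq_integral do rewrite absE.
rewrite integral_mu_star//; first by apply/measurable_EFinP; exact: measurable_funX.
by move=> x; rewrite lee_fin sqr_ge0.
Qed.

Lemma Lnorm1_mu_star u : measurable_fun [set: T] u ->
  'N[mu_star D]_1[EFin \o u] = \int[lambda]_x (`|u x| * weight D d x)%:E.
Proof.
move=> mu; rewrite Lnorm1 integral_mu_star //.
by apply: measurableT_comp => //; exact/measurable_EFinP.
Qed.

Lemma form_approximation_energy v phi (J : R) : measurable_fun [set: T] v ->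
  form_approximation D v phi -> dirichlet_form D (phi n) @[n --> \oo] --> J%:E ->
  energy_approximable D v J.
Proof.
move=> mv [tphi Nphi _] qphi e e0.
(* A norm [r] below both 1 and [e] satisfies [r^2 <= r <= e]. *)
have m0 : (0 < Num.min 1 e)%R by rewrite lt_min ltr01.
have /fine_cvgP[fN cN] := Nphi.
have /fine_cvgP[fq cq] := qphi.
have h1 : \forall n \near \oo, (fine 'N[mu_star D]_2%:E[EFin \o (phi n \- v)%R] < Num.min 1 e)%R.
  exact: (cvgr_lt _ cN).
have h2 : \forall n \near \oo, (fine (dirichlet_form D (phi n)) < J + e)%R.
  by apply: (cvgr_lt _ cq); rewrite ltrDl.
near \oo => n.
have fNn : 'N[mu_star D]_2%:E[EFin \o (phi n \- v)%R] \is a fin_num by near: n.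
have fqn : dirichlet_form D (phi n) \is a fin_num by near: n.
have h1n : (fine 'N[mu_star D]_2%:E[EFin \o (phi n \- v)%R] < Num.min 1 e)%R by near: n.
have h2n : (fine (dirichlet_form D (phi n)) < J + e)%R by near: n.
have Cn := (tphi n).1 1%N.
exists (phi n); split => //; first by rewrite -(fineK fqn) lee_fin ltW.
have mphi : measurable_fun [set: T] (phi n \- v)%R.
  by apply: measurable_funB => //; exact: (measurable_class_C1 Cn).1.
apply: (@le_trans _ _ (\int[lambda]_x ((phi n \- v)%R x ^+ 2 * weight D d x)%:E)).
  by rewrite le_eqVlt; apply/orP; left; apply/eqP/eq_integral => x _; rewrite /= -sqrrN opprB.
rewrite -sqr_Lnorm2//.
move: h1n fNn (Lnorm_ge0 (mu_star D) 2%:E (EFin \o (phi n \- v)%R)).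
case: ('N[_]__[_]) => [r||]//; rewrite lt_min [fine _]/= => /andP[r1 re] _ r0.
rewrite -EFin_expe lee_fin expr2; apply: le_trans (ltW re).
by rewrite ler_piMl// ?ltW.
Unshelve. all: by end_near.
Qed.

End norms.

Section part1.
Context {R : realType}.

Lemma powR_third (x : R) : 0 <= x -> (x `^ (1 / 3)) ^+ 3 = x.
Proof.
move=> x0; rewrite -powR_mulrn ?powR_ge0// -powRrM.
by rewrite div1r mulVf ?pnatr_eq0// powRr1.
Qed.

(** With [P = J^(1/3) A^(4/3)], everything is compared after cubing: [S^3 <= e P^3], and
    [J^3 <= J (c0 A^2)^2 = c0^2 P^3]. The bounds [e <= (1 + e)^3] and [c0^2 <= (1 + c0)^3] dispense
    with cube roots of constants. *)
Lemma gagliardo_nirenberg_arith (a b e c0 J A N S : R) : 0 <= a -> 0 <= b -> 0 <= e ->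
  0 <= c0 -> 0 <= J -> 0 <= A -> 0 <= S ->
  N <= a * J + b * S -> S ^+ 3 <= e * J * A ^+ 4 -> J <= c0 * A ^+ 2 ->
  N <= (a + b * (1 + e) + 1) * (1 + c0) * J `^ (1 / 3) * A `^ (4 / 3).
Proof.
move=> a0 b0 e0 c00 J0 A0 S0 hN hS hJ.
have [P [P0 P3 ->]] : exists P, [/\ 0 <= P, P ^+ 3 = J * A ^+ 4 &
    (a + b * (1 + e) + 1) * (1 + c0) * J `^ (1 / 3) * A `^ (4 / 3) =
    (a + b * (1 + e) + 1) * (1 + c0) * P].
  exists (J `^ (1 / 3) * A `^ (4 / 3)); split; last by rewrite mulrA.
    by rewrite mulr_ge0// powR_ge0.
  rewrite exprMn powR_third//; congr (_ * _).
  by rewrite -!powR_mulrn ?powR_ge0// -powRrM -mulrA mulVf ?pnatr_eq0// mulr1.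
have cube_le (x y : R) : 0 <= y -> x ^+ 3 <= y ^+ 3 -> x <= y.
  move=> y0 h; rewrite leNgt; apply/negP => yx; move: h; apply/negP; rewrite -ltNge.
  by rewrite ltrXn2r// -?ltNge// ltW.
have le3 (t : R) : 0 <= t -> t <= (1 + t) ^+ 3 /\ t ^+ 2 <= (1 + t) ^+ 3.
  by move=> t0; have := mulr_ge0 t0 t0; have := mulr_ge0 t0 (mulr_ge0 t0 t0); split; nra.
have P30 : 0 <= P ^+ 3 by rewrite exprn_ge0.
have SP : S <= (1 + e) * P.
  apply: cube_le; first by rewrite mulr_ge0// addr_ge0.
  apply: (le_trans hS); rewrite -mulrA -P3 exprMn ler_wpM2r//.
  exact: (le3 _ e0).1.
have JP : J <= (1 + c0) * P.
  apply: cube_le; first by rewrite mulr_ge0// addr_ge0.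
  apply: (@le_trans _ _ (c0 ^+ 2 * P ^+ 3)); last first.
    by rewrite exprMn ler_wpM2r//; exact: (le3 _ c00).2.
  have -> : c0 ^+ 2 * P ^+ 3 = J * (c0 * A ^+ 2) ^+ 2 by rewrite P3; ring.
  rewrite exprS ler_wpM2l//.
  by rewrite ler_pXn2r// nnegrE// mulr_ge0// exprn_ge0.
apply: (le_trans hN).
have h1 := ler_wpM2l a0 JP; have h2 := ler_wpM2l b0 SP.
have h3 : 0 <= b * (1 + e) * c0 * P by rewrite !mulr_ge0// addr_ge0.
have h4 : 0 <= (1 + c0) * P by rewrite mulr_ge0// addr_ge0.
by lra.
Qed.

Lemma exists_gagliardo_nirenberg d (D : R) : (3 <= d)%N -> 0 < D ->
  exists2 C : R, 0 < C & forall c0, 0 < c0 -> gagliardo_nirenberg_on d D c0 (C * (1 + c0)).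
Proof.
move=> d3 D0.
pose c p : R := 2 * (D + d%:R) `^ (p%:R / 2).
pose M : R := Num.max (D `^ (- (d%:R / 2))) (2 ^+ d) * 2 ^+ d.
pose a : R := M * (8 * c (d - 2)%N).
pose b : R := M * 2.
pose e : R := 4 * (2 ^+ d * (8 * c (d - 2)%N)) * (c d / 2 ^+ d) ^+ 4.
have c_ge0 p : 0 <= c p by rewrite mulr_ge0// powR_ge0.
have P0 : 0 <= 2 ^+ d :> R by rewrite exprn_ge0.
have M0 : 0 <= M by rewrite mulr_ge0// le_max powR_ge0.
have c8 : 0 <= 8 * c (d - 2)%N by apply: mulr_ge0.
have a0 : 0 <= a by apply: mulr_ge0.
have b0 : 0 <= b by rewrite mulr_ge0.
have e0 : 0 <= e.
  apply: mulr_ge0; first by apply: mulr_ge0 => //; apply: mulr_ge0.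
  by apply: exprn_ge0; apply: divr_ge0.
have C0 : 0 < a + b * (1 + e) + 1 by rewrite ltr_wpDl// addr_ge0// mulr_ge0// addr_ge0.
exists (a + b * (1 + e) + 1) => // c0 c00 v vL vD.
have mv : measurable_fun [set: 'rV[measurableTypeR R]_d] v.
  by have := sub_Lfun_mfun vL; rewrite inE.
have vfin : ('N[mu_star D]_2%:E[EFin \o v] < +oo)%E.
  by have := sub_Lfun_finLfun vL; rewrite inE.
have [phi [J [aphi J0 -> phiJ]]] := closed_formP D0 vD.
have vJ := form_approximation_energy mv aphi phiJ.
rewrite sqr_Lnorm2//.
have v2 : (\int[lebesgue_rV d]_x (v x ^+ 2 * weight D d x)%:E < +oo)%E.
  rewrite -sqr_Lnorm2//.
  move: vfin (Lnorm_ge0 (mu_star D) 2%:E (EFin \o v)).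
  by case: ('N[_]__[_])%E => [r||]// _ _; rewrite -EFin_expe ltry.
have N2E : (\int[lebesgue_rV d]_x (v x ^+ 2 * weight D d x)%:E =
    (fine (\int[lebesgue_rV d]_x (v x ^+ 2 * weight D d x)%:E))%:E)%E.
  rewrite fineK// ge0_fin_numE//; apply: integral_ge0 => x _.
  by rewrite lee_fin mulr_ge0 ?sqr_ge0// weight_ge0.
rewrite N2E; have := core_inequality d3 D0 mv v2 vJ.
rewrite -Lnorm1_mu_star//.
move: (fine _) => N2.
move: (sup _) => S [S0 hN hS JS].
have {}hN : N2 <= a * J + b * S.
  by apply: (le_trans hN); rewrite le_eqVlt; apply/orP; left; apply/eqP; rewrite /a /b /M /c; ring.
have {}hS A : 0 <= A -> ('N[mu_star D]_1[EFin \o v] <= A%:E)%E -> S ^+ 3 <= e * J * A ^+ 4.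
  move=> A0 /(hS A A0) /le_trans; apply; rewrite /e le_eqVlt; apply/orP; left; apply/eqP.
  rewrite /c !exprMn; ring.
have JN : J = 0 -> N2 <= 0.
  by move=> Jz; apply: (le_trans hN); rewrite (JS Jz) Jz !mulr0 addr0.
have K0 : 0 < (a + b * (1 + e) + 1) * (1 + c0) by rewrite mulr_gt0// addr_gt0.
have JN' : J = 0 -> forall N1, (0 <= N1 -> N2%:E <=
    ((a + b * (1 + e) + 1) * (1 + c0))%:E * J%:E `^ (1 / 3)%R * N1 `^ (4 / 3)%R)%E.
  move=> Jz N1 N10; apply: (@le_trans _ _ 0%E); first by rewrite lee_fin JN.
  by rewrite !mule_ge0 ?poweR_ge0// lee_fin ltW.
(* At zero energy the left-hand side vanishes, so the claim holds for every L^1 norm, infinite ones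
   included. *)
have [Jz _|Jn0] := eqVneq J 0; first by apply: JN' => //; exact: Lnorm_ge0.
have Jgt : 0 < J by rewrite lt_neqAle eq_sym Jn0.
move: hS (Lnorm_ge0 (mu_star D) 1 (EFin \o v)).
(* An infinite L^1 norm makes the right-hand side infinite, because [J] is now positive. *)
case: ('N[_]__[_])%E => [A||]// hS A0 ratio; last first.
  by rewrite poweRyr// poweR_EFin -EFinM gt0_muley ?leey// lte_fin mulr_gt0// powR_gt0.
have {}A0 : 0 <= A by rewrite -lee_fin.
(* If the L^1 norm is zero, the ratio is [J * +oo = +oo], which contradicts the bound by [c0]. *)
move: ratio; rewrite -EFin_expe inver; case: ifPn => [/eqP A2|A2].
  by rewrite gt0_muley ?lte_fin// leye_eq.
rewrite -EFinM lee_fin ler_pdivrMr; last by rewrite lt_neqAle eq_sym A2 sqr_ge0.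
move=> JA; rewrite !poweR_EFin -!EFinM lee_fin.
apply: (gagliardo_nirenberg_arith a0 b0 e0 (ltW c00) J0 A0 S0 hN _ JA).
exact: hS.
Qed.

End part1.

(** * Composition, and the divergence theorem *)

Section composition.
Context {R : realType} {d : nat}.
Implicit Types g : 'rV[R]_d -> R.

(** Only derivability along one axis is available, so the one-variable chain rule is applied on the
    line [t -> t *: v + x]. *)
Lemma partial_comp g (F : R -> R) i x (dF : R) : derivable g x (delta_mx ord0 i) ->
  is_derive (g x) 1 F dF ->
  derivable (F \o g) x (delta_mx ord0 i) /\
  partial_derivative i (F \o g) x = dF * partial_derivative i g x.
Proof.
move=> dg DF; set v := delta_mx ord0 i in dg *.
have /derivable1P dg1 := dg.
pose h := fun t : R => g (t *: v + x).
have hE : 'D_1 h 0 = 'D_v g x.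
  rewrite /derive; congr (lim _).
  rewrite (_ : (fun t => _) = (fun t => t^-1 *: (g (t *: v + x) - g x)))//.
  by apply/funext => t; rewrite /h /= scale0r add0r addr0 /GRing.scale/= mulr1.
have h0 : h 0 = g x by rewrite /h scale0r add0r.
have Dh : is_derive (0 : R) 1 h ('D_v g x) by rewrite -hE; exact/derivableP.
have DF' : is_derive (h 0) 1 F dF by rewrite h0.
have := @is_derive1_comp R F h 0 dF ('D_v g x) DF' Dh => -[dFh eFh].
split; first exact/derivable1P.
rewrite /partial_derivative -/v -eFh /derive; congr (lim _).
rewrite [in RHS](_ : (fun t => _) = (fun t => t^-1 *: ((F \o g) (t *: v + x) - (F \o g) x)))//.
by apply/funext => t; rewrite /h /= scale0r add0r addr0 /GRing.scale/= mulr1.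
Qed.

(** The derivative of [F] is required only at values of [g]. This admits real powers, differentiated
    on positive reals. *)
Lemma class_C_comp k g (F dF : R -> R) : class_C k.+1 g ->
  (forall x, is_derive (g x) 1 F (dF (g x))) ->
  class_C k (dF \o g) -> class_C k.+1 (F \o g).
Proof.
move=> Cg DF CdF; case: (Cg) => cg dg; split.
  move=> x; apply: continuous_comp; first exact: cg.
  apply: differentiable_continuous; apply/derivable1_diffP.
  by case: (DF x).
move=> i; split=> [x|]; first by have [] := partial_comp ((dg i).1 x) (DF x).
rewrite (_ : partial_derivative i _ = (dF \o g) \* partial_derivative i g).
  by apply: class_CM => //; exact: (dg i).2.
by apply/funext => x; have [] := partial_comp ((dg i).1 x) (DF x).
Qed.

Lemma partial_coord (i j : 'I_d) x : derivable (fun x : 'rV[R]_d => x ord0 j) x (delta_mx ord0 i) /\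
  partial_derivative i (fun x : 'rV[R]_d => x ord0 j) x = (j == i)%:R.
Proof.
have H : is_derive x (delta_mx ord0 i) (fun x : 'rV[R]_d => x ord0 j) ((j == i)%:R : R).
  apply: DeriveDef; first exact/diff_derivable/differentiable_coord.
  rewrite /derive (_ : (fun h : R => _) = (fun h => h^-1 * h * (j == i)%:R)).
    apply: cvg_lim => //; apply: cvg_near_cst.
    by exists 1 => //= h _ h0; rewrite mulVf// mul1r.
  by apply/funext => h; rewrite /= !mxE /= addrK /GRing.scale/= mulrA.
by case: H.
Qed.

Lemma class_C_coord k (j : 'I_d) : class_C k (fun x : 'rV[R]_d => x ord0 j).
Proof.
case: k => [|k]; first exact: continuous_coord.
split; first exact: continuous_coord.
move=> i; split; first by move=> x; exact: (partial_coord i j x).1.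
rewrite (_ : partial_derivative i _ = fun=> (j == i)%:R); first exact: class_C_cst.
by apply/funext => x; exact: (partial_coord i j x).2.
Qed.

Lemma class_C_sum k (I : Type) (r : seq I) (h : I -> 'rV[R]_d -> R) :
  (forall i, class_C k (h i)) -> class_C k (fun x => \sum_(i <- r) h i x).
Proof.
move=> ch; elim: r => [|i r IH].
  rewrite (_ : (fun _ => _) = fun=> 0); first exact: class_C_cst.
  by apply/funext => x; rewrite big_nil.
rewrite (_ : (fun _ => _) = h i \+ (fun x => \sum_(j <- r) h j x)); first exact: class_CD.
by apply/funext => x; rewrite big_cons.
Qed.

Lemma class_C_sqnorm k : class_C k (@sqnorm R d).
Proof.
apply: class_C_sum => i.
rewrite (_ : (fun _ => _) = (fun x : 'rV[R]_d => x ord0 i) \* (fun x => x ord0 i)).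
  by apply: class_CM; exact: class_C_coord.
by apply/funext => x; rewrite expr2.
Qed.

Lemma class_C1_shift_powR (D p : R) : 0 < D -> class_C 1 (fun x : 'rV[R]_d => (D + sqnorm x) `^ p).
Proof.
move=> D0.
pose g (x : 'rV[R]_d) := D + sqnorm x.
change (class_C 1 ((fun t : R => t `^ p) \o g)).
apply: (@class_C_comp 0 g _ (fun t => p * t `^ (p - 1))).
- exact: (@class_CD _ _ 1 _ _ (@class_C_cst _ _ 1 D) (class_C_sqnorm 1)).
- by move=> x; apply: is_derive1_powR; rewrite ltr_pwDl// sqnorm_ge0.
- exact: (@class_CM _ _ 0 _ _ (@class_C_cst _ _ 0 p) (continuous_shift_powR D0 (p:=p-1))).
Qed.

End composition.

Section divergence.
Context {R : realType}.
Notation T n := 'rV[measurableTypeR R]_n.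

Lemma integral_derive_segment (F : R -> R) (K M : R) : (0 < K)%R ->
  (forall t, derivable F t 1) -> continuous (derive1 F) -> F K = 0%R -> F (- K)%R = 0%R ->
  (\int[lebesgue_measure]_(t in `[(- K)%R, K]) (derive1 F t + M)%:E = (M * (2 * K))%:E)%E.
Proof.
move=> K0 dF cF FK FNK.
pose G t := (F t + M * t)%R.
have dG (t : R) : is_derive t (1 : R)%R G (derive1 F t + M)%R.
  have /derivableP dFt := dF t.
  rewrite (_ : G = F + M *: (id : R -> R))%R; last exact/funext.
  have := is_deriveD dFt (is_deriveZ M (is_derive_id t (1 : R))).
  by rewrite derive1E /GRing.scale/= mulr1.
have cG : continuous (fun t => derive1 F t + M)%R.
  by move=> t; apply: cvgD; [exact: cF|exact: cvg_cst].
rewrite (@continuous_FTC2 R _ G).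
- by rewrite /G FK FNK -EFinB; congr EFin; ring.
- by rewrite gtrN.
- exact: continuous_subspaceT.
- split.
  + by move=> t _; case: (dG t).
  + apply: cvg_at_right_filter; apply: differentiable_continuous.
    by apply/derivable1_diffP; case: (dG (- K)%R).
  + apply: cvg_at_left_filter; apply: differentiable_continuous.
    by apply/derivable1_diffP; case: (dG K).
- by move=> t _; rewrite derive1E; case: (dG t).
Qed.

Local Open Scope ereal_scope.

Lemma integral_cube_cst n (K M : R) : (0 <= K)%R ->
  \int[lebesgue_rV n]_(x in cube n K) M%:E = (M * (2 * K) ^+ n)%:E.
Proof.
move=> K0; rewrite [RHS]EFinM -lebesgue_cube//.
exact: (@integral_cst _ _ R (lebesgue_rV n) (cube n K) (measurable_cube K)).
Qed.

(** The shift by [M] makes the integrand non-negative, as Tonelli's theorem requires. The cube is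
    strictly larger than the one containing the support, so that [F] vanishes on its faces. *)
Lemma integral_cube_partial n (F : 'rV[R]_n -> R) i (L K M : R) : (0 <= L)%R -> (L < K)%R ->
  class_C 1 F -> vanishes_outside L F ->
  (forall x, 0 <= partial_derivative i F x + M)%R ->
  \int[lebesgue_rV n]_(x in cube n K) (partial_derivative i F x + M)%:E = (M * (2 * K) ^+ n)%:E.
Proof.
move=> L0 LK; have K0 : (0 < K)%R by exact: le_lt_trans LK.
elim: n F i => [F []//|n IH] F i CF FL dF.
have cf : continuous (fun x => partial_derivative i F x + M)%R.
  exact: (@class_CD R _ 0 _ _ (CF.2 i).2 (@class_C_cst R _ 0 M)).
have mf : measurable_fun [set: T n.+1] (fun x => (partial_derivative i F x + M)%:E).
  by apply/measurable_EFinP; exact: continuous_measurable_rV.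
have mfc : measurable_fun setT (fun p => (partial_derivative i F (@cons_rV R n p) + M)%:E).
  exact: (measurableT_comp mf (@measurable_cons_rV R n)).
rewrite integral_cube_cons//.
have K20 : (0 <= 2 * K)%R by rewrite mulr_ge0// ltW.
have vc a (x : 'rV[R]_n) : (~ cube n L x \/ (L < `|a|)%R) -> F (cons_rV (a, x)) = 0%R.
  move=> h; apply: FL => hc.
  have : (`[(- L)%R, L] `*` cube n L) (a, x) by rewrite -cons_cube.
  rewrite /= in_itv/= -ler_norml => -[ha hx].
  by case: h => //; rewrite ltNge ha.
(* For a later axis the induction hypothesis is used in each slice; for the first one the integrals
   are exchanged, and the inner one is computed by [integral_derive_segment]. *)
have [j ij|i0] := unliftP ord0 i; subst i.
  under eq_integral => a _.
    under eq_integral => x _ do rewrite -partial_cons_tail.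
    rewrite IH; [|exact: class_C1_cons_tail|by move=> x xL; apply: vc; left|
      by move=> x; rewrite partial_cons_tail].
    over.
  have -> : (M * (2 * K) ^+ n.+1)%:E = (M * (2 * K) ^+ n)%:E * lebesgue_measure `[(- K)%R, K]%classic.
    rewrite lebesgue_segment ?ltW// -EFinM; congr EFin.
    by rewrite exprS; move: (2 * K)%R => u; ring.
  by apply: integral_cst; exact: measurable_itv.
rewrite (@tonelli_on _ _ _ _ R lebesgue_measure (lebesgue_rV n) _ _ (fun p => (partial_derivative ord0 F (cons_rV p) + M)%:E))//; last first.
  by move=> p; rewrite lee_fin.
under eq_integral => x _.
  under eq_integral => a _ do rewrite -partial_cons_head.
  have [h1 h2] := class_C1_cons_head x CF.
  rewrite integral_derive_segment//; last 2 first.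
    by apply: vc; right; rewrite ger0_norm// ltW.
    by apply: vc; right; rewrite normrN ger0_norm// ltW.
  over.
rewrite integral_cube_cst ?ltW//; congr EFin.
by rewrite exprS; move: (2 * K)%R => u; ring.
Qed.

Lemma integral_partial_eq0 n (F : 'rV[R]_n -> R) i (L : R) : (0 <= L)%R ->
  class_C 1 F -> vanishes_outside L F ->
  \int[lebesgue_rV n]_x (partial_derivative i F x)%:E = 0.
Proof.
move=> L0 CF FL; have vL := vanishes_outside_partial i FL.
have cP : continuous (partial_derivative i F) := (CF.2 i).2.
have iP := integrable_bounded_support L0 cP vL.
have [M M0 hM] := continuous_bounded_support cP vL.
have LK : (L < L + 1)%R by rewrite ltrDl.
have K0 : (0 <= L + 1)%R by rewrite addr_ge0.
have := integral_cube_partial L0 LK CF FL (i := i) (M := M)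
  (fun x => ltac:(by have := hM x; rewrite ler_norml => /andP[]; lra)).
have iPK : (lebesgue_rV n).-integrable (cube n (L + 1)) (EFin \o partial_derivative i F).
  exact: integrableS iP.
under eq_integral do rewrite EFinD.
rewrite (@integralD _ _ R (lebesgue_rV n) (cube n (L+1)) _ (EFin \o partial_derivative i F) (fun=> M%:E))//; last first.
  apply/integrableP; split; first exact: measurable_cst.
  rewrite (_ : (fun x => _) = (fun=> `|M|%:E))//.
  by rewrite integral_cube_cst// ltry.
rewrite integral_cube_cst// => h.
have -> : \int[lebesgue_rV n]_x (partial_derivative i F x)%:E =
    \int[lebesgue_rV n]_(x in cube n (L + 1)) (EFin \o partial_derivative i F) x.
  rewrite [RHS]integral_mkcond; apply: eq_integral => x _; rewrite patchE.
  case: ifPn => //; rewrite notin_setE => xK; rewrite vL// => xL; apply: xK.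
  by apply: subset_cube xL; exact: ltW.
have fI := integrable_fin_num (measurable_cube _) iPK.
move: h fI; case: (\int[_]_(_ in _) _) => [r||]//; rewrite -EFinD => -[h] _.
by congr EFin; apply: (addIr (M * (2 * (L + 1)) ^+ n)%R); rewrite add0r.
Qed.

End divergence.

(** * Closability of the form *)

Section closability.
Context {R : realType} {d : nat}.
Notation T := 'rV[measurableTypeR R]_d.
Notation lambda := (lebesgue_rV d).
Variable D : R.
Hypothesis D0 : 0 < D.
Implicit Types a b f g : 'rV[R]_d -> R.

Let rho (x : 'rV[R]_d) : R := (D + sqnorm x) `^ (- ((d%:R - 2) / 2)).

(** On this class all functions are integrable, so real-valued integrals are linear and monotone
    without further conditions. *)
Definition Cc f := continuous f /\ exists2 L, 0 <= L & vanishes_outside L f.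

Lemma Cc_integrable f : Cc f -> lambda.-integrable [set: T] (EFin \o f).
Proof. by move=> [cf [L L0 fL]]; exact: integrable_bounded_support L0 cf fL. Qed.

Lemma CcMl f g : continuous f -> Cc g -> Cc (f \* g).
Proof.
move=> cf [cg [L L0 gL]]; split; first exact: (@class_CM _ _ 0).
by exists L => // x xL /=; rewrite gL// mulr0.
Qed.

Lemma CcMr f g : Cc f -> continuous g -> Cc (f \* g).
Proof.
move=> cf cg; rewrite (_ : f \* g = g \* f); first exact: CcMl.
by apply/funext => x; exact: mulrC.
Qed.

Lemma CcD f g : Cc f -> Cc g -> Cc (f \+ g).
Proof.
move=> [cf [L L0 fL]] [cg [M M0 gM]]; split; first exact: (@class_CD _ _ 0).
exists (L + M); first exact: addr_ge0.
move=> x xLM /=; rewrite fL ?gM ?addr0// => h; apply: xLM; apply: subset_cube h.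
  by rewrite lerDr.
by rewrite lerDl.
Qed.

Lemma Cc_sum (h : 'I_d -> 'rV[R]_d -> R) : (forall i, Cc (h i)) ->
  Cc (fun x => \sum_(i < d) h i x).
Proof.
move=> ch; elim: (index_enum _) => [|i r IH].
  rewrite (_ : (fun _ => _) = fun=> 0).
    by split; [exact: cst_continuous|exists 0].
  by apply/funext => x; rewrite big_nil.
rewrite (_ : (fun _ => _) = h i \+ (fun x => \sum_(j <- r) h j x)); first exact: CcD.
by apply/funext => x; rewrite big_cons.
Qed.

Lemma Cc_partial f i : class_C 1 f -> Cc f -> Cc (partial_derivative i f).
Proof.
move=> Cf [cf [L L0 fL]]; split; first exact: (Cf.2 i).2.
by exists L => //; exact: vanishes_outside_partial.
Qed.

Lemma Rintegral_CcD f g : Cc f -> Cc g ->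
  \int[lambda]_x (f x + g x) = \int[lambda]_x f x + \int[lambda]_x g x.
Proof. by move=> cf cg; apply: RintegralD => //; exact: Cc_integrable. Qed.

Lemma Rintegral_CcZ f (r : R) : Cc f -> \int[lambda]_x (r * f x) = r * \int[lambda]_x f x.
Proof. by move=> cf; apply: RintegralZl => //; exact: Cc_integrable. Qed.

Lemma le_Rintegral_Cc f g : Cc f -> Cc g -> (forall x, f x <= g x) ->
  \int[lambda]_x f x <= \int[lambda]_x g x.
Proof. by move=> cf cg fg; apply: le_Rintegral => //; exact: Cc_integrable. Qed.

Lemma Rintegral_Cc_sum (h : 'I_d -> 'rV[R]_d -> R) : (forall i, Cc (h i)) ->
  \int[lambda]_x (\sum_(i < d) h i x) = \sum_(i < d) \int[lambda]_x h i x.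
Proof.
move=> ch; rewrite /Rintegral; under eq_integral do rewrite -sumEFin.
rewrite (@integral_sum _ _ R lambda setT measurableT _ (fun i => EFin \o h i)).
  rewrite (eq_bigr (fun i => (\int[lambda]_x h i x)%:E)) ?sumEFin// => i _.
  by rewrite /Rintegral fineK//; apply: integrable_fin_num => //; exact: Cc_integrable.
by move=> i; exact: Cc_integrable.
Qed.

Lemma test_function_Cc f : test_function f -> Cc f.
Proof. by move=> /test_functionP[Cf h]; split => //; exact: (Cf 0%N). Qed.

(* [q(a) <= q(a - b) + 2 q(a, b)], and [q(a, b)] is integrated by parts. *)
Lemma closability_step a : test_function a -> exists2 G : R, 0 <= G &
  forall b (eta : R), test_function b -> 0 < eta ->
    fine (dirichlet_form D a) <= fine (dirichlet_form D (a \- b)) +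
      (eta^-1 * \int[lambda]_x (b x ^+ 2 * weight D d x) + eta * G).
Proof.
move=> ta; have Ca := ta.1; have cca := test_function_Cc ta.
pose w' (x : 'rV[R]_d) : R := (D + sqnorm x) `^ (d%:R / 2).
have Crho : class_C 1 rho by exact: class_C1_shift_powR.
(* [A] is the flux of [a] and [g] its divergence. Both depend on [a] alone, hence so does the bound
   [G]. *)
pose A i := rho \* partial_derivative i a.
have CA i : class_C 1 (A i) by apply: class_CM => //; exact: ((Ca 2%N).2 i).2.
have ccA i : Cc (A i) by apply: CcMl; [exact: Crho.1|exact: Cc_partial (Ca 1%N) cca].
pose g (x : 'rV[R]_d) : R := \sum_(i < d) partial_derivative i (A i) x.
have ccg : Cc g by apply: Cc_sum => i; exact: Cc_partial.
have cw' : continuous w' by exact: continuous_shift_powR.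
have ccG : Cc (fun x => g x * g x * w' x).
  exact: (CcMr (CcMl ccg.1 ccg) cw').
have w'0 x : 0 <= w' x by exact: powR_ge0.
exists (\int[lambda]_x (g x * g x * w' x)).
  by apply: Rintegral_ge0 => x _; rewrite mulr_ge0// -expr2 sqr_ge0.
move=> b eta tb eta0; have Cb := tb.1; have ccb := test_function_Cc tb.
have tab := test_functionB ta tb.
have ccq f : test_function f -> Cc (fun x => sqgrad f x * rho x).
  move=> tf; apply: CcMr; last exact: Crho.1.
  split; first exact: continuous_sqgrad (tf.1 1%N).
  have [_ [L L0 fL]] := test_function_Cc tf.
  by exists L => //; exact: vanishes_outside_sqgrad.
(* The divergence of [b A] has integral zero; expanded, it is [b g] plus the density of the cross
   term [q(a, b)]. *)
pose H i := b \* A i.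
have CH i : class_C 1 (H i) by apply: class_CM => //; exact: (Cb 1%N).
have ccH i : Cc (H i) by apply: CcMr => //; exact: (ccA i).1.
have ccdH i : Cc (partial_derivative i (H i)) by exact: Cc_partial.
have intdH : \int[lambda]_x (\sum_(i < d) partial_derivative i (H i) x) = 0.
  rewrite Rintegral_Cc_sum// big1// => i _.
  have [_ [L L0 HL]] := ccH i.
  by rewrite /Rintegral (integral_partial_eq0 i L0 (CH i) HL).
have ccdiv : Cc (fun x => \sum_(i < d) partial_derivative i (H i) x) by exact: Cc_sum.
have ccb2 : Cc (fun x => b x ^+ 2 * weight D d x).
  rewrite (_ : (fun _ => _) = (b \* b) \* weight D d); last first.
    by apply/funext => x; rewrite /= expr2.
  by apply: CcMr; [exact: CcMl ccb.1 ccb|exact: continuous_shift_powR].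
have ccZ r f : Cc f -> Cc (fun x => r * f x).
  by move=> cf; apply: (@CcMl (fun=> r)) => //; exact: cst_continuous.
suff h : \int[lambda]_x (sqgrad a x * rho x) <= \int[lambda]_x (sqgrad (a \- b) x * rho x) +
  (eta^-1 * \int[lambda]_x (b x ^+ 2 * weight D d x) + eta * \int[lambda]_x (g x * g x * w' x)).
  exact: h.
rewrite -!Rintegral_CcZ// -!Rintegral_CcD//; [|exact: ccq|by apply: CcD; exact: ccZ|exact: ccZ|exact: ccZ].
(* Twice this null integral is added, so that the inequality can be checked pointwise. *)
have -> : \int[lambda]_x (sqgrad (a \- b) x * rho x +
      (eta^-1 * (b x ^+ 2 * weight D d x) + eta * (g x * g x * w' x))) =
    \int[lambda]_x (sqgrad (a \- b) x * rho x +
      (eta^-1 * (b x ^+ 2 * weight D d x) + eta * (g x * g x * w' x)) +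
      2 * \sum_(i < d) partial_derivative i (H i) x).
  rewrite [RHS]Rintegral_CcD; [|by do 2 ?apply: CcD; do ?exact: ccZ; exact: ccq|exact: ccZ].
  by rewrite Rintegral_CcZ// intdH mulr0 addr0.
apply: le_Rintegral_Cc; first exact: ccq.
  by apply: CcD; [do 2 ?apply: CcD; do ?exact: ccZ; exact: ccq|exact: ccZ].
move=> x.
have wE : weight D d x * w' x = 1.
  rewrite /weight /w' powRN mulVf// gt_eqF// powR_gt0//.
  by rewrite ltr_pwDl// sqnorm_ge0.
(* Young's inequality, by completing a square. The factor [w'] in [G] is the inverse of the density
   of [mu_star] and compensates the weight on [b^2]. *)
have hb : - (2 * b x * g x) <= eta^-1 * (b x ^+ 2 * weight D d x) + eta * (g x * g x * w' x).
  have -> : eta^-1 * (b x ^+ 2 * weight D d x) + eta * (g x * g x * w' x) =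
      eta^-1 * weight D d x * (b x + eta * w' x * g x) ^+ 2 - 2 * b x * g x.
    have w0 : w' x != 0 by rewrite gt_eqF// powR_gt0// ltr_pwDl// sqnorm_ge0.
    have -> : weight D d x = (w' x)^-1 by rewrite -[LHS](mulfK w0) wE mul1r.
    by move: (w' x) w0 => z z0; field; rewrite z0 gt_eqF.
  rewrite lerBrDl subrr; apply: mulr_ge0; last exact: sqr_ge0.
  by apply: mulr_ge0; [rewrite invr_ge0 ltW|exact: powR_ge0].
have divE : \sum_(i < d) partial_derivative i (H i) x =
    b x * g x + \sum_(i < d) rho x * (partial_derivative i a x * partial_derivative i b x).
  rewrite /g mulr_sumr -big_split/=; apply: eq_bigr => i _.
  rewrite /H partialM; [|exact: ((Cb 1%N).2 i).1|exact: ((CA i).2 i).1].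
  by rewrite /= /A/= mulrA.
rewrite divE.
have hq : sqgrad a x * rho x <= sqgrad (a \- b) x * rho x +
    2 * \sum_(i < d) rho x * (partial_derivative i a x * partial_derivative i b x).
  rewrite /sqgrad !mulr_suml mulr_sumr -big_split/=; apply: ler_sum => i _.
  rewrite partialB; [|exact: ((Ca 1%N).2 i).1|exact: ((Cb 1%N).2 i).1].
  rewrite /=; move: (partial_derivative i a x) (partial_derivative i b x) => u v.
  have r0 : 0 <= rho x by exact: powR_ge0.
  have := mulr_ge0 r0 (sqr_ge0 v); move: (rho x) => r; lra.
by move: hb hq; lra.
Qed.

(** For an approximation [phi] of [f] realising the closed form, [closability_step] with
    [a = phi m - f] and [b = phi n - f] shows that the energy of [a] is small. The factor 2 comes
    from [dirichlet_form_perturb] at [theta = 1]. *)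
Lemma closed_form_test_le f : test_function f -> form_domain D f ->
  (closed_form D f <= 2%:E * dirichlet_form D f)%E.
Proof.
move=> tf /(closed_formP D0)[phi [J [[tphi Nphi cphi] J0 -> phiJ]]].
have tb n : test_function (phi n \- f) by exact: test_functionB.
have qfin h : test_function h -> dirichlet_form D h = (fine (dirichlet_form D h))%:E.
  by move=> th; rewrite fineK// dirichlet_form_fin.
rewrite qfin// -EFinM lee_fin; apply/ler_addgt0Pr => e e0.
have e60 : 0 < e / 6 by rewrite divr_gt0.
have [N hN] := cphi _ e60.
(* The order of choices matters: [m] fixes [G], then [eta] makes [eta * G] small, and [n] is taken
   last, large enough to beat [1 / eta]. Each of the three terms is at most [e / 6]. *)
have key m : (N <= m)%N -> fine (dirichlet_form D (phi m \- f)) <= e / 2.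
  move=> Nm; have [G G0 hG] := closability_step (tb m).
  have [eta [eta0 etaG]] : exists eta, 0 < eta /\ eta * G <= e / 6.
    exists (e / 6 / (G + 1)); split; first by rewrite divr_gt0// ltr_wpDl.
    by rewrite mulrAC -mulrA ger_pMr// ler_pdivrMr ?ltr_wpDl// mul1r lerDl.
  have /fine_cvgP[fN cN] := Nphi.
  have m0 : 0 < Num.min 1 (e / 6 * eta) by rewrite lt_min ltr01 mulr_gt0.
  have [n [Nn fNn nmin]] : exists n, [/\ (N <= n)%N,
      ('N[mu_star D]_2%:E[EFin \o (phi n \- f)%R] \is a fin_num)%E &
      fine ('N[mu_star D]_2%:E[EFin \o (phi n \- f)%R])%E < Num.min 1 (e / 6 * eta)].
    have h1 : \forall n \near \oo, fine ('N[mu_star D]_2%:E[EFin \o (phi n \- f)%R])%E < Num.min 1 (e / 6 * eta).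
      exact: (cvgr_lt _ cN).
    near \oo => n; exists n; split; [by near: n; exists N|by near: n|by near: n].
  apply: le_trans (hG (phi n \- f) eta (tb n) eta0) _.
  have -> : (phi m \- f) \- (phi n \- f) = phi m \- phi n.
    by apply/funext => x /=; ring.
  have -> : e / 2 = e / 6 + (e / 6 + e / 6) by field.
  apply: lerD; first by rewrite -lee_fin -qfin; [exact: hN|exact: test_functionB].
  apply: lerD => //; rewrite ler_pdivrMl// mulrC /Rintegral -sqr_Lnorm2; last first.
    by apply: continuous_measurable_rV; exact: ((tb n).1 0%N).
  move: fNn nmin (Lnorm_ge0 (mu_star D) 2%:E (EFin \o (phi n \- f)%R)).
  case: ('N[_]__[_])%E => [r||]//; rewrite lt_min [fine _]/= => _ /andP[r1 re] r0.
  rewrite -EFin_expe [fine _]/= expr2; apply: le_trans (ltW re).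
  by rewrite ler_piMl// ?ltW.
have ev : \forall n \near \oo, (dirichlet_form D (phi n) <= (2 * fine (dirichlet_form D f) + e)%:E)%E.
  exists N => // n /= Nn.
  apply: le_trans (dirichlet_form_perturb D ((tphi n).1 1%N) (tf.1 1%N) ltr01) _.
  rewrite [leRHS]EFinD; apply: leeD; first by rewrite [leRHS]EFinM -qfin.
  have -> : e = (1 + 1^-1) * (e / 2) by field.
  rewrite [leRHS]EFinM; apply: lee_wpmul2l; first by rewrite lee_fin invr1 addr_ge0.
  by rewrite qfin// lee_fin; exact: key.
rewrite -lee_fin -(cvg_lim (@ereal_hausdorff R) phiJ).
by apply: lime_le => //; apply/cvg_ex; exists J%:E.
Unshelve. all: by end_near.
Qed.

End closability.

(** * A smooth function with compact support *)

Section flat_function.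
Context {R : realType}.
Implicit Types (P : {poly R}) (t : R).

(* A general [P], rather than [P = 1], makes the family stable under derivation. *)
Definition flat P t : R := if 0 < t then P.[t^-1] * expR (- t^-1) else 0.

(** The derivative of [P(1/t) exp(-1/t)] is [t^(-2) (P - P')(1/t) exp(-1/t)]. *)
Definition flat_step P : {poly R} := 'X^2 * (P - deriv P).

(** Each [y^(i+2)] is at most [(i+2)! exp y]. The extra [y^2], at [y = 1/t], yields the quadratic
    bound on [flat P] that settles its derivative at 0. *)
Lemma poly_le_expR P : exists2 C, 0 <= C & forall y, 0 <= y -> y ^+ 2 * `|P.[y]| <= C * expR y.
Proof.
exists (\sum_(i < size P) `|P`_i| * i.+2`!%:R).
  by apply: sumr_ge0 => i _; rewrite mulr_ge0.
move=> y y0; rewrite horner_coef mulr_suml.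
apply: (@le_trans _ _ (\sum_(i < size P) y ^+ 2 * `|P`_i * y ^+ i|)).
  by rewrite -mulr_sumr ler_wpM2l ?exprn_ge0// ler_norm_sum.
apply: ler_sum => i _; rewrite normrM (ger0_norm (exprn_ge0 _ y0)) mulrCA -exprD -mulrA.
apply: ler_wpM2l => //; rewrite add2n -ler_pdivrMl ?ltr0n ?fact_gt0//.
by apply: le_trans (expR_ge1Dxn i.+1 y0); rewrite mulrC lerDr.
Qed.

Lemma flat_le_sqr P : exists2 C, 0 <= C & forall t, `|flat P t| <= C * t ^+ 2.
Proof.
have [C C0 hC] := poly_le_expR P; exists C => // t; rewrite /flat.
case: ltP => t0; last by rewrite normr0 mulr_ge0 ?sqr_ge0.
have y0 : 0 <= t^-1 by rewrite invr_ge0 ltW.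
rewrite normrM (ger0_norm (expR_ge0 _)) expRN ler_pdivrMr ?expR_gt0//.
have := hC _ y0; rewrite -(ler_pM2l (exprn_gt0 2 t0)) mulrA -exprMn divff ?gt_eqF// expr1n mul1r.
by move=> /le_trans; apply; rewrite mulrCA mulrA.
Qed.

Lemma is_derive_flat P t : is_derive t (1 : R) (flat P) (flat (flat_step P) t).
Proof.
have [t0|t0|t0] := ltgtP t 0.
- rewrite [X in is_derive _ _ _ X]/flat ltNge (ltW t0)/=.
  have d0 : is_derive t (1 : R) (cst 0 : R -> R) 0 by exact: is_derive_cst.
  apply: near_eq_is_derive d0; near=> s; rewrite /flat/= ltNge ifN// negbK ltW//.
  by near: s; exact: lt_nbhsl.
- have tn0 : t != 0 by rewrite gt_eqF.
  pose K := (horner P * (expR \o -%R))%R.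
  have dK : is_derive (t^-1) (1 : R) K ((deriv P - P).[t^-1] * expR (- t^-1)).
    have d1 := is_derive_poly P (t^-1).
    have d2 : is_derive (t^-1) (1 : R) (expR \o -%R) (expR (- t^-1) * -1).
      by apply: is_derive1_comp; exact: is_deriveNid.
    have [dK1 dK2] := is_deriveM d1 d2; apply: DeriveDef => //.
    by rewrite dK2 /GRing.scale/= hornerD hornerN; ring.
  have dV : is_derive t (1 : R) (fun s : R => s^-1) (- t ^- 2).
    apply: DeriveDef; first exact: derivableV.
    by rewrite deriveV// derive_id /GRing.scale/= mulr1.
  have [dF1 dF2] := is_derive1_comp dK dV.
  have dF : is_derive t (1 : R) (K \o (fun s : R => s^-1)) (flat (flat_step P) t).
    apply: DeriveDef => //; rewrite dF2 /flat t0 /flat_step.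
    rewrite !(hornerM, hornerD, hornerN, hornerX) -exprVn.
    by move: (t^-1) (deriv P).[_] P.[_] (expR _) => *; ring.
  apply: near_eq_is_derive dF; near=> s; rewrite /flat/= ifT//.
  by near: s; exact: lt_nbhsr.
(* At 0 the difference quotient is at most [C |h|] in absolute value. *)
- subst t; rewrite [X in is_derive _ _ _ X]/flat ltxx.
  have [C C0 hC] := flat_le_sqr P.
  have H : h^-1 *: ((flat P \o shift 0) (h *: (1 : R)) - flat P 0) @[h --> 0^'] --> (0 : R).
    apply/cvgrPdist_le => e e0; near=> h.
    have h0 : h != 0 by near: h; exact: nbhs_dnbhs_neq.
    rewrite /= addr0 /GRing.scale/= mulr1 {2}/flat ltxx subr0 sub0r normrN normrM normfV.
    rewrite ler_pdivrMl ?normr_gt0//; apply: (le_trans (hC h)).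
    have -> : h ^+ 2 = `|h| * `|h| by rewrite -expr2 real_normK ?num_real.
    rewrite mulrCA ler_wpM2l//.
    apply: (@le_trans _ _ ((C + 1) * `|h|)); first by rewrite ler_wpM2r// lerDl.
    rewrite -ler_pdivlMl ?ltr_wpDl//.
    near: h; apply: dnbhs0_le; by rewrite mulr_gt0// invr_gt0 ltr_wpDl.
  by apply: DeriveDef; [apply/cvg_ex; exists 0|exact: cvg_lim H].
Unshelve. all: by end_near.
Qed.

Lemma class_C_flat d P k (g : 'rV[R]_d -> R) : (forall j, class_C j g) -> class_C k (flat P \o g).
Proof.
move=> Cg; elim: k P => [|k IH] P.
  move=> x; apply: continuous_comp; first exact: (Cg 0%N).
  apply: differentiable_continuous; apply/derivable1_diffP.
  by case: (is_derive_flat P (g x)).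
by apply: (class_C_comp (Cg k.+1) (dF := flat (flat_step P))); [move=> x; exact: is_derive_flat|exact: IH].
Qed.

End flat_function.

(** * Bump functions at scale [eps] *)

Section bump.
Context {R : realType} {d : nat}.
Notation T := 'rV[measurableTypeR R]_d.
Notation lambda := (lebesgue_rV d).

Lemma integral_cube_ub (f : T -> R) (L M : R) : 0 <= L -> (forall x, 0 <= f x <= M) ->
  vanishes_outside L f -> (\int[lambda]_x (f x)%:E <= (M * (2 * L) ^+ d)%:E)%E.
Proof.
move=> L0 fM fL; rewrite -integral_cube_cst// [leRHS]integral_mkcond.
apply: ge0_integral_mono => x _; first by rewrite lee_fin; case/andP: (fM x).
rewrite patchE; case: ifPn => [_|]; first by rewrite lee_fin; case/andP: (fM x).
by rewrite notin_setE => /fL ->.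
Qed.

Lemma integral_cube_lb (f : T -> R) (L m : R) : 0 <= L -> 0 <= m -> (forall x, 0 <= f x) ->
  (forall x, cube d L x -> m <= f x) -> ((m * (2 * L) ^+ d)%:E <= \int[lambda]_x (f x)%:E)%E.
Proof.
move=> L0 m0 f0 fm; rewrite -integral_cube_cst// [leLHS]integral_mkcond.
apply: ge0_integral_mono => x _; rewrite patchE; case: ifPn => [|_].
- by rewrite lee_fin.
- exact: lexx.
- by rewrite inE => xL; rewrite lee_fin; exact: fm.
- by change (0%:E <= (f x)%:E)%E; rewrite lee_fin.
Qed.

Lemma partial_sqnorm i x : partial_derivative i (@sqnorm R d) x = 2 * x ord0 i.
Proof.
have dc (j : 'I_d) : is_derive x (delta_mx ord0 i) (fun x : 'rV[R]_d => x ord0 j) ((j == i)%:R : R).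
  by have [dc <-] := partial_coord i j x; exact/derivableP.
have := is_derive_sum (fun j => is_deriveX 2 (dc j)).
rewrite (_ : \sum_(j < d) _ = @sqnorm R d); last first.
  by apply/funext => y; rewrite fct_sumE.
move=> [_]; rewrite /partial_derivative => ->.
rewrite (bigD1 i)//= eqxx expr1 /GRing.scale/= mulr1 big1 ?addr0// => j /negPf ->.
by rewrite mulr0.
Qed.

(** Since [flat 1 t] is [exp(-1/t)] for [t > 0], this is the usual mollifier
    [exp(-1 / (1 - |x|^2 / eps^2))] on the ball of radius [eps]. *)
Definition bump (eps : R) (x : 'rV[R]_d) : R := flat (1 : {poly R}) (1 - sqnorm x / eps ^+ 2).

Section fixed_radius.
Variable eps : R.
Hypothesis eps0 : 0 < eps.

Lemma bump_arg_le1 x : 1 - sqnorm (x : 'rV[R]_d) / eps ^+ 2 <= 1.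
Proof. by rewrite gerBl divr_ge0 ?sqnorm_ge0 ?sqr_ge0. Qed.

Lemma bump_arg_le0 x : ~ cube d eps x -> 1 - sqnorm (x : 'rV[R]_d) / eps ^+ 2 <= 0.
Proof.
move=> xe; rewrite subr_le0 ler_pdivlMr ?exprn_gt0// mul1r.
by apply: sqnorm_notin_cube => //; exact: ltW.
Qed.

Lemma class_C_bump_arg k : class_C k (fun x : 'rV[R]_d => 1 - sqnorm x / eps ^+ 2).
Proof.
apply: (class_CB (class_C_cst k 1)).
exact: (class_CM (class_C_sqnorm k) (class_C_cst k (eps ^+ 2)^-1)).
Qed.

Lemma vanishes_outside_bump : vanishes_outside eps (bump eps).
Proof. by move=> x /bump_arg_le0 h; rewrite /bump /flat ltNge h. Qed.

Lemma test_function_bump : test_function (bump eps).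
Proof.
apply/test_functionP; split; last first.
  by exists eps; [exact: ltW|exact: vanishes_outside_bump].
by move=> k; apply: (@class_C_flat R d (1 : {poly R}) k (fun x => 1 - sqnorm x / eps ^+ 2)) => j; exact: class_C_bump_arg.
Qed.

Lemma bump_itv x : 0 <= bump eps x <= 1.
Proof.
rewrite /bump /flat; case: ltP => [h|_]; last by rewrite lexx ler01.
by rewrite hornerC mul1r expR_ge0/= -[leRHS]expR0 ler_expR oppr_le0 invr_ge0 ltW.
Qed.

(** On this cube [|x|^2 <= eps^2 / (4 d)], so the argument of [flat] is at least 1/2, and
    [exp(-1/t) >= exp(-2)] there. *)
Lemma bump_lb x : (0 < d)%N -> cube d (eps / (2 * d%:R)) x -> expR (- 2) <= bump eps x.
Proof.
move=> dgt0 xc; have d0 : 0 < d%:R :> R by rewrite ltr0n.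
have d1 : 1 <= d%:R :> R by rewrite ler1n.
have h : 2^-1 <= 1 - sqnorm x / eps ^+ 2.
  rewrite lerBrDl -lerBrDr ler_pdivrMr ?exprn_gt0//.
  apply: (le_trans (sqnorm_cube xc)).
  have -> : d%:R * (eps / (2 * d%:R)) ^+ 2 = eps ^+ 2 / (4 * d%:R) by field; rewrite gt_eqF.
  rewrite ler_pdivrMr ?mulr_gt0// mulrAC ler_peMl ?sqr_ge0//; lra.
have h0 : 0 < 1 - sqnorm x / eps ^+ 2 by apply: lt_le_trans h; rewrite invr_gt0.
rewrite /bump /flat h0 hornerC mul1r ler_expR lerN2.
by rewrite -[leRHS]invrK lef_pV2// posrE invr_gt0.
Qed.

(** By the chain rule: the derivative of the profile is at most [C], its argument being at most 1,
    and the inner derivative [2 x_i / eps^2] is at most [2 / eps] in absolute value on the cube. *)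
Lemma sqgrad_bump_le C : (forall t : R, `|flat (flat_step (1 : {poly R})) t| <= C * t ^+ 2) ->
  forall x, sqgrad (bump eps) x <= d%:R * (C * (2 / eps)) ^+ 2.
Proof.
move=> hC x.
have C0 : 0 <= C by have := le_trans (normr_ge0 _) (hC 1); rewrite expr1n mulr1.
have [xe|xe] := pselect (cube d eps x); last first.
  by rewrite (vanishes_outside_sqgrad vanishes_outside_bump xe) mulr_ge0// sqr_ge0.
rewrite /sqgrad; apply: (@le_trans _ _ (\sum_(i < d) (C * (2 / eps)) ^+ 2)); last first.
  by rewrite sumr_const card_ord -[leLHS]mulr_natl.
apply: ler_sum => i _.
pose s (x : 'rV[R]_d) := 1 - sqnorm x / eps ^+ 2.
have ds : derivable s x (delta_mx ord0 i) := ((class_C_bump_arg 1).2 i).1 x.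
have [_ ->] := partial_comp ds (is_derive_flat (1 : {poly R}) (s x)).
have dsE : partial_derivative i s x = - (2 * x ord0 i / eps ^+ 2).
  have dq y := ((class_C_sqnorm (R := R) (d := d) 1).2 i).1 y.
  have dk (k : R) y : derivable (fun _ : 'rV[R]_d => k) y (delta_mx ord0 i) by exact: derivable_cst.
  have k0 (k : R) : partial_derivative i (fun _ : 'rV[R]_d => k) = fun=> 0.
    by apply/funext => y; exact: derive_cst.
  pose c := (eps ^+ 2)^-1.
  have e2 := congr1 (fun f => f x) (partialM dq (dk c)).
  have e1 : partial_derivative i s x =
      partial_derivative i (fun=> 1) x - partial_derivative i (@sqnorm R d \* (fun=> c)) x.
    exact: (congr1 (fun f => f x) (partialB (dk 1) (fun y => derivableM (dq y) (dk c y)))).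
  rewrite e1 (k0 1) e2 /= (k0 c) partial_sqnorm /c; ring.
rewrite dsE -real_normK ?num_real// lerXn2r ?nnegrE//.
  by rewrite mulr_ge0// divr_ge0// ltW.
rewrite normrM; apply: ler_pM => //.
  have [s0|s0] := ltP 0 (s x); last by rewrite /flat ltNge s0/= normr0.
  apply: le_trans (hC _) _; apply: ler_piMr => //.
  by apply: exprn_ile1; [exact: ltW|exact: bump_arg_le1].
rewrite normrN !normrM normfV ger0_norm// (ger0_norm (sqr_ge0 _)).
have : `|x ord0 i| <= eps by have := xe i; rewrite /= in_itv/= -ler_norml.
move=> xi; rewrite ler_pdivrMr ?exprn_gt0// -mulrA ler_wpM2l//.
by rewrite (_ : eps^-1 * eps ^+ 2 = eps)//; field; rewrite gt_eqF.
Qed.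

End fixed_radius.
End bump.

(** * Blow-up of the constant *)

Section blow_up.
Context {R : realType} {d : nat}.
Notation T := 'rV[measurableTypeR R]_d.
Notation lambda := (lebesgue_rV d).
Variable D : R.
Hypotheses (d3 : (3 <= d)%N) (D0 : 0 < D).

Lemma weight_ub p (x : 'rV[R]_d) : weight D p x <= D `^ (- (p%:R / 2)).
Proof. by rewrite ler_powRN ?divr_ge0// lerDl sqnorm_ge0. Qed.

Lemma weight_lb p (x : 'rV[R]_d) : cube d 1 x -> (D + d%:R) `^ (- (p%:R / 2)) <= weight D p x.
Proof.
move=> x1; rewrite ler_powRN ?divr_ge0//; first by rewrite ltr_pwDl// sqnorm_ge0.
by rewrite lerD2l; apply: le_trans (sqnorm_cube x1) _; rewrite expr1n mulr1.
Qed.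

(** For [eps <= 1] the bump lives in the unit cube, where the weights lie between positive
    constants; only the scaling of Lebesgue measure and of the gradient is left. *)
Lemma bump_estimates : exists a b c : R, [/\ 0 < a, 0 < b, 0 < c &
  forall eps : R, 0 < eps -> eps <= 1 ->
  [/\ ((a * eps ^+ d)%:E <= \int[lambda]_x (bump eps x ^+ 2 * weight D d x)%:E)%E,
      (0 < \int[lambda]_x (`|bump eps x| * weight D d x)%:E)%E,
      (\int[lambda]_x (`|bump eps x| * weight D d x)%:E <= (c * eps ^+ d)%:E)%E &
      (dirichlet_form D (bump eps : 'rV[R]_d -> R) <= (b * eps ^+ (d - 2))%:E)%E]].
Proof.
have [C C0 hC] : exists2 C : R, 0 < C & forall t : R, `|flat (flat_step (1 : {poly R})) t| <= C * t ^+ 2.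
  have [C C0 hC] := flat_le_sqr (flat_step (1 : {poly R})).
  exists (C + 1); first by rewrite ltr_wpDl.
  by move=> t; apply: le_trans (hC t) _; rewrite ler_wpM2r ?sqr_ge0// lerDl.
have d0 : 0 < d%:R :> R by rewrite ltr0n (ltn_trans _ d3).
have d1 : 1 <= d%:R :> R by rewrite ler1n (ltn_trans _ d3).
pose w1 : R := (D + d%:R) `^ (- (d%:R / 2)).
have w1gt : 0 < w1 by rewrite powR_gt0// addr_gt0.
pose w2 p : R := D `^ (- (p%:R / 2)).
have w2gt p : 0 < w2 p by exact: powR_gt0.
have e2 : 0 < expR (- 2) :> R by exact: expR_gt0.
exists (expR (- 2) ^+ 2 * w1 * d%:R^-1 ^+ d), (d%:R * (C * 2) ^+ 2 * w2 (d - 2)%N * 2 ^+ d), (w2 d * 2 ^+ d).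
split.
- by rewrite !mulr_gt0// ?exprn_gt0// invr_gt0.
- by rewrite !mulr_gt0// ?exprn_gt0// mulr_gt0.
- by rewrite mulr_gt0// exprn_gt0.
move=> eps eps0 eps1.
have L0 : 0 <= eps / (2 * d%:R) by rewrite divr_ge0 ?ltW// mulr_gt0.
have L1 : eps / (2 * d%:R) <= 1.
  by rewrite ler_pdivrMr ?mulr_gt0// mul1r; lra.
have LE : 2 * (eps / (2 * d%:R)) = d%:R^-1 * eps by field; rewrite gt_eqF.
have lb x : cube d (eps / (2 * d%:R)) x -> expR (- 2) <= bump eps x /\ w1 <= weight D d x.
  move=> xL; split; first by apply: bump_lb => //; exact: ltn_trans d3.
  by apply: weight_lb; exact: subset_cube xL.
have b0 x : 0 <= bump eps x by case/andP: (bump_itv eps x).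
have b1 x : bump eps x <= 1 by case/andP: (bump_itv eps x).
have wge p x : 0 <= weight D p x by exact: powR_ge0.
split.
- apply: (@le_trans _ _ ((expR (- 2) ^+ 2 * w1) * (2 * (eps / (2 * d%:R))) ^+ d)%:E).
    by rewrite LE exprMn mulrA.
  apply: integral_cube_lb => // [|x|x xL].
  + by rewrite mulr_ge0 ?sqr_ge0// ltW.
  + by rewrite mulr_ge0 ?sqr_ge0.
  + have [h1 h2] := lb x xL; apply: ler_pM => //; first exact: ltW.
    by rewrite lerXn2r ?nnegrE// ltW.
- apply: (@lt_le_trans _ _ ((expR (- 2) * w1) * (2 * (eps / (2 * d%:R))) ^+ d)%:E).
    by rewrite lte_fin LE !mulr_gt0// exprn_gt0// mulr_gt0// invr_gt0.
  apply: integral_cube_lb => // [|x|x xL].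
  + by rewrite mulr_ge0// ltW.
  + by rewrite mulr_ge0.
  + have [h1 h2] := lb x xL; rewrite ger0_norm//; apply: ler_pM => //; exact: ltW.
- apply: (@le_trans _ _ (w2 d * (2 * eps) ^+ d)%:E); last by rewrite exprMn mulrA.
  apply: integral_cube_ub => //; first exact: ltW.
    move=> x; rewrite mulr_ge0//= ger0_norm// -[leRHS]mul1r; apply: ler_pM => //.
    exact: weight_ub.
  by move=> x xe; rewrite vanishes_outside_bump// normr0 mul0r.
- rewrite dirichlet_formE//.
  apply: (@le_trans _ _ (d%:R * (C * (2 / eps)) ^+ 2 * w2 (d - 2)%N * (2 * eps) ^+ d)%:E).
    apply: integral_cube_ub => //; first exact: ltW.
      move=> x; rewrite mulr_ge0 ?sqgrad_ge0//=; apply: ler_pM => //.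
      - exact: sqgrad_ge0.
      - exact: sqgrad_bump_le.
      - exact: weight_ub.
    by move=> x xe; rewrite (vanishes_outside_sqgrad (vanishes_outside_bump eps0)) ?mul0r.
  have -> : (2 * eps) ^+ d = 2 ^+ d * (eps ^+ (d - 2) * eps ^+ 2).
    by rewrite -exprD subnK ?(ltnW d3)// exprMn.
  rewrite lee_fin le_eqVlt; apply/orP; left; apply/eqP.
  move: (2 ^+ d) (w2 _) (eps ^+ (d - 2)) => u v z; field.
  by rewrite gt_eqF.
Qed.

Lemma test_function_form_domain (f : 'rV[R]_d -> R) : test_function f ->
  f \in Lfun (mu_star D) 2%:E /\ form_domain D f.
Proof.
move=> tf; have ccf := test_function_Cc tf.
have mf : measurable_fun [set: T] f by apply: continuous_measurable_rV; exact: ccf.1.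
have L2 : f \in Lfun (mu_star D) 2%:E.
  rewrite inE; apply/andP; split; rewrite inE//= /finite_norm.
  have : ('N[mu_star D]_2%:E[EFin \o f] ^+ 2 < +oo)%E.
    rewrite sqr_Lnorm2//.
    have cc : Cc (fun x => f x ^+ 2 * weight D d x).
      rewrite (_ : (fun _ => _) = (f \* f) \* weight D d); last first.
        by apply/funext => x; rewrite /= expr2.
      by apply: CcMr; [exact: CcMl ccf.1 ccf|exact: continuous_shift_powR].
    have /integrableP[_] := Cc_integrable cc.
    apply: le_lt_trans; apply: ge0_integral_mono => x _; last by rewrite lee_fin ler_norm.
    by rewrite lee_fin mulr_ge0 ?sqr_ge0 ?powR_ge0.
  by move: (Lnorm_ge0 (mu_star D) 2%:E (EFin \o f)); case: ('N[_]__[_])%E => [r||]//; rewrite ?ltry// expe2 mulyy.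
split => //; split => //; exists (fun=> f); split => //.
  rewrite (_ : EFin \o (f \- f)%R = cst 0%E); last first.
    by apply/funext => x /=; rewrite subrr.
  by rewrite Lnorm0//; exact: cvg_cst.
move=> e e0; exists 0%N => m n _ _.
rewrite (_ : (f \- f)%R = fun=> 0); last by apply/funext => x; rewrite /= subrr.
rewrite /dirichlet_form integral0_eq ?lee_fin ?ltW// => x _.
rewrite /sqgrad big1 ?mul0r// => i _; rewrite /partial_derivative.
by rewrite (derive_cst (0 : R)) expr0n.
Qed.

(** The bump is chosen after [M], and [c0] is its ratio of energy to squared L^1 norm; every larger
    [c] also admits this bump as a test. *)
Lemma gagliardo_nirenberg_constant_lb (M : R) : 0 < M -> exists c0 : R,
  forall c K : R, c0 <= c -> gagliardo_nirenberg_on d D c K -> M <= K.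
Proof.
move=> M0; have [a [b [c [a0 b0 c0 est]]]] := bump_estimates.
(* If [K < M], the cubed inequality gives [a^3 eps^(3d) <= B eps^(5d-2)]; the factor 2 is that of
   [closed_form_test_le]. The choice of [eps] below contradicts this. *)
pose B := 2 * (M ^+ 3 * b * c ^+ 4).
have B0 : 0 < B by rewrite !mulr_gt0// exprn_gt0.
pose eps := Num.min 1 (a ^+ 3 / (2 * B)).
have a3 : 0 < a ^+ 3 by rewrite exprn_gt0.
have eps0 : 0 < eps by rewrite lt_min ltr01 divr_gt0// mulr_gt0.
have eps1 : eps <= 1 by rewrite ge_min lexx.
have epsB : B * eps < a ^+ 3.
  apply: (@le_lt_trans _ _ (B * (a ^+ 3 / (2 * B)))).
    by apply: ler_wpM2l; [exact: ltW|rewrite ge_min lexx orbT].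
  have -> : B * (a ^+ 3 / (2 * B)) = a ^+ 3 / 2 by field; rewrite gt_eqF.
  by rewrite ltr_pdivrMr// ltr_pMr// ltr1n.
have [h1 h2 h3 h4] := est eps eps0 eps1.
pose u : 'rV[R]_d -> R := bump eps.
have tu : test_function u by exact: test_function_bump.
have mu : measurable_fun [set: T] u.
  by apply: continuous_measurable_rV; exact: (tu.1 0%N).
have [uL uD] := test_function_form_domain tu.
have Jq := closed_form_test_le D0 tu uD.
have [phi [J [_ J0 JE _]]] := closed_formP D0 uD.
have {Jq h4} hJ : J <= 2 * (b * eps ^+ (d - 2)).
  rewrite -lee_fin -JE; apply: (le_trans Jq); rewrite [leRHS]EFinM.
  by apply: lee_wpmul2l.
rewrite -sqr_Lnorm2// in h1; rewrite -!Lnorm1_mu_star// in h2 h3.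
have [n1 n1E] : exists n1, 'N[mu_star D]_1[EFin \o u]%E = n1%:E.
  by move: h2 h3; case: ('N[_]__[_])%E => [r||]// _ _; exists r.
rewrite n1E lte_fin in h2; rewrite n1E lee_fin in h3.
exists (J / n1 ^+ 2) => c' K hc /(_ u uL uD).
rewrite JE n1E -EFin_expe inver gt_eqF ?exprn_gt0// -EFinM lee_fin => /(_ hc).
move=> /(le_trans h1); rewrite !poweR_EFin -!EFinM lee_fin => h.
rewrite leNgt; apply/negP => KM.
pose P := J `^ (1 / 3) * n1 `^ (4 / 3).
have P0 : 0 <= P by rewrite mulr_ge0// powR_ge0.
have P3 : P ^+ 3 = J * n1 ^+ 4.
  rewrite exprMn powR_third//; congr (_ * _).
  by rewrite -!powR_mulrn ?powR_ge0 ?(ltW h2)// -powRrM -mulrA mulVf ?pnatr_eq0// mulr1.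
have {}h : a * eps ^+ d <= M * P.
  by apply: (le_trans h); rewrite -mulrA ler_wpM2r// ltW.
have e30 : 0 < eps ^+ d by rewrite exprn_gt0.
have : (a * eps ^+ d) ^+ 3 <= (M * P) ^+ 3.
  by rewrite lerXn2r ?nnegrE// mulr_ge0// ltW.
apply/negP; rewrite -ltNge [ltLHS]exprMn P3 [ltRHS]exprMn.
apply: (@le_lt_trans _ _ (M ^+ 3 * (2 * (b * eps ^+ (d - 2)) * (c * eps ^+ d) ^+ 4))).
  apply: ler_wpM2l; first by rewrite exprn_ge0// ltW.
  apply: ler_pM => //; first by rewrite exprn_ge0// ltW.
  by rewrite lerXn2r ?nnegrE//; [exact: ltW|apply: ltW; exact: mulr_gt0].
apply: (@le_lt_trans _ _ (B * eps * (eps ^+ d) ^+ 3)); last by rewrite ltr_pM2r// exprn_gt0.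
have -> : M ^+ 3 * (2 * (b * eps ^+ (d - 2)) * (c * eps ^+ d) ^+ 4) =
    B * (eps ^+ (d - 2) * eps ^+ d) * (eps ^+ d) ^+ 3.
  by rewrite /B; move: (eps ^+ d) (eps ^+ (d - 2)) => y z; ring.
apply: ler_wpM2r; first exact/exprn_ge0/ltW.
apply: ler_wpM2l; first exact: ltW.
(* The surplus power is [2d - 2 >= 1], and [eps <= 1]. *)
rewrite -exprD -[leRHS]expr1; apply: ler_wiXn2l => //; first exact: ltW.
by rewrite addn_gt0 (ltn_trans _ d3) ?orbT.
Qed.

End blow_up.

(** An admissible constant may always be enlarged, so divergence of one [K] would say little; the
    second clause makes it a property of the inequality itself. *)
Theorem proposition4p10 (R : realType) (d : nat) (D : R) :
  (3 <= d)%N -> 0 < D ->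
  (exists K : R -> R,
     (forall c0 : R, 0 < c0 ->
        0 < K c0 /\ gagliardo_nirenberg_on d D c0 (K c0)) /\
     K c0 @[c0 --> +oo] --> +oo) /\
  (forall K : R -> R,
     (forall c0 : R, 0 < c0 -> gagliardo_nirenberg_on d D c0 (K c0)) ->
     K c0 @[c0 --> +oo] --> +oo).
Proof.
move=> d3 D0.
have blow_up (K : R -> R) : (forall c0 : R, 0 < c0 -> gagliardo_nirenberg_on d D c0 (K c0)) ->
    K c0 @[c0 --> +oo] --> +oo.
  move=> hK; apply/cvgryPge => A.
  have M0 : 0 < Num.max A 1 by rewrite lt_max ltr01 orbT.
  have [c1 hc1] := gagliardo_nirenberg_constant_lb d3 D0 M0.
  near=> c0; apply: (@le_trans _ _ (Num.max A 1)); first by rewrite le_max lexx.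
  apply: (hc1 c0); first by near: c0; apply: nbhs_pinfty_ge; rewrite num_real.
  by apply: hK; near: c0; apply: nbhs_pinfty_gt; rewrite num_real.
split; last exact: blow_up.
have [C C0 hC] := exists_gagliardo_nirenberg d3 D0.
exists (fun c0 => C * (1 + c0)); split; last exact: blow_up.
by move=> c0 c00; split; [rewrite mulr_gt0// addr_gt0|exact: hC].
Unshelve. all: by end_near.
Qed.
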